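(* Let $\Omega$ be a bounded domain in $\mathbb{C}^n$ and $g \in C(\partial \Omega)$. Assume that: (i) $f \in C(\overline{\Omega} \times \mathbb{R})$ is non-negative and for any fixed $z\in \Omega$, $f(z, \cdot )$ is non-decreasing; (ii) there exists a harmonic function $\overline{u}$ in $\Omega$ with boundary value $g$ (i.e. $\overline u\in C(\overline\Omega)$, $\overline u$ harmonic in $\Omega$, $\overline u=g$ on $\partial\Omega$); (iii) there exists a viscosity subsolution $\underline{u} \in C(\overline{\Omega})$ of $M_{\mathbb{C}}(\cdot)=f(z,\cdot)$ in $\Omega$ such that $\underline{u} =g$ on $\partial \Omega$. Then there exists a unique viscosity solution of the Dirichlet problem $$M_{\mathbb{C}}(u)=f(z,u)\ \text{ in }\Omega,\qquad u=g\ \text{ on }\partial\Omega,\qquad u\in PSH(\Omega)\cap C(\overline\Omega).$$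
   Context: $PSH(\Omega)$ is the space of plurisubharmonic functions on $\Omega$; ''harmonic'' is with respect to the Euclidean Laplacian on $\mathbb{C}^n\cong\mathbb{R}^{2n}$. For a $C^2$ function $\varphi$, $M_{\mathbb{C}}(\varphi) := \det(2\varphi_{\bar j i})$, where $\varphi_{\bar j i} = \partial^2\varphi/\partial z^i\partial \bar z^j$. $T^+(n)$ is the set of polynomials $p(z) = \sum_{i,j} A_{\bar j i} z^i \bar z^j$ with $A=(A_{\bar j i})$ a non-negative Hermitian $n\times n$ matrix, so that $M_{\mathbb{C}}(p)=\det(2A)$ is constant. $H(n)$ is the space of holomorphic polynomials in $z^1,\dots,z^n$ of degree at most $2$. A continuous function $\varphi$ touches $u$ from above (resp. below) at $z_0$ if $\varphi(z_0)=u(z_0)$ and $\varphi\ge u$ (resp. $\varphi\le u$) in some open neighborhood of $z_0$. A continuous plurisubharmonic function $u$ on $\Omega$ is a viscosity subsolution (resp. supersolution) of $M_{\mathbb{C}}(\cdot)=f(z,\cdot)$ if: for any $p\in T^+(n)$, if there exists $h\in H(n)$ such that $p+\mathrm{Re}(h)$ touches $u$ from above (resp. below) at some $z_0\in\Omega$, then $M_{\mathbb{C}}(p)\ge f(z_0,u(z_0))$ (resp. $M_{\mathbb{C}}(p)\le f(z_0,u(z_0))$). A viscosity solution is a function which is both a viscosity subsolution and a viscosity supersolution; a viscosity solution of the Dirichlet problem is a viscosity solution of the equation in $\Omega$ that belongs to $PSH(\Omega)\cap C(\overline\Omega)$ and equals $g$ on $\partial\Omega$. *)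

(* Defs.v *)
From HB Require Import structures.
From mathcomp Require Import all_boot all_order all_algebra.
From mathcomp Require Import complex.
From mathcomp Require Import all_classical all_reals all_analysis.

Set Implicit Arguments.
Unset Strict Implicit.
Unset Printing Implicit Defensive.

Import Order.TTheory GRing.Theory Num.Theory.
Import numFieldNormedType.Exports.

Local Open Scope classical_set_scope.
Local Open Scope ring_scope.
Local Open Scope complex_scope.

(* The metric topology of C, needed for that of C^n = 'rV[R[i]]_n. *)
HB.instance Definition _ (R : realType) := NormedModule.copy R[i] R[i]^o.

Notation "''CV[' R ]_ n" := 'rV[R[i]]_n
  (at level 0, n at level 2, format "''CV[' R ]_ n") : type_scope.

Section Domains.
Variables (R : realType) (n : nat).
Implicit Types (Om : set 'CV[R]_n).

Definition boundary Om : set 'CV[R]_n := closure Om `\` Om°.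

Definition bounded_domain Om : Prop :=
  [/\ open Om, connected Om, Om !=set0 & bounded_set Om].

End Domains.

Section Derivatives.
Variables (R : realType) (n : nat).
Implicit Types (u phi : 'CV[R]_n -> R) (Om : set 'CV[R]_n).

(* The 2n real coordinate directions of C^n = R^2n: with z^k = x^k + i y^k,
   (k, false) stands for x^k and (k, true) for y^k. *)
Definition real_coord : Type := ('I_n * bool)%type.

Definition coord_dir (a : real_coord) : 'CV[R]_n :=
  (if a.2 then 'i else 1) *: delta_mx ord0 a.1.

Definition coord_line u (a : real_coord) (z : 'CV[R]_n) : R -> R :=
  fun t => u (z + t%:C *: coord_dir a).

Definition pderiv (a : real_coord) u : 'CV[R]_n -> R :=
  fun z => derive1 (coord_line u a z) 0.

Definition C1_on Om u : Prop :=
  forall a : real_coord,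
    (forall z, Om z -> derivable (coord_line u a z) 0 1) /\
    {within Om, continuous (pderiv a u)}.

Definition C2_on Om u : Prop :=
  [/\ {within Om, continuous u}, C1_on Om u
    & forall a : real_coord, C1_on Om (pderiv a u)].

Definition laplacian u : 'CV[R]_n -> R :=
  fun z => \sum_(k < n) (pderiv (k, false) (pderiv (k, false) u) z
                         + pderiv (k, true) (pderiv (k, true) u) z).

Definition harmonic_on Om u : Prop :=
  C2_on Om u /\ forall z, Om z -> laplacian u z = 0.

(* d^2 phi / dz^i dzbar^j, from d/dz = (d/dx - i d/dy) / 2 and
   d/dzbar = (d/dx + i d/dy) / 2, applied to a real-valued phi. *)
Definition wirtinger2 phi (j i : 'I_n) (z : 'CV[R]_n) : R[i] :=
  4%:R^-1 * ((pderiv (i, false) (pderiv (j, false) phi) z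
              + pderiv (i, true) (pderiv (j, true) phi) z)%:C
             + 'i * (pderiv (i, false) (pderiv (j, true) phi) z
                     - pderiv (i, true) (pderiv (j, false) phi) z)%:C).

(* For C^2 functions the matrix is Hermitian, so its determinant is real and
   taking the real part loses nothing. *)
Definition MC phi (z : 'CV[R]_n) : R :=
  complex.Re (\det (\matrix_(j, i) (2%:R * wirtinger2 phi j i z))).

End Derivatives.

Section Psh.
Variables (R : realType) (n : nat).

(* Upper semicontinuity and the sub-mean value property on every circle whose
   closed disc is contained in the intersection of Om with a complex line. *)
Definition psh (Om : set 'CV[R]_n) (u : 'CV[R]_n -> \bar R) : Prop :=
  [/\ forall z, Om z -> (u z < +oo)%E,
      forall z, Om z -> forall c : R, (u z < c%:E)%E ->
        \forall w \near z, (u w < c%:E)%E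
    & forall a b : 'CV[R]_n,
        (forall zeta : R[i], `|zeta| <= 1 -> Om (a + zeta *: b)) ->
        (u a <= ((2 * pi)^-1)%R%:E *
           \int[lebesgue_measure]_(t in `[0%R, (2 * pi)%R]%classic)
             u (a + (cos t +i* sin t) *: b)%R)%E].

End Psh.

Section Viscosity.
Variables (R : realType) (n : nat).
Implicit Types (Om : set 'CV[R]_n) (u : 'CV[R]_n -> R) (f : 'CV[R]_n -> R -> R).

Definition nonneg_hermitian (A : 'M[R[i]]_n) : Prop :=
  A \is hermsymmx /\
  forall w : 'CV[R]_n, 0 <= \sum_(i < n) \sum_(j < n) A j i * w 0 i * (w 0 j)^*.

(* The sum is real because A is Hermitian. *)
Definition hermitian_form (A : 'M[R[i]]_n) : 'CV[R]_n -> R :=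
  fun z => complex.Re (\sum_(i < n) \sum_(j < n) A j i * z 0 i * (z 0 j)^*).

Definition Tplus : set ('CV[R]_n -> R) :=
  [set hermitian_form A | A in nonneg_hermitian].

Definition poly_deg2 (c : R[i]) (b : 'CV[R]_n) (Q : 'M[R[i]]_n) :
    'CV[R]_n -> R[i] :=
  fun z => c + \sum_(i < n) b 0 i * z 0 i
           + \sum_(i < n) \sum_(j < n) Q i j * z 0 i * z 0 j.

Definition Hquad : set ('CV[R]_n -> R[i]) :=
  [set h | exists c b Q, h = poly_deg2 c b Q].

Definition re_fun (h : 'CV[R]_n -> R[i]) : 'CV[R]_n -> R :=
  fun z => complex.Re (h z).

Definition touches_above (phi u : 'CV[R]_n -> R) (z0 : 'CV[R]_n) : Prop :=
  phi z0 = u z0 /\ \forall z \near z0, u z <= phi z.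

Definition touches_below (phi u : 'CV[R]_n -> R) (z0 : 'CV[R]_n) : Prop :=
  phi z0 = u z0 /\ \forall z \near z0, phi z <= u z.

Definition continuous_psh Om u : Prop :=
  {within Om, continuous u} /\ psh Om (EFin \o u).

Definition viscosity_subsolution Om f u : Prop :=
  continuous_psh Om u /\
  forall p, Tplus p -> forall z0, Om z0 ->
    (exists2 h, Hquad h & touches_above (p \+ re_fun h) u z0) ->
    f z0 (u z0) <= MC p z0.

Definition viscosity_supersolution Om f u : Prop :=
  continuous_psh Om u /\
  forall p, Tplus p -> forall z0, Om z0 ->
    (exists2 h, Hquad h & touches_below (p \+ re_fun h) u z0) ->
    MC p z0 <= f z0 (u z0).

Definition viscosity_solution Om f u : Prop :=
  viscosity_subsolution Om f u /\ viscosity_supersolution Om f u.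

Definition dirichlet_solution Om f (g : 'CV[R]_n -> R) u : Prop :=
  [/\ viscosity_solution Om f u,
      psh Om (EFin \o u),
      {within closure Om, continuous u}
    & forall z, boundary Om z -> u z = g z].

End Viscosity.

(* Main.v *)
(* The Monge-Ampere inequality is a family of linear ones: by the arithmetic-geometric
   mean, det A >= c^n for A >= 0 amounts to Re tr (C^* A C) >= n c for all |det C| = 1.
   Viscosity subsolutions of such a linear inequality are closed under sums (on a small
   sphere each summand is replaced by a harmonic polynomial), hence under averaging over
   small boxes, and box averages are C^2. So a subsolution u of the Monge-Ampere equation
   is uniformly approximated on compact sets by C^2 functions which, after adding
   e |z|^2, are strict subsolutions. At a maximum of this C^2 function minus a
   supersolution v, its Taylor polynomial touches v from below: this gives the comparison
   principle, whence uniqueness.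

   Existence is Perron's method. The supremum U of all subsolutions above usub with
   boundary values g lies below ubar, since a plurisubharmonic function is dominated by
   its harmonic majorant. For a competitor v, gluing usub and
   v(z + t) + eta (|z|^2 - c) - b gives again a competitor, so U(z + t) <= U(z) + eta c + b
   and U is uniformly continuous (Walsh). U is a subsolution because these are stable under
   limits, and a supersolution because otherwise the lifted test quadratic, glued to U,
   would be a competitor exceeding U.

   Testing against all quadratic polynomials, the viscosity inequality A >= 0 is
   plurisubharmonicity: one direction is the mean of a quadratic over a small circle; for
   the other, the box averages restrict to C^2 subharmonic functions on complex discs,
   which lie below harmonic polynomials, and these have the mean value property. *)

Require Import Defs.
From mathcomp Require Import all_boot all_order all_algebra.
From mathcomp Require Import complex.
From mathcomp Require Import all_classical all_reals all_analysis.
From mathcomp Require Import ring lra.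
Import Order.TTheory GRing.Theory Num.Theory.
Import numFieldNormedType.Exports.
Local Open Scope classical_set_scope.
Local Open Scope ring_scope.
Local Open Scope complex_scope.
Set Implicit Arguments.
Unset Strict Implicit.
Unset Printing Implicit Defensive.

(** The obstacle is that a viscosity subsolution has no Hessian, while the determinant, being
    nonlinear, does not pass through averages. Linear inequalities do, and on A > 0 the function
    det^(1/n) is the minimum of tr (C^* A C) / n over |det C| = 1. So every linear inequality is
    averaged separately, and the determinant is recovered only afterwards, from the C^2 average. The
    minimum is attained only for A > 0, hence the small multiples of |z|^2 that are added before
    returning to the determinant. Strictness cannot come from f, which is merely non-decreasing in
    u. It comes from det (A + s) >= det A + s^n for A >= 0, s >= 0 and n >= 1: adding s |z|^2 gains
    a fixed amount, which absorbs the oscillation of f between nearby points, both in the comparison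
    principle and for the translated competitors of Perron's method. The translation argument gives
    the supremum a modulus of continuity directly. The supremum is therefore itself a competitor,
    and the function that exceeds it in the supersolution argument can be glued to it. *)

Section PointwiseContinuity.
Variables (R : realType) (T : topologicalType).
Implicit Types f g : T -> R.

Lemma cts_add f g : continuous f -> continuous g -> continuous (fun x => f x + g x).
Proof. by move=> cf cg x; apply: continuousD; [exact: cf|exact: cg]. Qed.

Lemma cts_opp f : continuous f -> continuous (fun x => - f x).
Proof. by move=> cf x; apply: continuousN; exact: cf. Qed.

Lemma cts_sub f g : continuous f -> continuous g -> continuous (fun x => f x - g x).
Proof. by move=> cf cg; apply: cts_add => //; exact: cts_opp. Qed.

Lemma cts_mul f g : continuous f -> continuous g -> continuous (fun x => f x * g x).
Proof. by move=> cf cg x; apply: continuousM; [exact: cf|exact: cg]. Qed.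

Lemma cts_cst (c : R) : continuous (fun _ : T => c).
Proof. by move=> x; exact: cst_continuous. Qed.

Lemma eq_cts f g : f =1 g -> continuous f -> continuous g.
Proof. by move=> /funext ->. Qed.

End PointwiseContinuity.

(** * Real coordinates on C^n *)

Section RealCoordinates.
Variables (R : realType) (n : nat).
Implicit Types (z w : 'CV[R]_n) (a : real_coord n).

Definition rc a z : R :=
  if a.2 then complex.Im (z 0 a.1) else complex.Re (z 0 a.1).

(** The squared Euclidean norm. It is real-valued and itself a test quadratic, whereas the norm of
    ['rV[R[i]]_n] is a maximum of moduli with values in [R[i]]. Radii paired with [N2] bound squared
    distances. *)
Definition N2 z : R := \sum_a rc a z ^+ 2.

Definition of_rc (x : real_coord n -> R) : 'CV[R]_n :=
  \row_k (x (k, false) +i* x (k, true)).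

Lemma ReD (x y : R[i]) : complex.Re (x + y) = complex.Re x + complex.Re y.
Proof. by case: x; case: y. Qed.

Lemma ImD (x y : R[i]) : complex.Im (x + y) = complex.Im x + complex.Im y.
Proof. by case: x; case: y. Qed.

Lemma ReZ (t : R) (x : R[i]) : complex.Re (t%:C * x) = t * complex.Re x.
Proof. by case: x => x y /=; rewrite mul0r subr0. Qed.

Lemma ImZ (t : R) (x : R[i]) : complex.Im (t%:C * x) = t * complex.Im x.
Proof. by case: x => x y /=; rewrite mul0r addr0. Qed.

Lemma Re_sum (I : Type) (r : seq I) (P : pred I) (F : I -> R[i]) :
  complex.Re (\sum_(i <- r | P i) F i) = \sum_(i <- r | P i) complex.Re (F i).
Proof. exact: (big_morph (@complex.Re R) ReD). Qed.

Lemma rcD a z w : rc a (z + w) = rc a z + rc a w.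
Proof. by rewrite /rc mxE; case: a.2; rewrite ?ReD ?ImD. Qed.

Lemma rcZ a (t : R) z : rc a (t%:C *: z) = t * rc a z.
Proof. by rewrite /rc mxE; case: a.2; rewrite ?ReZ ?ImZ. Qed.

Lemma rcN a z : rc a (- z) = - rc a z.
Proof. by rewrite /rc mxE; case: a.2; case: (z 0 a.1). Qed.

Lemma rcB a z w : rc a (z - w) = rc a z - rc a w.
Proof. by rewrite rcD rcN. Qed.

Lemma rc0 a : rc a 0 = 0.
Proof. by rewrite /rc mxE; case: a.2. Qed.

Lemma of_rcK a x : rc a (of_rc x) = x a.
Proof. by case: a => k [] /=; rewrite /rc /= mxE. Qed.

Lemma rc_inj z w : (forall a, rc a z = rc a w) -> z = w.
Proof.
move=> H; apply/rowP => k.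
by move: (H (k, false)) (H (k, true)); rewrite /rc /=; case: (z 0 k); case: (w 0 k) => ? ? ? ? /= -> ->.
Qed.

Lemma rc_coord_dir a b : rc a (coord_dir R b) = (a == b)%:R.
Proof.
case: a b => [i c] [j d]; rewrite /rc /coord_dir /= mxE mxE eqxx /= xpair_eqE.
by case: c; case: d; case: (i == j) => /=; ring.
Qed.

Lemma N2_ge0 z : 0 <= N2 z.
Proof. by apply: sumr_ge0 => a _; exact: sqr_ge0. Qed.

Lemma N2_0 : N2 0 = 0.
Proof. by rewrite /N2 big1 // => a _; rewrite rc0 expr0n. Qed.

Lemma N2N z : N2 (- z) = N2 z.
Proof. by apply: eq_bigr => a _; rewrite rcN sqrrN. Qed.

Lemma N2C z w : N2 (z - w) = N2 (w - z).
Proof. by rewrite -N2N opprB. Qed.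

Lemma N2Z (t : R) z : N2 (t%:C *: z) = t ^+ 2 * N2 z.
Proof. by rewrite /N2 mulr_sumr; apply: eq_bigr => a _; rewrite rcZ exprMn. Qed.

Lemma N2_eq0 z : N2 z = 0 -> z = 0.
Proof.
move=> /eqP; rewrite psumr_eq0; last by move=> a _; exact: sqr_ge0.
move=> /allP H; apply: rc_inj => a; rewrite rc0; apply/eqP.
by move: (H a (mem_index_enum a)); rewrite /= sqrf_eq0.
Qed.

Lemma N2_gt0 z : z != 0 -> 0 < N2 z.
Proof.
move=> z0; rewrite lt_neqAle N2_ge0 andbT; apply/negP => /eqP/esym/N2_eq0 zE.
by rewrite zE eqxx in z0.
Qed.

Lemma rc_le_N2 a z : rc a z ^+ 2 <= N2 z.
Proof.
rewrite /N2 (bigD1 a) //= lerDl; apply: sumr_ge0 => b _; exact: sqr_ge0.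
Qed.

Lemma N2D z w : N2 (z + w) <= 2 * N2 z + 2 * N2 w.
Proof.
rewrite /N2 !mulr_sumr -big_split; apply: ler_sum => a _ /=; rewrite rcD.
have := sqr_ge0 (rc a z - rc a w); nra.
Qed.

Lemma N2_lt_triangle z w y (r : R) :
  N2 (z - w) < r / 4 -> N2 (w - y) < r / 4 -> N2 (z - y) < r.
Proof.
move=> h1 h2; have -> : z - y = (z - w) + (w - y) by rewrite addrA subrK.
by apply: le_lt_trans (N2D _ _) _; lra.
Qed.

Lemma N2_complex z : N2 z = \sum_k Normc.normc (z 0 k) ^+ 2.
Proof.
rewrite /N2 -(pair_big xpredT xpredT (fun k c => rc (k, c) z ^+ 2)) /=.
apply: eq_bigr => k _; rewrite big_bool /= /rc /= addrC.
case: (z 0 k) => x y /=; rewrite sqr_sqrtr //.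
by rewrite addr_ge0 // sqr_ge0.
Qed.

Lemma nbhsN2P z0 (P : set 'CV[R]_n) :
  nbhs z0 P <-> exists2 r : R, 0 < r & forall z, N2 (z - z0) < r -> P z.
Proof.
split.
- move=> /nbhs_ballP [e /= e0 eP].
  (* In the order of [R[i]], a positive number is real. *)
  have [r r0 er] : exists2 r : R, 0 < r & e = r%:C.
    by move: e0 {eP}; case: e => x y; rewrite ltcE /= => /andP[/eqP -> x0]; exists x.
  exists (r ^+ 2); first exact: exprn_gt0.
  move=> z zr; apply: eP; rewrite er; split=> [|i j]; first by rewrite ltcR.
  rewrite (ord1 i) /ball /= -subr_lt0.
  have : Normc.normc (z 0 j - z0 0 j) ^+ 2 < r ^+ 2.
    apply: le_lt_trans zr; rewrite N2_complex (bigD1 j) //= !mxE lerDl.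
    by apply: sumr_ge0 => b _; exact: sqr_ge0.
  rewrite ltr_pXn2r // ?nnegrE ?(ltW r0) //; last first.
    by case: (_ - _) => ? ?; rewrite /= sqrtr_ge0.
  rewrite subr_lt0 distrC => h; rewrite -[`|_|]/((Normc.normc (z 0 j - z0 0 j))%:C).
  by rewrite ltcR.
- move=> [r r0 rP]; apply/nbhs_ballP.
  (* Each of the n coordinates contributes at most r / (n + 1), so the sum stays strictly below r,
     also for n = 0. *)
  pose s := Num.sqrt (r / n.+1%:R).
  have r1 : 0 < r / n.+1%:R by rewrite divr_gt0.
  exists s%:C => /=; first by rewrite ltcR sqrtr_gt0.
  move=> z bz; apply: rP; rewrite N2_complex.
  apply: (@le_lt_trans _ _ (\sum_(k < n) (r / n.+1%:R))); last first.
    rewrite sumr_const card_ord -[X in X < _]mulr_natl mulrCA gtr_pMr // ltr_pdivrMr // mul1r.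
    by rewrite ltr_nat.
  apply: ler_sum => k _; move: (bz.2 0 k); rewrite /ball /= distrC => h.
  have {}h : Normc.normc (z 0 k - z0 0 k) < s.
    by move: h; rewrite -[`|_|]/((Normc.normc (z 0 k - z0 0 k))%:C) ltcR.
  rewrite -(sqr_sqrtr (ltW r1)) -/s !mxE ltW // ltr_pXn2r // ?nnegrE ?sqrtr_ge0 //.
  by case: (_ - _) => ? ?; rewrite /= sqrtr_ge0.
Qed.

Lemma openN2P (U : set 'CV[R]_n) :
  open U <-> forall z0, U z0 -> exists2 r : R, 0 < r & forall z, N2 (z - z0) < r -> U z.
Proof.
rewrite openE; split => [oU z0 /oU/nbhsN2P //|H z0 /H/nbhsN2P //].
Qed.

Lemma closureN2P (U : set 'CV[R]_n) z0 :
  closure U z0 <-> forall r : R, 0 < r -> exists2 z, U z & N2 (z - z0) < r.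
Proof.
split.
- move=> cU r r0; have [|z [Uz zr]] := cU [set z | N2 (z - z0) < r].
    by apply/nbhsN2P; exists r.
  by exists z.
- move=> H B /nbhsN2P[r r0 rB]; have [z Uz zr] := H _ r0.
  by exists z; split => //; apply: rB.
Qed.

Definition cts_at (A : set 'CV[R]_n) (phi : 'CV[R]_n -> R) z0 :=
  forall e : R, 0 < e -> exists2 r : R, 0 < r &
    forall z, A z -> N2 (z - z0) < r -> `|phi z - phi z0| < e.

Lemma withinN2P (A : set 'CV[R]_n) (phi : 'CV[R]_n -> R) :
  {within A, continuous phi} <-> forall z0, A z0 -> cts_at A phi z0.
Proof.
split.
- move=> /subspace_continuousP H z0 /H/cvgrPdist_lt K e e0.
  have /nbhsN2P[r r0 rP] := K _ e0; exists r => // z Az zr.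
  by rewrite distrC; exact: rP.
- move=> H; apply/subspace_continuousP => z0 Az0; apply/cvgrPdist_lt => e e0.
  have [r r0 rP] := H z0 Az0 e e0; apply/nbhsN2P; exists r => // z zr Az.
  by rewrite distrC; exact: rP.
Qed.

Lemma continuousN2P (phi : 'CV[R]_n -> R) :
  continuous phi <-> forall z0, cts_at setT phi z0.
Proof.
split.
- move=> H z0 e e0.
  have K : phi @ z0 --> phi z0 := H z0.
  have /nbhsN2P[r r0 rP] : \forall z \near z0, `|phi z0 - phi z| < e.
    exact: cvgr_dist_lt K _ e0.
  exists r => // z _ zr.
  by rewrite distrC; exact: rP.
- move=> H z0; apply/(@cvgrPdist_lt _ _ _ (nbhs z0)) => e e0.
  have [r r0 rP] := H z0 e e0; apply/nbhsN2P; exists r => // z zr.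
  by rewrite distrC; exact: rP.
Qed.

Lemma cts_at_sub (A B : set 'CV[R]_n) phi z0 : B `<=` A -> cts_at A phi z0 -> cts_at B phi z0.
Proof.
by move=> BA H e /H[r r0 rP]; exists r => // z Bz; apply: rP; exact: BA.
Qed.

Lemma rc_continuous a : continuous (rc a).
Proof.
apply/continuousN2P => z0 e e0; exists (e ^+ 2); first exact: exprn_gt0.
move=> z _ zr; rewrite -rcB -(ltr_pXn2r (n := 2)) ?nnegrE ?(ltW e0) //.
by rewrite real_normK ?num_real //; apply: le_lt_trans zr; exact: rc_le_N2.
Qed.

Lemma continuous_sumr (T : topologicalType) (I : Type) (s : seq I) (F : I -> T -> R) :
  (forall i, continuous (F i)) -> continuous (fun x => \sum_(i <- s) F i x).
Proof.
move=> cF; elim: s => [|i s IH] x.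
  under [X in continuous_at _ X]eq_fun do rewrite big_nil; exact: cst_continuous.
under [X in continuous_at _ X]eq_fun do rewrite big_cons.
by apply: continuousD; [exact: cF|exact: IH].
Qed.

Lemma N2_continuous : continuous N2.
Proof.
apply: continuous_sumr => a x.
rewrite (_ : (fun z => rc a z ^+ 2) = (fun z => rc a z * rc a z)) //.
by apply: continuousM; exact: rc_continuous.
Qed.

Lemma N2_dist_continuous w : continuous (fun z => N2 (z - w)).
Proof.
apply: continuous_sumr => a x.
have cB : {for x, continuous (fun z => rc a (z - w))}.
  rewrite (_ : (fun z => _) = (fun z => rc a z - rc a w)); last first.
    by apply/funext => z; rewrite rcB.
  by apply: continuousB; [exact: rc_continuous|exact: cst_continuous].
rewrite (_ : (fun z => rc a (z - w) ^+ 2) = (fun z => rc a (z - w) * rc a (z - w))) //.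
exact: (@continuousM _ _ (fun z => rc a (z - w)) (fun z => rc a (z - w)) x cB cB).
Qed.

Lemma open_ballN2 w (r : R) : open [set z | N2 (z - w) < r].
Proof.
have -> : [set z | N2 (z - w) < r] = (fun z => N2 (z - w)) @^-1` [set x | x < r] by [].
by apply: open_comp => [z _|]; [exact: N2_dist_continuous|exact: open_lt].
Qed.

Lemma closed_ballN2 w (r : R) : closed [set z | N2 (z - w) <= r].
Proof.
have -> : [set z | N2 (z - w) <= r] = (fun z => N2 (z - w)) @^-1` [set x | x <= r] by [].
by apply: preimage_closed => [z _|]; [exact: N2_dist_continuous|exact: closed_le].
Qed.

End RealCoordinates.

(** * Compactness in C^n *)

Section Compactness.
Variables (R : realType).

(** Near-covering compactness along the filter [0^'+] of small positive radii: instead of extracting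
    a finite subcover, the property is shown to hold eventually as [d] tends to 0. *)
Lemma compact_uniform_radius (T : topologicalType) (K : set T) (P : R -> T -> Prop) :
    compact K ->
    (forall x, K x -> exists2 d0 : R, 0 < d0 &
       \forall y \near x, forall d : R, 0 < d -> d < d0 -> K y -> P d y) ->
  exists2 d : R, 0 < d & forall x, K x -> P d x.
Proof.
move=> /compact_near_coveringP cK H.
have := cK R (0^'+) (fun d y => K y -> P d y) _ _.
case=> [x Kx|d0 /= d00 dP].
  have [d0 d00 nx] := H x Kx.
  exists ([set y | forall d : R, 0 < d -> d < d0 -> K y -> P d y], [set d | 0 < d < d0]) => /=.
    split => //; near=> d; apply/andP; split; near: d; [exact: nbhs_right_gt|exact: nbhs_right_lt].
  by move=> [y d] /= [h /andP[d1 d2]]; exact: h.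
exists (d0 / 2); first by rewrite divr_gt0.
move=> x Kx; apply: (dP (d0 / 2)) => //=; last by rewrite divr_gt0.
by rewrite sub0r normrN gtr0_norm ?divr_gt0 // ltr_pdivrMr // ltr_pMr // ltr1n.
Unshelve. all: by end_near. Qed.

Section CV.
Variable n : nat.
Implicit Types (z w : 'CV[R]_n) (A K : set 'CV[R]_n).

(** Common source of uniform continuity, of the distance between a compact set and the complement of
    an open one, and of uniform bounds on the oscillation of [f]: [P] has to hold for any two points
    close to a common centre. *)
Lemma lebesgue_number K (P : 'CV[R]_n -> 'CV[R]_n -> Prop) :
    compact K ->
    (forall z, K z -> exists2 r : R, 0 < r &
       forall x y, K x -> N2 (x - z) < r -> N2 (y - z) < r -> P x y) ->
  exists2 d : R, 0 < d & forall x, K x -> forall y, N2 (y - x) < d -> P x y.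
Proof.
move=> cK H; apply: compact_uniform_radius (cK) _ => z Kz.
have [r r0 rP] := H z Kz; have r4 : 0 < r / 4 by lra.
exists (r / 4) => //; apply/nbhsN2P; exists (r / 4) => // x xz d d0 dr Kx y yx.
apply: rP => //; first by apply: lt_trans xz _; lra.
by apply: N2_lt_triangle (lt_trans yx dr) xz.
Qed.

Lemma uniformly_continuousN2 K (phi : 'CV[R]_n -> R) (e : R) :
    compact K -> (forall z, K z -> cts_at setT phi z) -> 0 < e ->
  exists2 d : R, 0 < d &
    forall x, K x -> forall y, N2 (y - x) < d -> `|phi y - phi x| < e.
Proof.
move=> cK H e0; apply: lebesgue_number => // z Kz.
have e2 : 0 < e / 2 by lra.
have [r r0 rP] := H z Kz _ e2; exists r => // x y Kx xz yz.
have := rP x I xz; have := rP y I yz.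
rewrite !ltr_norml => /andP[h1 h2] /andP[h3 h4]; apply/andP; split; lra.
Qed.

Lemma compact_subset_open K (U : set 'CV[R]_n) : compact K -> open U -> K `<=` U ->
  exists2 d : R, 0 < d & forall x, K x -> forall y, N2 (y - x) < d -> U y.
Proof.
move=> cK /openN2P oU KU; apply: lebesgue_number => // z /KU/oU[r r0 rP].
by exists r => // x y Kx _ /rP.
Qed.

Lemma compactN2 A (M : R) : closed A -> (forall z, A z -> N2 z <= M) -> compact A.
Proof.
move=> cA bA; pose m := `|M| + 1.
have m0 : 0 < m by rewrite ltr_wpDl.
(* A compact square of C, the image of a real one; a bounded set lies in the n-fold product of such
   squares. *)
pose sq : set R[i] := (fun p : R * R => p.1 +i* p.2) @` (`[- m, m] `*` `[- m, m]).
have csq : compact sq.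
  apply: continuous_compact; last by apply: compact_setX; exact: segment_compact.
  apply: continuous_subspaceT => -[x y]; apply/cvgrPdist_lt => e e0.
  have [r r0 er] : exists2 r : R, 0 < r & e = r%:C.
    by move: e0; case: e => u v; rewrite ltcE /= => /andP[/eqP -> u0]; exists u.
  near=> p; rewrite er -[`|_|]/((Normc.normc _)%:C) ltcR.
  have -> : (x, y).1 +i* (x, y).2 - p.1 +i* p.2 = (x - p.1) +i* (y - p.2) by [].
  rewrite /= -(ltr_pXn2r (n := 2)) ?nnegrE ?sqrtr_ge0 ?(ltW r0) //.
  rewrite sqr_sqrtr ?addr_ge0 ?sqr_ge0 //.
  have h1 : `|x - p.1| < r / 2.
    by near: p; apply: (cvgr_dist_lt (@fst R R) x); [exact: cvg_fst|lra].
  have h2 : `|y - p.2| < r / 2.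
    by near: p; apply: (cvgr_dist_lt (@snd R R) y); [exact: cvg_snd|lra].
  have k1 : (x - p.1) ^+ 2 < (r / 2) ^+ 2.
    by rewrite -(real_normK (num_real (x - p.1))) ltr_pXn2r ?nnegrE //; lra.
  have k2 : (y - p.2) ^+ 2 < (r / 2) ^+ 2.
    by rewrite -(real_normK (num_real (y - p.2))) ltr_pXn2r ?nnegrE //; lra.
  nra.
apply: (subclosed_compact cA (rV_compact (fun=> csq))) => z Az i /=.
have Mm : M <= m ^+ 2.
  have := ler_norm M; rewrite /m; have := normr_ge0 M; nra.
have rcm a : - m <= rc a z <= m.
  rewrite -ler_norml -(ler_pXn2r (n := 2)) ?nnegrE ?(ltW m0) //.
  rewrite real_normK ?num_real //; apply: le_trans Mm; apply: le_trans (bA z Az); exact: rc_le_N2.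
exists (complex.Re (z 0 i), complex.Im (z 0 i)); last by case: (z 0 i).
by split; rewrite /= in_itv /=; [exact: (rcm (i, false))|exact: (rcm (i, true))].
Unshelve. all: by end_near. Qed.

Lemma compact_ballN2 w (r : R) : compact [set z | N2 (z - w) <= r].
Proof.
apply: (@compactN2 _ (2 * r + 2 * N2 w)) => [|z /= zr]; first exact: closed_ballN2.
rewrite -(subrK w z); apply: le_trans (N2D _ _) _; lra.
Qed.

Lemma bounded_setN2 A : bounded_set A -> exists M : R, forall z, A z -> N2 z <= M.
Proof.
move=> [M0 [M0real H]].
have [r r0 Mr] : exists2 r : R, 0 < r & M0 < r%:C.
  exists (`|complex.Re M0| + 1); first by rewrite ltr_wpDl.
  move: M0real; case: (M0) => u v; rewrite complex_real => /eqP /= ->.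
  by rewrite ltcR (le_lt_trans (ler_norm u)) // ltrDl.
exists (n%:R * r ^+ 2) => z Az; rewrite N2_complex.
have -> : n%:R * r ^+ 2 = \sum_(k < n) r ^+ 2 by rewrite sumr_const card_ord mulr_natl.
apply: ler_sum => k _; rewrite ler_pXn2r ?nnegrE ?(ltW r0) //; last first.
  by case: (z 0 k) => ? ?; rewrite /= sqrtr_ge0.
have := H r%:C Mr z Az; rewrite /= => /(le_trans _) h.
have : `|z 0 k| <= r%:C.
  apply: h; rewrite -[`|z|]/(mx_norm z) mx_normE -[leLHS]nngE num_le.
  exact: (le_bigmax _ (fun ij => `|z ij.1 ij.2|%:nng) (0, k)).
by rewrite -[`|_|]/((Normc.normc _)%:C) lecR.
Qed.

Lemma bounded_closureN2 A : bounded_set A -> compact (closure A).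
Proof.
move=> /bounded_setN2[M bM]; apply: (@compactN2 _ (2 * M + 2)) => [|z cz].
  exact: closed_closure.
have [w Aw wz] := (closureN2P _ _).1 cz _ ltr01.
have -> : z = w + (z - w) by rewrite addrCA subrr addr0.
apply: le_trans (N2D _ _) _; rewrite (N2C z w); have := bM _ Aw; lra.
Qed.

(** [rho] and [J] carry the problem to real row vectors, where the extension theorem for bounded
    functions on closed sets applies. Averages along segments are taken of functions that are
    continuous on all of C^n, hence the extension. *)
Lemma tietzeN2 K (u : 'CV[R]_n -> R) : compact K -> closed K ->
    {within K, continuous u} ->
  exists2 v : 'CV[R]_n -> R, continuous v & forall z, K z -> v z = u z.
Proof.
move=> cK clK cu.
pose m := #|{: real_coord n}|.
pose rho (z : 'CV[R]_n) : 'rV[R]_m := \row_i rc (enum_val i) z.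
pose J (x : 'rV[R]_m) : 'CV[R]_n := of_rc (fun a => x 0 (enum_rank a)).
have rhoK z : J (rho z) = z.
  by apply: rc_inj => a; rewrite of_rcK mxE enum_rankK.
have Jc : continuous J.
  move=> x P /nbhsN2P[r r0 rP].
  have : continuous (fun y => N2 (J y - J x)).
    apply: continuous_sumr => a y; rewrite /=.
    rewrite (_ : (fun y => _) = (fun y : 'rV_m => (y 0 (enum_rank a) - x 0 (enum_rank a))
       * (y 0 (enum_rank a) - x 0 (enum_rank a)))); last first.
      by apply/funext => ?; rewrite rcB !of_rcK.
    have h : {for y, continuous (fun y : 'rV_m => y 0 (enum_rank a) - x 0 (enum_rank a))}.
      by apply: continuousB; [exact: coord_continuous|exact: cst_continuous].
    exact: (continuousM h h).
  move=> /(_ x)/cvgr_lt; rewrite subrr N2_0 => /(_ _ r0).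
  by apply: filterS => y; exact: rP.
have rhoc : continuous rho.
  move=> z P /nbhs_ballP[e /= e0 eP]; apply/nbhsN2P; exists (e ^+ 2); first exact: exprn_gt0.
  move=> w we; apply: eP; split => // i j; rewrite !mxE /ball /= distrC -rcB.
  rewrite -(ltr_pXn2r (n := 2)) ?nnegrE ?(ltW e0) //.
  by rewrite real_normK ?num_real //; apply: le_lt_trans we; exact: rc_le_N2.
have [M M0 bM] : exists2 M : R, 0 < M & forall z, K z -> `|u z| <= M.
  have [M [_ H]] : bounded_set (u @` K).
    by apply: compact_bounded; exact: continuous_compact.
  exists (`|M| + 1) => [|z Kz]; first by rewrite ltr_wpDl.
  apply: (H (`|M| + 1)); last by exists z.
  by rewrite (le_lt_trans (ler_norm M)) // ltrDl.
have clB : closed (J @^-1` K) by apply: preimage_closed => // x _; exact: Jc.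
have cB : {within J @^-1` K, continuous (u \o J)}.
  apply/subspace_continuousP => x Bx; apply: cvg_comp; last first.
    by move/subspace_continuousP: cu; apply; exact: Bx.
  by move=> P hP; exact: (Jc x _ hP).
have [g [eqg cg _]] :=
  @continuous_bounded_extension _ R pseudometric_normal _ clB (u \o J) M M0 cB (fun x Bx => bM _ Bx).
exists (g \o rho) => [z|z Kz].
  by apply: continuous_comp; [exact: rhoc|exact: cg].
by rewrite /= -eqg /= ?rhoK // inE /= rhoK.
Qed.

End CV.
End Compactness.

(** * Hermitian matrices *)

Section Congruence.
Variable (R : realType).

Lemma conjcK' (x : R[i]) : x^*^* = x.
Proof. by case: x => a b; rewrite /= opprK. Qed.

Lemma hermsymP n (A : 'M[R[i]]_n) : reflect (forall i j, A i j = (A j i)^*) (A \is hermsymmx).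
Proof.
apply: (iffP (is_hermitianmxP _ _ _)) => [AE i j|H].
  by rewrite [in LHS]AE expr0 scale1r !mxE.
by apply/matrixP => i j; rewrite expr0 scale1r !mxE.
Qed.

Lemma hermsymT n (A : 'M[R[i]]_n) : A \is hermsymmx -> map_mx conjc A^T = A.
Proof. by move=> /hermsymP H; apply/matrixP => i j; rewrite !mxE [RHS]H. Qed.

Definition cform n (A : 'M[R[i]]_n) (w : 'CV[R]_n) : R[i] :=
  \sum_(i < n) \sum_(j < n) A j i * w 0 i * (w 0 j)^*.

Lemma hermitian_formE n (A : 'M[R[i]]_n) w : hermitian_form A w = complex.Re (cform A w).
Proof. by []. Qed.

Lemma cformE n (A : 'M[R[i]]_n) w : cform A w = (map_mx conjc w *m A *m w^T) 0 0.
Proof.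
rewrite mxE; apply: eq_bigr => i _; rewrite !mxE mulr_suml.
by apply: eq_bigr => j _; rewrite !mxE; ring.
Qed.

Definition psd n (A : 'M[R[i]]_n) := forall w, 0 <= hermitian_form A w.

Variables (m n : nat).
Implicit Types (C : 'M[R[i]]_(m, n)) (A : 'M[R[i]]_n).

(** The complex Hessian after the substitution z = w C: if [q] has Hessian [A], then w |-> q (w C)
    has Hessian [congmx C A]. *)
Definition congmx C A : 'M[R[i]]_m := map_mx conjc C *m A *m C^T.

Lemma congmx_herm C A : A \is hermsymmx -> congmx C A \is hermsymmx.
Proof.
move=> /hermsymT AE; apply/is_hermitianmxP; rewrite expr0 scale1r /congmx.
rewrite !trmx_mul trmxK !map_mxM AE mulmxA.
by congr (_ *m _ *m _); apply/matrixP => i j; rewrite !mxE; exact/esym/conjcK'.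
Qed.

Lemma cform_congmx C A w : cform (congmx C A) w = cform A (w *m C).
Proof. by rewrite !cformE /congmx map_mxM trmx_mul !mulmxA. Qed.

Lemma congmx_diag C A k : congmx C A k k = cform A (row k C).
Proof.
rewrite cformE map_row tr_row /congmx -row_mul mxE [RHS]mxE.
by apply: eq_bigr => j _; rewrite [in RHS]mxE [in X in _ = _ * X]mxE.
Qed.

Lemma congmx_psd C A : psd A -> psd (congmx C A).
Proof. by move=> pA w; rewrite hermitian_formE cform_congmx; exact: pA. Qed.

Lemma mxtrace_congmx C A :
  complex.Re (\tr (congmx C A)) = \sum_k hermitian_form A (row k C).
Proof. by rewrite /mxtrace Re_sum; apply: eq_bigr => k _; rewrite congmx_diag. Qed.

Lemma congmxD C A (B : 'M[R[i]]_n) : congmx C (A + B) = congmx C A + congmx C B.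
Proof. by rewrite /congmx mulmxDr mulmxDl. Qed.

Lemma trace_congmx_ge0 C A : psd A -> 0 <= complex.Re (\tr (congmx C A)).
Proof. by move=> pA; rewrite mxtrace_congmx; apply: sumr_ge0 => k _; exact: pA. Qed.

End Congruence.

Section HermitianMatrices.
Variables (R : realType) (n : nat).
Implicit Types (A B C : 'M[R[i]]_n) (w : 'CV[R]_n).

Lemma det_congmx C A : \det (congmx C A) = ((Normc.normc (\det C) ^+ 2)%:C) * \det A.
Proof.
rewrite /congmx !det_mulmx det_tr det_map_mx mulrAC; congr (_ * _).
case: (\det C) => a b /=; rewrite sqr_sqrtr ?addr_ge0 ?sqr_ge0 //.
by apply/eqP; rewrite eq_complex /=; apply/andP; split; apply/eqP; ring.
Qed.

Lemma spectral_decomposition A : A \is hermsymmx ->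
  exists (l : 'I_n -> R) (P : 'M[R[i]]_n), P *m (map_mx conjc P^T) = 1%:M /\
    A = map_mx conjc P^T *m diag_mx (\row_k (l k)%:C) *m P.
Proof.
move=> hA; have /orthomx_spectralP AE := hermitian_normalmx hA.
exists (fun k => complex.Re (spectral_diag A 0 k)), (spectralmx A); split.
  exact/unitarymxP/spectral_unitarymx.
have uS := spectral_unitarymx A; rewrite {1}AE (invmx_unitary uS); congr (_ *m diag_mx _ *m _).
apply/rowP => k; rewrite mxE.
have /mxOverP/(_ 0 k) := hermitian_spectral_diag_real hA.
by case: (spectral_diag A 0 k) => a b; rewrite complex_real => /eqP /= ->.
Qed.

Definition real_diag (l : 'I_n -> R) : 'M[R[i]]_n := diag_mx (\row_k (l k)%:C).

Lemma conj_real_diag l : map_mx conjc (real_diag l) = real_diag l.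
Proof.
by apply/matrixP => i j; rewrite !mxE; case: (i == j); rewrite /= ?mulr1n ?mulr0n /= ?oppr0.
Qed.

Lemma real_diagM l m : real_diag l *m real_diag m = real_diag (fun k => l k * m k).
Proof.
rewrite /real_diag mulmx_diag; congr diag_mx; apply/rowP => k.
by rewrite !mxE -rmorphM.
Qed.

Lemma det_real_diag l : \det (real_diag l) = (\prod_k l k)%:C.
Proof. by rewrite det_diag rmorph_prod; apply: eq_bigr => k _; rewrite mxE. Qed.

Lemma mxtrace_real_diag l : complex.Re (\tr (real_diag l)) = \sum_k l k.
Proof. by rewrite mxtrace_diag Re_sum; apply: eq_bigr => k _; rewrite mxE. Qed.

Lemma psd_real_diag l : psd (real_diag l) <-> forall k, 0 <= l k.
Proof.
have E w : hermitian_form (real_diag l) w = \sum_k l k * Normc.normc (w 0 k) ^+ 2.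
  rewrite /hermitian_form Re_sum; apply: eq_bigr => k _.
  rewrite (bigD1 k) //= big1 ?addr0 => [|j jk]; last first.
    by rewrite !mxE (negbTE jk) mulr0n !mul0r.
  rewrite !mxE eqxx mulr1n; case: (w 0 k) => a b /=.
  by rewrite sqr_sqrtr ?addr_ge0 ?sqr_ge0 //; ring.
split=> [H k|H w].
- have := H (delta_mx 0 k); rewrite E (bigD1 k) //= big1 ?addr0 => [|j jk].
    by rewrite mxE !eqxx /= expr0n /= addr0 expr1n sqrtr1 expr1n mulr1.
  by rewrite mxE (negbTE jk) andbF /= expr0n addr0 sqrtr0 expr0n mulr0.
- by rewrite E; apply: sumr_ge0 => k _; apply: mulr_ge0 => //; exact: sqr_ge0.
Qed.

(** All that is used of the spectral theorem, so that matrix facts become inequalities between the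
    numbers [l k]. In the last clause, C is the diagonal matrix of [m] times the conjugate of [P]:
    it diagonalises A and multiplies the k-th eigenvalue by m_k^2. *)
Lemma eigenvalues A : A \is hermsymmx -> exists l : 'I_n -> R,
  [/\ forall s : R, \det (A + (s%:C)%:M) = (\prod_k (l k + s))%:C,
      complex.Re (\tr A) = \sum_k l k,
      forall s : R, psd (A + (s%:C)%:M) <-> forall k, 0 <= l k + s
    & forall m : 'I_n -> R, exists C,
        complex.Re (\tr (congmx C A)) = \sum_k m k ^+ 2 * l k /\
        Normc.normc (\det C) ^+ 2 = \prod_k m k ^+ 2].
Proof.
move=> /spectral_decomposition[l [P [PP AE]]]; exists l.
have PP' := mulmx1C PP; rewrite -/(real_diag l) in AE.
have As s : A + (s%:C)%:M = map_mx conjc P^T *m real_diag (fun k => l k + s) *m P.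
  have -> : real_diag (fun k => l k + s) = real_diag l + (s%:C)%:M.
    apply/matrixP => i j; rewrite !mxE; case: (i == j); rewrite ?mulr1n ?mulr0n ?addr0 //.
    by rewrite rmorphD.
  by rewrite mulmxDr mulmxDl -AE -scalemx1 -scalemxAr mulmx1 -scalemxAl PP'.
have cK : map_mx conjc (map_mx conjc P) = P.
  by apply/matrixP => i j; rewrite !mxE; exact: conjcK'.
have Dcong B : P *m B *m map_mx conjc P^T = congmx (map_mx conjc P) B.
  by rewrite /congmx cK map_trmx.
split.
- move=> s; rewrite As !det_mulmx mulrAC -det_mulmx PP' det1 mul1r.
  exact: det_real_diag.
- by rewrite AE mxtrace_mulC mulmxA PP mul1mx mxtrace_real_diag.
- move=> s; rewrite -psd_real_diag As; split=> H.
    rewrite (_ : real_diag _ = congmx (map_mx conjc P) (map_mx conjc P^T *m real_diag (fun k => l k + s) *m P)).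
      exact: congmx_psd.
    by rewrite -Dcong !mulmxA PP mul1mx -mulmxA PP mulmx1.
  rewrite (_ : _ *m P = congmx P^T (real_diag (fun k => l k + s))).
    exact: congmx_psd.
  by rewrite /congmx trmxK.
- move=> m; pose C := real_diag m *m map_mx conjc P.
  have CE B : congmx C B = real_diag m *m (P *m B *m map_mx conjc P^T) *m real_diag m.
    by rewrite /congmx /C map_mxM conj_real_diag cK trmx_mul tr_diag_mx map_trmx !mulmxA.
  exists C; split.
    rewrite CE AE !mulmxA -(mulmxA _ P) PP mulmx1 -(mulmxA _ P) PP mulmx1 !real_diagM mxtrace_real_diag.
    by apply: eq_bigr => k _; rewrite mulrAC expr2.
  have := det_congmx C 1%:M; rewrite det1 mulr1 CE mulmx1 PP mulmx1 real_diagM det_real_diag.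
  by move=> [<-]; apply: eq_bigr => k _; rewrite expr2.
Qed.

Lemma addmx_scalar0 A : A + ((0 : R)%:C)%:M = A.
Proof. by apply/matrixP => i j; rewrite !mxE mul0rn addr0. Qed.

Lemma herm_scalar (s : R) : ((s%:C)%:M : 'M[R[i]]_n) \is hermsymmx.
Proof.
apply/hermsymP => i j; rewrite !mxE [j == i]eq_sym.
by case: (i == j); rewrite ?mulr1n ?mulr0n /= oppr0.
Qed.

Lemma hermD A B : A \is hermsymmx -> B \is hermsymmx -> A + B \is hermsymmx.
Proof.
move=> /hermsymP HA /hermsymP HB; apply/hermsymP => i j; rewrite !mxE HA HB.
by rewrite -rmorphD.
Qed.

Lemma hermZ (t : R) A : A \is hermsymmx -> t%:C *: A \is hermsymmx.
Proof.
move=> /hermsymP HA; apply/hermsymP => i j; rewrite !mxE HA.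
by case: (A j i) => a b /=; rewrite !mul0r; congr (_ +i* _); ring.
Qed.

Lemma psdP A (l : 'I_n -> R) :
  (forall s : R, psd (A + (s%:C)%:M) <-> forall k, 0 <= l k + s) ->
  psd A <-> forall k, 0 <= l k.
Proof.
by move=> /(_ 0); rewrite addmx_scalar0 => ->; split=> H k; move: (H k); rewrite addr0.
Qed.

Lemma det_eigen A (l : 'I_n -> R) :
  (forall s : R, \det (A + (s%:C)%:M) = (\prod_k (l k + s))%:C) ->
  complex.Re (\det A) = \prod_k l k.
Proof.
by move=> /(_ 0); rewrite addmx_scalar0 => -> /=; apply: eq_bigr => k _; rewrite addr0.
Qed.

Lemma psd_det_ge0 A : A \is hermsymmx -> psd A -> 0 <= complex.Re (\det A).
Proof.
move=> /eigenvalues[l [/det_eigen -> _ /psdP psdA _]] /psdA l0.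
by apply: prodr_ge0.
Qed.

Lemma det_le_trace A : A \is hermsymmx -> psd A ->
  complex.Re (\det A) <= (complex.Re (\tr A) / n%:R) ^+ n.
Proof.
move=> /eigenvalues[l [/det_eigen -> -> /psdP psdA _]] /psdA l0.
have [] := @leif_AGM _ 'I_n predT l _; first by move=> k _; exact: l0.
by rewrite cardT /= size_enum_ord.
Qed.

Lemma det_le_trace_congmx C A : A \is hermsymmx -> psd A ->
  Normc.normc (\det C) = 1 ->
  complex.Re (\det A) <= (complex.Re (\tr (congmx C A)) / n%:R) ^+ n.
Proof.
move=> hA pA C1; have := det_le_trace (congmx_herm C hA) (congmx_psd C pA).
by rewrite det_congmx C1 expr1n mul1r.
Qed.

Lemma nth_root (x : R) : 0 < x -> (0 < n)%N -> exists2 g : R, 0 < g & g ^+ n = x.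
Proof.
move=> x0 n0; exists (expR (ln x / n%:R)); first exact: expR_gt0.
by rewrite -expRM_natl mulrC divfK ?pnatr_eq0 -?lt0n // lnK.
Qed.

(** Equality case of the arithmetic-geometric mean: with [g] the geometric mean of the eigenvalues,
    the weights sqrt (g / l_k) turn every eigenvalue into [g], with |det C| = 1 and trace n g.
    Dividing by l_k is possible because A >= s > 0. *)
Lemma det_ge_of_traces A (s c : R) : (0 < n)%N -> A \is hermsymmx ->
    0 < s -> psd (A + ((- s)%:C)%:M) -> 0 <= c ->
    (forall C, Normc.normc (\det C) = 1 -> n%:R * c <= complex.Re (\tr (congmx C A))) ->
  c ^+ n <= complex.Re (\det A).
Proof.
move=> n0 /eigenvalues[l [/det_eigen -> _ psdA Cm]] s0 /psdA l0 c0 H.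
have l1 k : 0 < l k by have := l0 k; lra.
have [|g g0 gn] := @nth_root (\prod_k l k) _ n0; first by apply: prodr_gt0.
have [C [trC detC]] := Cm (fun k => Num.sqrt (g / l k)).
have sq k : Num.sqrt (g / l k) ^+ 2 = g / l k by rewrite sqr_sqrtr // divr_ge0 // ltW.
have {}detC : Normc.normc (\det C) = 1.
  apply/eqP; rewrite -(eqrXn2 (n := 2)) // ?ler01 //; last first.
    by case: (\det C) => a b /=; exact: sqrtr_ge0.
  rewrite detC expr1n (eq_bigr (fun k => g / l k)) // big_split /= prodfV.
  by rewrite prodr_const card_ord gn divff // gt_eqF // prodr_gt0.
have := H C detC; rewrite trC (eq_bigr (fun=> g)) => [|k _]; last first.
  by rewrite sq divfK // gt_eqF.
rewrite sumr_const card_ord -[X in _ <= X]mulr_natl ler_pM2l ?ltr0n // -gn => cg.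
by rewrite ler_pXn2r // nnegrE // ltW.
Qed.

(** A negative eigenvalue would produce a negative trace: give its eigenvector weight 1 and all
    others a small weight [e], which keeps C invertible. *)
Lemma psd_of_traces A : A \is hermsymmx ->
  (forall C, \det C != 0 -> 0 <= complex.Re (\tr (congmx C A))) -> psd A.
Proof.
move=> /eigenvalues[l [_ _ /psdP -> Cm]] H k.
apply: contrapT => /negP; rewrite -ltNge => lk.
pose S := \sum_(i | i != k) `|l i|.
have S0 : 0 <= S by apply: sumr_ge0.
have [e e0 eS] : exists2 e : R, 0 < e & e ^+ 2 * S < - l k.
  exists (Num.sqrt (- l k / (S + 1))); first by rewrite sqrtr_gt0 divr_gt0 // ?oppr_gt0 // ltr_wpDl.
  rewrite sqr_sqrtr; last by rewrite divr_ge0 ?oppr_ge0 ?(ltW lk) // addr_ge0.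
  rewrite mulrAC -mulrA gtr_pMr ?oppr_gt0 // ltr_pdivrMr ?mul1r ?ltrDl // ltr_wpDl //.
have [C [trC detC]] := Cm (fun i => if i == k then 1 else e).
have : \det C != 0.
  apply: contraTneq isT => C0; move: detC; rewrite C0 /= expr0n /= addr0 sqrtr0 expr0n /=.
  move/esym/eqP/prodf_eq0 => [i _]; case: ifP => _ /=; rewrite ?expr1n ?oner_eq0 //.
  by rewrite expf_eq0 /= gt_eqF.
move=> /H; rewrite trC (bigD1 k) //= eqxx expr1n mul1r.
rewrite (eq_bigr (fun i => e ^+ 2 * l i)) => [|i /negbTE -> //]; rewrite -mulr_sumr.
have : \sum_(i | i != k) l i <= S by apply: ler_sum => i _; exact: ler_norm.
have := exprn_gt0 2 e0; nra.
Qed.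

(** Two terms of the expanded product. Read on eigenvalues, this is the gain s^n of the determinant
    under adding s |z|^2, the only source of strictness below. *)
Lemma prodr_addX (s : R) (l : 'I_n -> R) : (0 < n)%N -> 0 <= s -> (forall k, 0 <= l k) ->
  \prod_k l k + s ^+ n <= \prod_k (l k + s).
Proof.
move=> n0 s0 l0; have -> : s ^+ n = \prod_(k < n) s by rewrite prodr_const card_ord.
(* The induction starts at one factor, since for the empty product the claim would read 1 + 1 <=
   1. *)
have : (0 < size (index_enum 'I_n))%N.
  by rewrite /index_enum; case: index_enum_key; rewrite /= -enumT size_enum_ord.
elim: (index_enum 'I_n) => // k [|j r] IH _; first by rewrite !big_seq1.
rewrite big_cons [X in _ + X]big_cons [X in _ <= X]big_cons.
have := IH isT; set a := \prod_(_ <- _) _; set b := \prod_(_ <- _) _; set d := \prod_(_ <- _) _.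
have a0 : 0 <= a by apply: prodr_ge0.
have d0 : 0 <= d by apply: prodr_ge0.
move=> adb; have lk := l0 k.
apply: le_trans (ler_wpM2l (addr_ge0 lk s0) adb).
have := mulr_ge0 lk d0; have := mulr_ge0 s0 a0; nra.
Qed.

Lemma det_add_scalar A (s : R) : (0 < n)%N -> A \is hermsymmx -> psd A -> 0 <= s ->
  complex.Re (\det A) + s ^+ n <= complex.Re (\det (A + (s%:C)%:M)).
Proof.
move=> n0 /eigenvalues[l [detA _ /psdP psdA _]] /psdA l0 s0.
by rewrite detA /= (det_eigen detA) prodr_addX.
Qed.

Lemma continuous_prodr (I : Type) (r : seq I) (F : I -> R -> R) :
  (forall i, continuous (F i)) -> continuous (fun x => \prod_(i <- r) F i x).
Proof.
move=> cF; elim: r => [|i r IH] x.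
  under [X in continuous_at _ X]eq_fun do rewrite big_nil; exact: cst_continuous.
under [X in continuous_at _ X]eq_fun do rewrite big_cons.
by apply: continuousM; [exact: cF|exact: IH].
Qed.

Lemma det_scalar_continuous A : A \is hermsymmx ->
  continuous (fun s : R => complex.Re (\det (A + (s%:C)%:M))).
Proof.
move=> /eigenvalues[l [detA _ _ _]].
under [X in continuous X]eq_fun do rewrite detA /=.
apply: continuous_prodr => k x.
by apply: (@continuousD _ R^o); [exact: cst_continuous|exact: cvg_id].
Qed.

Lemma psdD A B : psd A -> psd B -> psd (A + B).
Proof.
move=> pA pB w; have -> : hermitian_form (A + B) w = hermitian_form A w + hermitian_form B w.
  rewrite -ReD -big_split; congr complex.Re; apply: eq_bigr => i _; rewrite -big_split.
  by apply: eq_bigr => j _; rewrite mxE /=; ring.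
by rewrite addr_ge0.
Qed.

Lemma psd_sub_scalar (A : 'M[R[i]]_n) : (0 < n)%N -> A \is hermsymmx -> psd A -> 0 < complex.Re (\det A) ->
  exists2 s : R, 0 < s & psd (A + ((- s)%:C)%:M).
Proof.
move=> n0 hA pA d0.
have [l [/det_eigen detA _ psdA _]] := eigenvalues hA.
have l0 : forall k, 0 <= l k by apply/(psdP psdA).
have l1 k : 0 < l k.
  rewrite lt_neqAle l0 andbT; apply/negP => /eqP lk; move: d0.
  by rewrite detA (bigD1 k) //= -lk mul0r ltxx.
have [k0 _ kP] := @arg_minP _ _ 'I_n (Ordinal n0) xpredT l isT.
by exists (l k0) => //; apply/psdA => k; rewrite subr_ge0; exact: kP.
Qed.

(** Monotonicity is clear for traces: every normalised trace of A is at least n (det A)^(1/n),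
    adding B >= 0 only raises it, and [det_ge_of_traces] returns to the determinant. *)
Lemma det_mono A B : (0 < n)%N -> A \is hermsymmx -> B \is hermsymmx -> psd A -> psd B ->
  complex.Re (\det A) <= complex.Re (\det (A + B)).
Proof.
move=> n0 hA hB pA pB.
have [d0|d0] := leP (complex.Re (\det A)) 0.
  by apply: le_trans d0 (psd_det_ge0 (hermD hA hB) (psdD pA pB)).
have [c c0 cn] := nth_root d0 n0.
have [s s0 ps] := psd_sub_scalar n0 hA pA d0.
have psB : psd (A + B + ((- s)%:C)%:M) by rewrite addrAC; exact: psdD.
rewrite -cn; apply: (det_ge_of_traces n0 (hermD hA hB) s0 psB (ltW c0)).
move=> C C1; rewrite congmxD raddfD ReD.
have := det_le_trace_congmx hA pA C1; have := trace_congmx_ge0 C pB; have := trace_congmx_ge0 C pA.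
move: (complex.Re _) (complex.Re (\tr (congmx C B))) => a b a0 b0; rewrite -cn.
rewrite ler_pXn2r ?nnegrE ?(ltW c0) ?divr_ge0 // ler_pdivlMr ?ltr0n // mulrC => ca.
by apply: le_trans ca _; rewrite lerDl.
Qed.

End HermitianMatrices.

(** * Quadratic test functions *)

Section Quadratics.
Variables (R : realType) (n : nat).
Implicit Types (A B C M : 'M[R[i]]_n) (z w : 'CV[R]_n) (h l : 'CV[R]_n -> R[i]) (q p : 'CV[R]_n -> R).

Definition affine l := exists c (b : 'CV[R]_n), l = fun z : 'CV[R]_n => c + \sum_(i < n) b 0 i * z 0 i.

Lemma Hquad_affineM l1 l2 : affine l1 -> affine l2 -> Hquad (fun z => l1 z * l2 z).
Proof.
move=> [c1 [b1 ->]] [c2 [b2 ->]].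
exists (c1 * c2), (c1 *: b2 + c2 *: b1 : 'CV[R]_n), (\matrix_(i, j) (b1 0 i * b2 0 j)).
apply/funext => z; rewrite /poly_deg2 mulrDl !mulrDr -!addrA; congr (_ + _).
rewrite addrA; congr (_ + _).
  rewrite mulr_sumr mulr_suml -big_split; apply: eq_bigr => i _ /=; rewrite !mxE; ring.
rewrite mulr_suml; apply: eq_bigr => i _; rewrite mulr_sumr; apply: eq_bigr => j _.
by rewrite mxE; ring.
Qed.

Lemma HquadD h1 h2 : Hquad h1 -> Hquad h2 -> Hquad (fun z => h1 z + h2 z).
Proof.
move=> [c1 [b1 [Q1 ->]]] [c2 [b2 [Q2 ->]]].
exists (c1 + c2), (b1 + b2 : 'CV[R]_n), (Q1 + Q2); apply/funext => z; rewrite /poly_deg2.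
rewrite [X in _ = _ + X + _](eq_bigr (fun i => b1 0 i * z 0 i + b2 0 i * z 0 i)); last first.
  by move=> i _; rewrite mxE mulrDl.
rewrite [X in _ = _ + X](eq_bigr (fun i => \sum_j Q1 i j * z 0 i * z 0 j + \sum_j Q2 i j * z 0 i * z 0 j)).
  by rewrite !big_split /=; ring.
by move=> i _; rewrite -big_split; apply: eq_bigr => j _; rewrite mxE /=; ring.
Qed.

Lemma affine_cst c : affine (fun=> c).
Proof.
exists c, 0; apply/funext => z; rewrite big1 ?addr0 // => i _; rewrite mxE mul0r //.
Qed.

Lemma affine_coord i : affine (fun z => z 0 i).
Proof.
exists 0, (delta_mx 0 i); apply/funext => z; rewrite (bigD1 i) //= big1 => [|j ji].
  by rewrite mxE !eqxx mul1r add0r addr0.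
by rewrite mxE (negbTE ji) andbF mul0r.
Qed.

Lemma affineD l1 l2 : affine l1 -> affine l2 -> affine (fun z => l1 z + l2 z).
Proof.
move=> [c1 [b1 ->]] [c2 [b2 ->]]; exists (c1 + c2), (b1 + b2 : 'CV[R]_n); apply/funext => z.
rewrite [X in _ = _ + X](eq_bigr (fun i => b1 0 i * z 0 i + b2 0 i * z 0 i)).
  by rewrite big_split /=; ring.
by move=> i _; rewrite mxE mulrDl.
Qed.

Lemma affineZ c l : affine l -> affine (fun z => c * l z).
Proof.
move=> [d [b ->]]; exists (c * d), (c *: b : 'CV[R]_n); apply/funext => z.
rewrite mulrDr mulr_sumr; congr (_ + _); apply: eq_bigr => i _; rewrite mxE mulrA //.
Qed.

Lemma affine_sum (I : Type) (s : seq I) (F : I -> 'CV[R]_n -> R[i]) :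
  (forall i, affine (F i)) -> affine (fun z => \sum_(i <- s) F i z).
Proof.
move=> H; elim: s => [|i s IH].
  by under eq_fun do rewrite big_nil; exact: affine_cst.
by under eq_fun do rewrite big_cons; exact: affineD.
Qed.

Lemma Hquad_affine l : affine l -> Hquad l.
Proof.
move=> al; have := Hquad_affineM al (affine_cst 1).
by under eq_fun do rewrite mulr1.
Qed.

Lemma Hquad_sum (I : Type) (s : seq I) (F : I -> 'CV[R]_n -> R[i]) :
  (forall i, Hquad (F i)) -> Hquad (fun z => \sum_(i <- s) F i z).
Proof.
move=> H; elim: s => [|i s IH].
  by under eq_fun do rewrite big_nil; apply: Hquad_affine; exact: affine_cst.
by under eq_fun do rewrite big_cons; exact: HquadD.
Qed.

Lemma HquadZ c h : Hquad h -> Hquad (fun z => c * h z).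
Proof.
move=> [d [b [Q ->]]]; exists (c * d), (c *: b : 'CV[R]_n), (c *: Q); apply/funext => z.
rewrite /poly_deg2 !mulrDr !mulr_sumr; congr (_ + _ + _).
  by apply: eq_bigr => i _; rewrite mxE mulrA.
by apply: eq_bigr => i _; rewrite mulr_sumr; apply: eq_bigr => j _; rewrite mxE !mulrA.
Qed.

(* [quad A q]: q = p + Re h with complex Hessian A, as in the test functions of
   the viscosity definitions, but without assuming A >= 0. *)
Definition quad A q := A \is hermsymmx /\
  exists2 h, Hquad h & q = hermitian_form A \+ re_fun h.

Lemma hermitian_formD A B w : hermitian_form (A + B) w = hermitian_form A w + hermitian_form B w.
Proof.
rewrite -ReD -big_split; congr complex.Re; apply: eq_bigr => i _; rewrite -big_split.
by apply: eq_bigr => j _; rewrite mxE /=; ring.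
Qed.

Lemma hermitian_formZ (t : R) A w : hermitian_form (t%:C *: A) w = t * hermitian_form A w.
Proof.
rewrite /hermitian_form -ReZ mulr_sumr; congr complex.Re; apply: eq_bigr => i _.
by rewrite mulr_sumr; apply: eq_bigr => j _; rewrite mxE !mulrA.
Qed.

Lemma hermitian_form0 w : hermitian_form 0 w = 0.
Proof.
by rewrite /hermitian_form big1 // => i _; rewrite big1 // => j _; rewrite mxE !mul0r.
Qed.

Lemma herm0 : (0 : 'M[R[i]]_n) \is hermsymmx.
Proof. by apply/hermsymP => i j; rewrite !mxE rmorph0. Qed.

Lemma quad_Re l : Hquad l -> quad 0 (fun z => complex.Re (l z)).
Proof.
move=> hl; split; first exact: herm0.
by exists l => //; apply/funext => z; rewrite /= hermitian_form0 add0r.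
Qed.

Lemma quadD A B p q : quad A p -> quad B q -> quad (A + B) (fun z => p z + q z).
Proof.
move=> [hA [h1 H1 ->]] [hB [h2 H2 ->]]; split; first exact: hermD.
exists (fun z => h1 z + h2 z); first exact: HquadD.
by apply/funext => z; rewrite /= hermitian_formD /re_fun ReD addrACA.
Qed.

Lemma quadZ (t : R) A q : quad A q -> quad (t%:C *: A) (fun z => t * q z).
Proof.
move=> [hA [h H ->]]; split; first exact: hermZ.
exists (fun z => t%:C * h z); first exact: HquadZ.
by apply/funext => z; rewrite /= hermitian_formZ /re_fun ReZ mulrDr.
Qed.

Lemma quad_cst (t : R) : quad 0 (fun=> t).
Proof. by have := quad_Re (Hquad_affine (affine_cst t%:C)). Qed.

Lemma quadB A B p q : quad A p -> quad B q -> quad (A - B) (fun z => p z - q z).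
Proof.
move=> qA /(quadZ (-1)) /(quadD qA).
rewrite (_ : (-1)%:C *: B = - B); last by rewrite rmorphN scaleN1r.
by under eq_fun do rewrite mulN1r.
Qed.

Lemma quad_herm A q : quad A q -> A \is hermsymmx. Proof. by case. Qed.

Definition coef (a : real_coord n) : R[i] := if a.2 then - 'i else 1.

Lemma rcE a z : rc a z = complex.Re (coef a * z 0 a.1).
Proof.
by rewrite /rc /coef; case: a => k [] /=; case: (z 0 k) => x y /=; ring.
Qed.

Lemma affine_rc a : affine (fun z => coef a * z 0 a.1).
Proof. by apply: affineZ; exact: affine_coord. Qed.

Lemma quad_rc a : quad 0 (rc a).
Proof.
have := quad_Re (Hquad_affine (affine_rc a)).
by under eq_fun do rewrite -rcE.
Qed.

(** The real part of the form sees only the Hermitian part of M. *)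
Lemma quad_sesqui M : exists A, quad A (hermitian_form M).
Proof.
pose A := (2%:R^-1 : R)%:C *: (M + map_mx conjc M^T).
have hA : A \is hermsymmx.
  apply: hermZ; apply/hermsymP => i j; rewrite !mxE.
  by case: (M i j) => a b; case: (M j i) => c d /=; congr (_ +i* _); ring.
exists A; split => //; exists (fun=> 0); first exact: Hquad_affine (affine_cst 0).
apply/funext => z; rewrite /= /re_fun addr0 hermitian_formZ hermitian_formD.
suff -> : hermitian_form (map_mx conjc M^T) z = hermitian_form M z by lra.
rewrite /hermitian_form exchange_big !Re_sum; apply: eq_bigr => i _; rewrite !Re_sum.
apply: eq_bigr => j _; rewrite !mxE.
by case: (M j i) => a b; case: (z 0 i) => x y; case: (z 0 j) => u v /=; ring.
Qed.

(** Re x Re y is half the sum of Re (x y'), with y' the conjugate of y, and Re (x y): a Hermitian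
    and a holomorphic term. Hence every real quadratic polynomial is of the form p + Re h. *)
Lemma quad_rcM a b : exists A, quad A (fun z => rc a z * rc b z).
Proof.
pose M : 'M[R[i]]_n := \matrix_(j, i) (if (i == a.1) && (j == b.1) then coef a * (coef b)^* else 0).
have [A qA] := quad_sesqui M.
have qH := quad_Re (Hquad_affineM (affine_rc a) (affine_rc b)).
exists ((2^-1 : R)%:C *: (A + 0)).
have := quadZ (2^-1) (quadD qA qH); congr quad; apply/funext => z.
have -> : hermitian_form M z = complex.Re (coef a * z 0 a.1 * (coef b * z 0 b.1)^*).
  rewrite /hermitian_form (bigD1 a.1) //= (bigD1 b.1) //= !big1 ?addr0.
  - rewrite mxE !eqxx /=; congr complex.Re; rewrite rmorphM /=; ring.
  - by move=> i ia; rewrite big1 // => j _; rewrite mxE (negbTE ia) !mul0r.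
  - by move=> j jb; rewrite mxE (negbTE jb) andbF !mul0r.
rewrite !rcE; case: (coef a * _) => x y; case: (coef b * _) => u v /=; lra.
Qed.

Lemma cform_delta A k : cform A (delta_mx 0 k) = A k k.
Proof.
rewrite /cform (bigD1 k) //= (bigD1 k) //= !big1 ?addr0.
- by rewrite mxE !eqxx mulr1 rmorph1 mulr1.
- by move=> i ik; rewrite big1 // => j _; rewrite !mxE (negbTE ik) andbF mulr0 mul0r.
- by move=> j jk; rewrite !mxE (negbTE jk) andbF rmorph0 mulr0.
Qed.

Lemma quad_N2 : quad 1%:M (@N2 R n).
Proof.
split; first exact: (herm_scalar _ 1).
exists (fun=> 0); first exact: Hquad_affine (affine_cst 0).
apply/funext => z; rewrite /= /re_fun addr0 N2_complex.
have := @psd_real_diag R n.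
rewrite /hermitian_form Re_sum; move=> _; apply: eq_bigr => k _.
rewrite (bigD1 k) //= big1 ?addr0 => [|j jk]; last by rewrite !mxE (negbTE jk) !mul0r.
rewrite mxE eqxx mul1r; case: (z 0 k) => a b /=.
by rewrite sqr_sqrtr ?addr_ge0 ?sqr_ge0 //; ring.
Qed.

Lemma affine_row m (C : 'M[R[i]]_(n, m)) i : affine (fun z => (z *m C) 0 i).
Proof.
rewrite (_ : (fun z => _) = (fun z => \sum_k C k i * z 0 k)).
  by apply: affine_sum => k; apply: affineZ; exact: affine_coord.
by apply/funext => z; rewrite mxE; apply: eq_bigr => k _; rewrite mulrC.
Qed.

Lemma Hquad_comp m (h : 'CV[R]_m -> R[i]) (phi : 'CV[R]_n -> 'CV[R]_m) :
  (forall i, affine (fun z => phi z 0 i)) -> Hquad h -> Hquad (h \o phi).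
Proof.
move=> aphi [c [b [Q ->]]]; rewrite /poly_deg2 /=.
apply: (@HquadD (fun z => c + \sum_i b 0 i * phi z 0 i)
  (fun z => \sum_i \sum_j Q i j * phi z 0 i * phi z 0 j)).
  apply: Hquad_affine; apply: affineD; first exact: affine_cst.
  by apply: affine_sum => i; apply: affineZ.
apply: Hquad_sum => i; apply: Hquad_sum => j.
by apply: (@Hquad_affineM (fun z => Q i j * phi z 0 i)) => //; exact: affineZ.
Qed.

(** The two cross terms of the Hermitian form are conjugate to each other, so together they are the
    real part of the affine function 2 l and go into the holomorphic part. *)
Lemma quad_translate t A q : quad A q -> quad A (fun z => q (z + t)).
Proof.
move=> [hA [h H ->]]; split => //.
have ht : Hquad (fun z => h (z + t)).
  apply: (@Hquad_comp n h (fun z => z + t)) => // i.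
  under eq_fun do rewrite mxE.
  by apply: affineD; [exact: affine_coord|exact: affine_cst].
pose l z := \sum_i (\sum_j A j i * (t 0 j)^*) * z 0 i.
have al : affine l by apply: affine_sum => i; apply: affineZ; exact: affine_coord.
exists (fun z => h (z + t) + ((hermitian_form A t)%:C + (2%:R * l z))).
  apply: HquadD => //; apply: Hquad_affine; apply: affineD; first exact: affine_cst.
  exact: affineZ.
apply/funext => z; rewrite /= /re_fun ReD ReD [complex.Re (_%:C)]/=.
suff -> : hermitian_form A (z + t) = hermitian_form A z + hermitian_form A t + complex.Re (2%:R * l z).
  ring.
have -> : complex.Re (2%:R * l z) = complex.Re (l z) + complex.Re (l z).
  by rewrite -ReD; congr complex.Re; ring.
have -> : hermitian_form A (z + t) = hermitian_form A z + hermitian_form A t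
   + (complex.Re (\sum_i \sum_j A j i * z 0 i * (t 0 j)^*)
   +  complex.Re (\sum_i \sum_j A j i * t 0 i * (z 0 j)^*)).
  rewrite -!ReD -!big_split; congr complex.Re; apply: eq_bigr => i _; rewrite -!big_split.
  by apply: eq_bigr => j _; rewrite !mxE rmorphD /=; ring.
congr (_ + (_ + _)).
  congr complex.Re; apply: eq_bigr => i _; rewrite mulr_suml.
  by apply: eq_bigr => j _; ring.
rewrite exchange_big !Re_sum; apply: eq_bigr => i _; rewrite mulr_suml !Re_sum.
apply: eq_bigr => j _; rewrite ((hermsymP _ hA) i j).
by case: (A j i) => a b; case: (z 0 i) => x y; case: (t 0 j) => u v /=; ring.
Qed.

(** A four-point mean value formula: linear terms cancel between opposite points, holomorphic
    squares between b and i b, and only the Hermitian form survives. It reads A off the values of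
    q. *)
Lemma quad_levi A q z b : quad A q ->
  q (z + b) + q (z - b) + q (z + 'i *: b) + q (z - 'i *: b) = 4 * q z + 4 * hermitian_form A b.
Proof.
move=> /(quad_translate z) [_ [_ [c [b0 [Q ->]]] qE]].
have E w : q (z + w) = hermitian_form A w + re_fun (poly_deg2 c b0 Q) w.
  by move/(congr1 (@^~ w)): qE; rewrite /= addrC.
rewrite -{5}(addr0 z) !E.
have hf0 : hermitian_form A 0 = 0.
  by rewrite /hermitian_form big1 // => i _; rewrite big1 // => j _; rewrite !mxE mulr0 mul0r.
have hfZ (x : R[i]) : x * x^* = 1 -> hermitian_form A (x *: b) = hermitian_form A b.
  move=> x1; congr complex.Re; apply: eq_bigr => i _; apply: eq_bigr => j _.
  by rewrite !mxE rmorphM -[RHS]mul1r -x1 /=; ring.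
have p2Z (x : R[i]) : poly_deg2 c b0 Q (x *: b) = c + x * \sum_i b0 0 i * b 0 i
    + x ^+ 2 * \sum_i \sum_j Q i j * b 0 i * b 0 j.
  rewrite /poly_deg2 !mulr_sumr; congr (_ + _ + _).
    by apply: eq_bigr => i _; rewrite mxE; ring.
  by apply: eq_bigr => i _; rewrite mulr_sumr; apply: eq_bigr => j _; rewrite !mxE; ring.
have hN1 := hfZ (-1); have hi := hfZ 'i; have hNi := hfZ (- 'i).
have e1 := p2Z 1; have eN1 := p2Z (-1); have ei := p2Z 'i; have eNi := p2Z (- 'i).
have e0 : poly_deg2 c b0 Q 0 = c.
  by have := p2Z 0; rewrite scale0r expr0n !mul0r !addr0.
rewrite scale1r in e1; rewrite !scaleN1r in hN1 eN1; rewrite !scaleNr in hNi eNi.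
rewrite hf0 ?hN1 ?hi ?hNi; try by (apply/eqP; rewrite eq_complex /=; apply/andP; split; apply/eqP; ring).
rewrite /re_fun e0 e1 eN1 ei eNi.
case: (\sum_i b0 0 i * b 0 i) => x y; case: (\sum_i \sum_j _) => u v; case: (c) => c1 c2 /=.
ring.
Qed.

Definition ctsC l := continuous (fun z => complex.Re (l z)) /\ continuous (fun z => complex.Im (l z)).

Lemma ctsC_cst c : ctsC (fun=> c).
Proof. by split=> z; exact: cst_continuous. Qed.

Lemma ctsCD l1 l2 : ctsC l1 -> ctsC l2 -> ctsC (fun z => l1 z + l2 z).
Proof.
move=> [a b] [c d]; split.
  by apply: eq_cts (cts_add a c) => y; rewrite ReD.
by apply: eq_cts (cts_add b d) => y; rewrite ImD.
Qed.

Lemma ctsCM l1 l2 : ctsC l1 -> ctsC l2 -> ctsC (fun z => l1 z * l2 z).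
Proof.
move=> [a b] [c d]; split.
  apply: eq_cts (cts_sub (cts_mul a c) (cts_mul b d)) => y.
  by case: (l1 y) => ? ?; case: (l2 y).
apply: eq_cts (cts_add (cts_mul a d) (cts_mul b c)) => y.
by case: (l1 y) => ? ?; case: (l2 y).
Qed.

Lemma ctsC_conj l : ctsC l -> ctsC (fun z => (l z)^*).
Proof.
move=> [a b]; split.
  by apply: eq_cts a => y; case: (l y).
by apply: eq_cts (cts_opp b) => y; case: (l y).
Qed.

Lemma ctsC_coord i : ctsC (fun z => z 0 i).
Proof. by split; [exact: (@rc_continuous R n (i, false))|exact: (@rc_continuous R n (i, true))]. Qed.

Lemma ctsC_sum (I : Type) (s : seq I) (F : I -> 'CV[R]_n -> R[i]) :
  (forall i, ctsC (F i)) -> ctsC (fun z => \sum_(i <- s) F i z).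
Proof.
move=> H; elim: s => [|i s IH].
  by under eq_fun do rewrite big_nil; exact: ctsC_cst.
by under eq_fun do rewrite big_cons; exact: ctsCD.
Qed.

Lemma quad_continuous A q : quad A q -> continuous q.
Proof.
move=> [_ [_ [c [b [Q ->]]] ->]].
have [a _] : ctsC (fun z => cform A z + poly_deg2 c b Q z).
  apply: ctsCD.
    apply: ctsC_sum => i; apply: ctsC_sum => j; apply: ctsCM; last exact/ctsC_conj/ctsC_coord.
    by apply: ctsCM; [exact: ctsC_cst|exact: ctsC_coord].
  apply: ctsCD.
    apply: ctsCD; first exact: ctsC_cst.
    by apply: ctsC_sum => i; apply: ctsCM; [exact: ctsC_cst|exact: ctsC_coord].
  apply: ctsC_sum => i; apply: ctsC_sum => j; apply: ctsCM; last exact: ctsC_coord.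
  by apply: ctsCM; [exact: ctsC_cst|exact: ctsC_coord].
by apply: eq_cts a => z; rewrite ReD.
Qed.

End Quadratics.

Lemma quad_comp_linear (R : realType) (m n : nat) (C : 'M[R[i]]_(n, m)) (A : 'M[R[i]]_m) q :
  quad A q -> quad (congmx C A) (fun w => q (w *m C)).
Proof.
move=> [hA [h H ->]]; split; first exact: congmx_herm.
exists (h \o (mulmx^~ C)); last first.
  by apply/funext => z; rewrite /= !hermitian_formE cform_congmx.
by apply: Hquad_comp => // i; exact: affine_row.
Qed.

(** * Second-order contact *)

Section Touching.
Variables (R : realType) (n : nat).
Implicit Types (A B : 'M[R[i]]_n) (z w : 'CV[R]_n) (q p phi u : 'CV[R]_n -> R) (U : set 'CV[R]_n).

Lemma cts_atD U u phi z : cts_at U u z -> cts_at U phi z -> cts_at U (fun x => u x + phi x) z.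
Proof.
move=> cu cp e e0; have e2 : 0 < e / 2 by lra.
have [r r0 h] := cu _ e2; have [s s0 k] := cp _ e2.
exists (Num.min r s); first by rewrite lt_min r0.
move=> x Ux; rewrite lt_min => /andP[/(h _ Ux) h1 /(k _ Ux) h2].
rewrite opprD addrACA (le_lt_trans (ler_normD _ _)) //; lra.
Qed.

Lemma cts_atN U u z : cts_at U u z -> cts_at U (fun x => - u x) z.
Proof.
move=> cu e /cu[r r0 h]; exists r => // x Ux /(h _ Ux).
by rewrite -normrN opprD !opprK.
Qed.

Lemma cts_atB U u phi z : cts_at U u z -> cts_at U phi z -> cts_at U (fun x => u x - phi x) z.
Proof. by move=> cu cp; apply: cts_atD => //; exact: cts_atN. Qed.

Lemma continuous_cts_at U u z : continuous u -> cts_at U u z.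
Proof. by move=> /continuousN2P cu; apply: cts_at_sub (cu z). Qed.

Lemma compact_max (K : set 'CV[R]_n) u : compact K -> K !=set0 ->
    (forall z, K z -> cts_at K u z) ->
  exists2 z, K z & forall w, K w -> u w <= u z.
Proof.
move=> cK K0 /withinN2P cu; have [z] := compact_EVT_max K0 cK cu.
rewrite inE => Kz H; exists z => // w Kw; apply: H; by rewrite inE.
Qed.

Lemma ball_max w (r : R) u : 0 <= r -> (forall z, N2 (z - w) <= r -> cts_at [set z | N2 (z - w) <= r] u z) ->
  exists2 z1, N2 (z1 - w) <= r & forall z, N2 (z - w) <= r -> u z <= u z1.
Proof.
move=> r0 cu; have [|//|z1 /= z1r H] := @compact_max _ u (@compact_ballN2 R n w r).
  by exists w; rewrite /= subrr N2_0.
by exists z1.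
Qed.

Lemma scalar_herm (t : R) : ((t%:C)%:M : 'M[R[i]]_n) = t%:C *: 1%:M.
Proof. by rewrite scalemx1. Qed.

Lemma quad_N2_shift (t : R) w : quad (t%:C)%:M (fun z => t * N2 (z - w)).
Proof. by rewrite scalar_herm; apply/quadZ/quad_translate/quad_N2. Qed.

Lemma hermitian_form_scalar (t : R) z : hermitian_form ((t%:C)%:M : 'M[R[i]]_n) z = t * N2 z.
Proof.
have [_ [_ [c [b [Q ->]]] qE]] := quad_N2 R n.
rewrite scalar_herm hermitian_formZ; congr (_ * _).
have := quad_levi 0 z (quad_N2 R n).
rewrite add0r sub0r add0r sub0r N2_0 N2N.
have -> : N2 (- ('i *: z)) = N2 ('i *: z) by rewrite N2N.
have -> : N2 ('i *: z) = N2 z.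
  rewrite !N2_complex; apply: eq_bigr => k _; rewrite mxE Normc.normcM /=.
  by rewrite expr0n /= expr1n add0r sqrtr1 mul1r.
lra.
Qed.

(** Second-order expansion at [z0] with complex Hessian [A]; as [N2] is already squared, the error
    is o(|z - z0|^2). *)
Definition tay phi z0 A := exists q, [/\ quad A q, q z0 = phi z0 &
  forall e : R, 0 < e -> exists2 r : R, 0 < r &
    forall z, N2 (z - z0) < r -> `|phi z - q z| <= e * N2 (z - z0)].

Lemma quad_tay A q z0 : quad A q -> tay q z0 A.
Proof.
move=> qA; exists q; split => // e e0; exists 1 => // z _.
by rewrite subrr normr0 mulr_ge0 ?N2_ge0 // ltW.
Qed.

Lemma tayD A B u phi z0 : tay u z0 A -> tay phi z0 B -> tay (fun z => u z + phi z) z0 (A + B).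
Proof.
move=> [q [qA q0 hq]] [p [pB p0 hp]]; exists (fun z => q z + p z); split.
- exact: quadD.
- by rewrite q0 p0.
- move=> e e0; have e2 : 0 < e / 2 by lra.
  have [r r0 h] := hq _ e2; have [s s0 k] := hp _ e2.
  exists (Num.min r s); first by rewrite lt_min r0.
  move=> z; rewrite lt_min => /andP[/h h1 /k h2].
  rewrite opprD addrACA (le_trans (ler_normD _ _)) //; lra.
Qed.

Lemma tay_translate t A u z0 : tay u (z0 + t) A -> tay (fun z => u (z + t)) z0 A.
Proof.
move=> [q [qA q0 hq]]; exists (fun z => q (z + t)); split => //; first exact: quad_translate.
move=> e /hq[r r0 h]; exists r => // z zr.
have E : z - z0 = z + t - (z0 + t) by rewrite opprD addrACA subrr addr0.
by rewrite E; apply: h; rewrite -E.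
Qed.

(** A minimum up to o(|z - z0|^2): summed over the four points of [quad_levi], the lower bound
    bounds the form at b from below by - e |b|^2. *)
Lemma quad_nonneg A q z0 : quad A q -> 0 <= q z0 ->
    (forall e : R, 0 < e -> exists2 r : R, 0 < r & forall z, N2 (z - z0) < r -> q z0 - e * N2 (z - z0) <= q z) ->
  psd A.
Proof.
move=> qA _ H b; apply: contrapT => /negP; rewrite -ltNge => hb.
pose s := hermitian_form A b.
have N0 := N2_ge0 b.
(* This makes e |b|^2 < - s; the factor [t] below brings the four points within squared distance r
   of z0. *)
pose e := - s / (2 * (N2 b + 1)).
have e0 : 0 < e by rewrite divr_gt0 ?oppr_gt0 //; lra.
have eE : e * (2 * (N2 b + 1)) = - s by rewrite divfK // gt_eqF //; lra.
have [r r0 h] := H e e0.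
pose t := Num.sqrt (r / (2 * (N2 b + 1))).
have t2 : t ^+ 2 * (2 * (N2 b + 1)) = r.
  rewrite sqr_sqrtr ?divr_ge0 ?(ltW r0) //; last lra.
  by rewrite divfK // gt_eqF //; lra.
have tpos : 0 < t ^+ 2.
  have rr : 0 < r / (2 * (N2 b + 1)) by rewrite divr_gt0 //; lra.
  by rewrite sqr_sqrtr // ltW.
have tr : t ^+ 2 * N2 b < r by nra.
have key c : N2 c = t ^+ 2 * N2 b -> q z0 - e * (t ^+ 2 * N2 b) <= q (z0 + c).
  by move=> Nc; have := h (c + z0); rewrite addrK Nc (addrC c) => /(_ tr).
have Ni c : N2 ('i *: c) = N2 c.
  rewrite !N2_complex; apply: eq_bigr => k _; rewrite mxE Normc.normcM /=.
  by rewrite expr0n /= expr1n add0r sqrtr1 mul1r.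
have := quad_levi z0 (t%:C *: b) qA.
have -> : hermitian_form A (t%:C *: b) = t ^+ 2 * s.
  rewrite /s /hermitian_form -ReZ mulr_sumr; congr complex.Re; apply: eq_bigr => i _.
  rewrite mulr_sumr; apply: eq_bigr => j _; rewrite !mxE.
  by case: (A j i) => ? ?; case: (b 0 i) => ? ?; case: (b 0 j) => ? ? /=; congr (_ +i* _); ring.
have := key (t%:C *: b) (N2Z _ _).
have := key (- (t%:C *: b)); rewrite N2N N2Z => /(_ erefl).
have := key ('i *: (t%:C *: b)); rewrite Ni N2Z => /(_ erefl).
have := key (- ('i *: (t%:C *: b))); rewrite N2N Ni N2Z => /(_ erefl).
have : 0 < - s by rewrite oppr_gt0.
move: eE; move: (q z0) (q _) (q _) (q _) (q _) => x x1 x2 x3 x4.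
set T := t ^+ 2 in tpos *; set N := N2 b in N0 *.
move=> eE s0 k1 k2 k3 k4 E.
have : T * s >= - (e * (T * N)) by lra.
have : e * N < - s by nra.
nra.
Qed.

(** Viscosity subsolutions of an arbitrary condition [P] on the point, the value and the Hessian.
    All quadratics are tested, not only those with A >= 0, so that A >= 0 can be part of [P]. *)
Definition vsub (P : 'CV[R]_n -> R -> 'M[R[i]]_n -> Prop) U u :=
  forall z0 A q, U z0 -> quad A q -> touches_above q u z0 -> P z0 (u z0) A.

Lemma tay_below_quad A B phi q z0 : tay phi z0 A -> quad B q ->
  (\forall z \near z0, phi z - q z <= phi z0 - q z0) -> psd (B - A).
Proof.
move=> [p [pA p0 hp]] qB /nbhsN2P[r r0 h].
have qd := quadB qB pA; have := quadD qd (quad_cst n (p z0 - q z0)); rewrite addr0 => qd'.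
apply: (quad_nonneg (z0 := z0) qd'); first by lra.
move=> e e0; have [s s0 k] := hp _ e0.
exists (Num.min r s); first by rewrite lt_min r0.
move=> z; rewrite lt_min => /andP[/h h1 /k]; rewrite ler_norml => /andP[k1 k2].
rewrite p0; lra.
Qed.

(** Adding e |z - z1|^2 to the Taylor polynomial absorbs the remainder and makes it an admissible
    test function, at the price of e in the Hessian. *)
Lemma vsub_tay P U u phi A z1 (e : R) : vsub P U u -> U z1 -> tay phi z1 A -> 0 < e ->
  (\forall z \near z1, u z - phi z <= u z1 - phi z1) -> P z1 (u z1) (A + (e%:C)%:M).
Proof.
move=> vu Uz1 [q [qA q0 hq]] e0 /nbhsN2P[r r0 h].
have qq := quadD (quadD qA (quad_N2_shift e z1)) (quad_cst n (u z1 - phi z1)).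
rewrite addr0 in qq; apply: vu qq _ => //; split.
  by rewrite subrr N2_0 mulr0 addr0 q0 addrC subrK.
have [s s0 k] := hq _ e0; apply/nbhsN2P.
exists (Num.min r s); first by rewrite lt_min r0.
move=> z; rewrite lt_min => /andP[/h h1 /k]; rewrite ler_norml => /andP[k1 k2].
lra.
Qed.

(** Stability under limits, with one-sided hypotheses that also fit suprema: away from z0, v may lie
    far below u. Once e |z - z0|^2 is added to q, the maximum over a small ball is interior and
    yields a contact point near z0. *)
Lemma vsub_stable P u z0 A q (r0 e : R) : quad A q -> touches_above q u z0 -> 0 < r0 ->
    (forall d : R, 0 < d -> exists v, [/\ vsub P [set z | N2 (z - z0) < r0] v,
       (forall z, N2 (z - z0) < r0 -> cts_at [set z | N2 (z - z0) < r0] v z),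
       (forall z, N2 (z - z0) < r0 -> v z <= u z + d) & u z0 - d <= v z0]) ->
    0 < e ->
  exists z1 v, [/\ N2 (z1 - z0) < e, N2 (z1 - z0) < r0, `|v z1 - u z0| <= e,
     v z1 <= u z1 + e & P z1 (v z1) (A + (e%:C)%:M)].
Proof.
move=> qA [q0 /nbhsN2P[r1 r10 hr1]] r00 H e0.
have e4 : 0 < e / 4 by lra.
have [r2 r20 hr2] := continuous_cts_at setT z0 (quad_continuous qA) e4.
have [r [rpos rr0 rr1 rr2 re]] : exists r, [/\ 0 < r, r < r0, r < r1, r < r2 & r < e].
  exists (Num.min (Num.min r0 r1) (Num.min r2 e) / 2).
  set m := Num.min _ _; have m0 : 0 < m by rewrite !lt_min r00 r10 r20.
  have : m <= m by []; rewrite {2}/m !le_min => /andP[/andP[a b] /andP[c d]].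
  split; lra.
(* On the sphere the added term costs e r, while the errors of v there and at z0 sum to 2 d; hence d
   <= e r / 4 excludes a maximum on the sphere. The bound e / 4 controls the value at z1. *)
pose d := Num.min (e / 4) (e * r / 4).
have er0 : 0 < e * r by rewrite mulr_gt0.
have d0 : 0 < d by rewrite lt_min e4; lra.
have : d <= d by []; rewrite {2}/d le_min => /andP[d1 d2].
have [v [vv cv vu v0]] := H d d0.
pose phi z := v z - (q z + e * N2 (z - z0)).
have [z zr|z1 z1r phimax] := @ball_max z0 r phi (ltW rpos).
  apply: (@cts_at_sub _ _ [set z | N2 (z - z0) < r0]) => [x /= xr|]; first lra.
  apply: cts_atB; first by apply: cv; lra.
  apply/continuous_cts_at/quad_continuous.
  exact: quadD qA (quad_N2_shift e z0).
have phi0 : - d <= phi z1.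
  apply: le_trans (phimax z0 _); last by rewrite subrr N2_0 ltW.
  by rewrite /phi subrr N2_0 mulr0 addr0 q0; lra.
have uq z : N2 (z - z0) <= r -> u z <= q z by move=> zr; apply: hr1; lra.
have z1r' : N2 (z1 - z0) < r.
  rewrite lt_neqAle z1r andbT; apply/negP => /eqP E.
  by move: phi0; rewrite /phi E; have := vu z1; have := uq z1 z1r; lra.
have /(hr2 _ I) : N2 (z1 - z0) < r2 by lra.
rewrite q0 ltr_norml => /andP[k1 k2].
have vuz1 : v z1 <= u z1 + d by apply: vu; lra.
have N0 := N2_ge0 (z1 - z0).
have eN0 : 0 <= e * N2 (z1 - z0) by rewrite mulr_ge0 // ltW.
exists z1, v; split; try lra.
  rewrite ler_norml; apply/andP; split; last by have := uq z1 z1r; lra.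
  by move: phi0; rewrite /phi; lra.
have qq := quadD (quadD qA (quad_N2_shift e z0)) (quad_cst n (phi z1)).
rewrite addr0 in qq; apply: vv qq _ => /=; first lra.
split; first by rewrite /phi addrC subrK.
have /openN2P/(_ z1 z1r')[s s0 hs] := @open_ballN2 R n z0 r.
apply/nbhsN2P; exists s => // z /hs /= /ltW /phimax; rewrite /phi; lra.
Qed.

End Touching.

Section MeanValue.
Variable R : realType.

Lemma mean_value (f df : R -> R) (x : R) :
    (forall t : R, `|t| <= `|x| -> is_derive t (1 : R) f (df t)) ->
  exists2 c, `|c| <= `|x| & f x - f 0 = x * df c.
Proof.
move=> H.
have ctf t : `|t| <= `|x| -> {for t, continuous f}.
  by move=> /H dt; apply/differentiable_continuous/derivable1_diffP; exact: ex_derive.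
have [x0|x0|->] := ltgtP x 0; last by exists 0 => //; rewrite mul0r subrr.
- have [||c cI E] := @MVT _ f df x 0 x0.
  + by move=> t /itvP tI; apply: H; rewrite !ler0_norm ?lerN2 ?tI // ltW.
  + apply: derivable_within_continuous => t /itvP tI.
    have dt : is_derive t (1 : R) f (df t).
      by apply: H; rewrite !ler0_norm ?lerN2 ?tI // ltW.
    exact: ex_derive.
  exists c; last by move: E; rewrite sub0r; nra.
  by move: cI => /itvP cI; rewrite !ler0_norm ?lerN2 ?cI // ltW.
- have [||c cI E] := @MVT _ f df 0 x x0.
  + by move=> t /itvP tI; apply: H; rewrite !ger0_norm ?tI // ltW.
  + apply: derivable_within_continuous => t /itvP tI.
    have dt : is_derive t (1 : R) f (df t).
      by apply: H; rewrite !ger0_norm ?tI // ltW.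
    exact: ex_derive.
  exists c; last by move: E; rewrite subr0; nra.
  by move: cI => /itvP cI; rewrite !ger0_norm ?cI // ltW.
Qed.

End MeanValue.

(** * Taylor's formula to second order, along coordinate paths *)

Section Taylor.
Variables (R : realType) (n : nat).
Implicit Types (z w : 'CV[R]_n) (a b : real_coord n) (phi u : 'CV[R]_n -> R) (Om : set 'CV[R]_n).

Lemma line_derive Om phi a z (t : R) : C1_on Om phi -> Om (z + t%:C *: coord_dir R a) ->
  is_derive t (1 : R) (fun s : R => phi (z + s%:C *: coord_dir R a)) (pderiv a phi (z + t%:C *: coord_dir R a)).
Proof.
move=> C1 Oz; have [/(_ _ Oz) dz _] := C1 a.
have E h : phi (z + (h *: (1 : R) + t)%:C *: coord_dir R a) =
  coord_line phi a (z + t%:C *: coord_dir R a) (h *: (1 : R) + 0).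
  by rewrite /coord_line addr0 rmorphD scalerDl -addrA [X in z + X]addrC.
have E0 : phi (z + t%:C *: coord_dir R a) = coord_line phi a (z + t%:C *: coord_dir R a) 0.
  by rewrite /coord_line scale0r addr0.
pose F s : R := phi (z + s%:C *: coord_dir R a).
pose G := coord_line phi a (z + t%:C *: coord_dir R a).
have EE : (fun h : R => h^-1 *: ((F \o shift t) (h *: (1 : R)) - F t)) =
          (fun h : R => h^-1 *: ((G \o shift 0) (h *: (1 : R)) - G 0)).
  by apply/funext => h; rewrite /= /F /G E E0.
split.
  by rewrite /derivable -/F EE.
by rewrite /pderiv derive1E /derive -/F EE.
Qed.

(** The increment w restricted to the coordinates in [s]. Adding one coordinate at a time joins z to
    z + w by a path on which the one-variable mean value theorem applies. *)
Definition partial_vec (s : seq (real_coord n)) w : 'CV[R]_n :=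
  \sum_(b <- s) (rc b w)%:C *: coord_dir R b.

Lemma rc_sum a (I : Type) (s : seq I) (F : I -> 'CV[R]_n) : rc a (\sum_(i <- s) F i) = \sum_(i <- s) rc a (F i).
Proof. by elim: s => [|i s IH]; rewrite ?big_nil ?rc0 // !big_cons rcD IH. Qed.

Lemma rc_partial_vec a s w : uniq s -> rc a (partial_vec s w) = if a \in s then rc a w else 0.
Proof.
rewrite rc_sum; elim: s => [|b s IH] /=; first by rewrite big_nil.
move=> /andP[bs us]; rewrite big_cons IH // rcZ rc_coord_dir in_cons.
have [->|_] := eqVneq a b; last by rewrite mulr0 add0r.
by rewrite (negbTE bs) mulr1 addr0.
Qed.

Lemma partial_vec_full w : partial_vec (index_enum (real_coord n)) w = w.
Proof. by apply: rc_inj => a; rewrite rc_partial_vec ?index_enum_uniq // mem_index_enum. Qed.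

Lemma N2_mono z w : (forall a, `|rc a z| <= `|rc a w|) -> N2 z <= N2 w.
Proof.
move=> H; apply: ler_sum => a _.
by rewrite -(real_normK (num_real (rc a z))) -(real_normK (num_real (rc a w))) ler_pXn2r ?nnegrE.
Qed.

Lemma N2_partial_vec_line s a w (t : R) : uniq (a :: s) -> `|t| <= `|rc a w| ->
  N2 (partial_vec s w + t%:C *: coord_dir R a) <= N2 w.
Proof.
move=> /andP[na us] ht; apply: N2_mono => b; rewrite rcD rcZ rc_coord_dir rc_partial_vec //.
have [->|_] := eqVneq b a; first by rewrite (negbTE na) add0r mulr1.
by rewrite mulr0 addr0; case: ifP => // _; rewrite normr0.
Qed.

Lemma taylor1 Om phi z (e : R) : open Om -> C1_on Om phi -> Om z -> 0 < e ->
  exists2 r : R, 0 < r & forall w, N2 w < r ->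
    `|phi (z + w) - phi z - \sum_a pderiv a phi z * rc a w| <= e * \sum_a `|rc a w|.
Proof.
move=> oO C1 Oz e0.
have [r0 r00 hr0] := (openN2P Om).1 oO z Oz.
have [r rpos hr] : exists2 r : R, 0 < r & forall a w, N2 w < r ->
    Om (z + w) /\ `|pderiv a phi (z + w) - pderiv a phi z| <= e.
  have H a : exists2 r : R, 0 < r & forall w, N2 w < r -> `|pderiv a phi (z + w) - pderiv a phi z| <= e.
    have [_ /withinN2P/(_ z Oz e e0)[r r1 h]] := C1 a.
    exists (Num.min r r0) => [|w]; first by rewrite lt_min r1.
    rewrite lt_min => /andP[wr wr0]; apply/ltW/h.
      by apply: hr0; rewrite addrC addKr.
    by rewrite addrC addKr.
  have [rr hrr] := choice (fun a => let: ex_intro2 r p q := H a in ex_intro _ r (conj p q)).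
  exists (\big[Num.min/r0]_a rr a).
    by elim/big_ind: _ => // [x y x0 y0|a _]; [rewrite lt_min x0|exact: (hrr a).1].
  move=> a w; rewrite (bigD1 a) //= lt_min => /andP[w1 w2]; split; last exact: (hrr a).2.
  apply: hr0; rewrite addrC addKr; apply: lt_le_trans w2 _.
  by elim/big_rec: _ => // b x _ xr; rewrite ge_min xr orbT.
exists r => // w wr; rewrite -{1}(partial_vec_full w).
elim: (index_enum _) (index_enum_uniq (real_coord n)) => [|a s IH] us.
  by rewrite /partial_vec !big_nil addr0 subrr subr0 normr0 mulr0.
have [na us'] := andP us; rewrite !big_cons /partial_vec big_cons -/(partial_vec s w).
have [|c cx E] := @mean_value _ (fun t => phi (z + partial_vec s w + t%:C *: coord_dir R a))
   (fun t => pderiv a phi (z + partial_vec s w + t%:C *: coord_dir R a)) (rc a w).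
  move=> t ht; apply: line_derive C1 _; rewrite -addrA; apply: (hr a _ _).1.
  exact: le_lt_trans (N2_partial_vec_line us ht) wr.
rewrite scale0r addr0 in E.
have -> : phi (z + ((rc a w)%:C *: coord_dir R a + partial_vec s w)) - phi z
   - (pderiv a phi z * rc a w + \sum_(b <- s) pderiv b phi z * rc b w) =
  (phi (z + partial_vec s w) - phi z - \sum_(b <- s) pderiv b phi z * rc b w) +
  (pderiv a phi (z + partial_vec s w + c%:C *: coord_dir R a) - pderiv a phi z) * rc a w.
  rewrite [X in z + X]addrC addrA; move: E; nra.
rewrite mulrDr addrC (le_trans (ler_normD _ _)) // lerD ?IH // normrM ler_wpM2r //.
rewrite -addrA; apply: (hr a _ _).2; exact: le_lt_trans (N2_partial_vec_line us cx) wr.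
Qed.

Definition hess u z a b : R := pderiv b (pderiv a u) z.

(** The step in direction a starts at [partial_vec s' w], so its first derivative meets only the
    coordinates of s'; each mixed product thus occurs exactly once, without a factor 1/2. *)
Fixpoint taylor_poly u z (s : seq (real_coord n)) w : R :=
  if s is a :: s' then
    pderiv a u z * rc a w + hess u z a a / 2 * rc a w ^+ 2
    + rc a w * \sum_b hess u z a b * rc b (partial_vec s' w) + taylor_poly u z s' w
  else 0.

Lemma taylor2 Om u z (e : R) : open Om -> C2_on Om u -> Om z -> 0 < e ->
  exists2 r : R, 0 < r & forall w, N2 w < r ->
    `|u (z + w) - u z - taylor_poly u z (index_enum (real_coord n)) w| <= e * N2 w.
Proof.
move=> oO [cu C1 C2] Oz e0.
pose D : R := (size (index_enum (real_coord n)))%:R.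
have D0 : 0 <= D by rewrite ler0n.
(* Each of the D steps costs e1 (D nu) nu with nu^2 = |w|^2, and D^2 <= (D + 1)^2; D + 1 keeps the
   denominator positive. *)
have e1 : 0 < e / ((D + 1) * (D + 1)) by rewrite divr_gt0 // mulr_gt0 // ltr_wpDl.
have [r0 r00 hr0] := (openN2P Om).1 oO z Oz.
have H a := taylor1 oO (C2 a) Oz e1.
have [rr hrr] := choice (fun a => let: ex_intro2 r p q := H a in ex_intro _ r (conj p q)).
exists (\big[Num.min/r0]_a rr a).
  by elim/big_ind: _ => // [x y x0 y0|a _]; [rewrite lt_min x0|exact: (hrr a).1].
move=> w wr.
have wr0 : N2 w < r0.
  by apply: lt_le_trans wr _; elim/big_rec: _ => // b x _ xr; rewrite ge_min xr orbT.
have wra a : N2 w < rr a.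
  by move: wr; rewrite (bigD1 a) //= lt_min => /andP[].
pose nu := Num.sqrt (N2 w).
have nu2 : nu ^+ 2 = N2 w by rewrite sqr_sqrtr // N2_ge0.
have nu0 : 0 <= nu by exact: sqrtr_ge0.
have rcnu a y : N2 y <= N2 w -> `|rc a y| <= nu.
  move=> yw; rewrite -(ler_pXn2r (n := 2)) ?nnegrE // real_normK ?num_real // nu2.
  exact: le_trans (rc_le_N2 a y) yw.
have sumnu (y : 'CV[R]_n) : N2 y <= N2 w -> \sum_a `|rc a y| <= D * nu.
  move=> yw; apply: (@le_trans _ _ (\sum_(a : real_coord n) nu)).
    by apply: ler_sum => a _; exact: rcnu.
  by rewrite big_const_seq count_predT iter_addr_0 -mulr_natl.
suff : forall s, uniq s -> `|u (z + partial_vec s w) - u z - taylor_poly u z s w| <=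
    \sum_(a <- s) (e / ((D + 1) * (D + 1)) * (D * nu) * nu).
  move=> /(_ _ (index_enum_uniq (real_coord n))); rewrite partial_vec_full => /le_trans; apply.
  rewrite big_const_seq count_predT iter_addr_0 -mulr_natl -/D.
  have -> : D * (e / ((D + 1) * (D + 1)) * (D * nu) * nu) = e / ((D + 1) * (D + 1)) * (D * D) * N2 w.
    by rewrite -nu2; ring.
  rewrite ler_wpM2r ?N2_ge0 // mulrAC -mulrA ger_pMr // ler_pdivrMr ?mul1r; first nra.
  by rewrite mulr_gt0 // ltr_wpDl.
elim=> [|a s IH] us.
  by rewrite /partial_vec !big_nil addr0 subrr sub0r oppr0 normr0.
have [na us'] := andP us; rewrite [taylor_poly _ _ _ _]/= big_cons /partial_vec big_cons -/(partial_vec s w).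
(* After subtracting k t + (u_aa / 2) t^2, the derivative in t is the first-order Taylor remainder
   of [pderiv a u], which [taylor1] bounds. *)
pose k := pderiv a u z + \sum_b hess u z a b * rc b (partial_vec s w).
have [|c cx E] := @mean_value _
   (fun t => u (z + partial_vec s w + t%:C *: coord_dir R a) - (k * t + hess u z a a / 2 * t ^+ 2))
   (fun t => pderiv a u (z + partial_vec s w + t%:C *: coord_dir R a) - (k + hess u z a a * t)) (rc a w).
  move=> t ht.
  have d1 : is_derive t (1 : R) (fun t => u (z + partial_vec s w + t%:C *: coord_dir R a))
     (pderiv a u (z + partial_vec s w + t%:C *: coord_dir R a)).
    apply: line_derive C1 _; rewrite -addrA; apply: hr0.
    have -> x : z + x - z = x by rewrite addrC addKr.
    exact: le_lt_trans (N2_partial_vec_line us ht) wr0.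
  have d2 : is_derive t (1 : R) (fun t : R => k * t + hess u z a a / 2 * t ^+ 2) (k + hess u z a a * t).
    apply: is_derive_eq; rewrite /GRing.scale /=; lra.
  exact: is_deriveB.
rewrite scale0r addr0 mulr0 expr0n mulr0 addr0 subr0 in E.
set S := \sum_b _; rewrite -/S in k E.
have -> : u (z + ((rc a w)%:C *: coord_dir R a + partial_vec s w)) - u z
   - (pderiv a u z * rc a w + hess u z a a / 2 * rc a w ^+ 2 + rc a w * S + taylor_poly u z s w) =
  (u (z + partial_vec s w) - u z - taylor_poly u z s w) +
  (pderiv a u (z + partial_vec s w + c%:C *: coord_dir R a) - (k + hess u z a a * c)) * rc a w.
  rewrite [X in z + X]addrC addrA; move: E; rewrite /k; lra.
rewrite addrC (le_trans (ler_normD _ _)) // lerD ?IH // normrM ler_pM ?normr_ge0 ?rcnu //.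
have yw := N2_partial_vec_line us cx.
have := (hrr a).2 _ (le_lt_trans yw (wra a)).
rewrite addrA => /le_trans h.
have -> : k + hess u z a a * c = pderiv a u z +
    \sum_b hess u z a b * rc b (partial_vec s w + c%:C *: coord_dir R a).
  rewrite /k -addrA; congr (_ + _); rewrite -/S.
  under [RHS]eq_bigr do rewrite rcD rcZ rc_coord_dir mulrDr.
  rewrite big_split /= -/S; congr (_ + _).
  rewrite (bigD1 a) //= eqxx mulr1 big1 ?addr0 // => b ba.
  by rewrite (negbTE ba) !mulr0.
rewrite opprD addrA; apply: h; rewrite ler_wpM2l ?(ltW e1) //; exact: sumnu.
Qed.

Lemma quad_sum (I : Type) (s : seq I) (F : I -> 'CV[R]_n -> R) :
  (forall i, exists A, quad A (F i)) -> exists A, quad A (fun w => \sum_(i <- s) F i w).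
Proof.
move=> H; elim: s => [|i s [B qB]].
  by exists 0; under eq_fun do rewrite big_nil; exact: quad_cst.
have [A qA] := H i; exists (A + B); under eq_fun do rewrite big_cons; exact: quadD.
Qed.

Lemma quad_taylor_poly u z s : exists A, quad A (taylor_poly u z s).
Proof.
elim: s => [|a s [B qB]]; first by exists 0; exact: quad_cst.
have [A qA] := quad_rcM R a a.
have [C qC] : exists C, quad C (fun w => rc a w * \sum_b hess u z a b * rc b (partial_vec s w)).
  have [C qC] : exists C, quad C (fun w => \sum_(c <- s) hess u z a c * (rc a w * rc c w)).
    apply: quad_sum => c; have [C qC] := quad_rcM R a c.
    by exists ((hess u z a c)%:C *: C); exact: quadZ.
  exists C; move: qC; congr quad; apply/funext => w.
  under [in RHS]eq_bigr do rewrite rc_sum mulr_sumr.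
  rewrite exchange_big mulr_sumr; apply: eq_bigr => c _.
  rewrite (bigD1 c) //= big1 ?addr0 => [|b bc]; last first.
    by rewrite rcZ rc_coord_dir (negbTE bc) !mulr0.
  by rewrite rcZ rc_coord_dir eqxx mulr1 mulrCA.
exists ((pderiv a u z)%:C *: 0 + (hess u z a a / 2)%:C *: A + C + B).
apply: quadD qB; apply: quadD qC; apply: quadD; first by apply/quadZ/quad_rc.
by apply: quadZ; move: qA; congr quad; apply/funext => w; rewrite expr2.
Qed.

Lemma taylor_poly_coord_dir u z s a (t : R) : uniq s ->
  taylor_poly u z s (t%:C *: coord_dir R a) =
  if a \in s then pderiv a u z * t + hess u z a a / 2 * t ^+ 2 else 0.
Proof.
elim: s => [|c s IH] // us; have [nc us'] := andP us.
rewrite [LHS]/= IH // in_cons rcZ rc_coord_dir eq_sym.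
have [ac|ac] := eqVneq a c; last first.
  rewrite orFb; move: (\sum_b _) (if _ then _ else _) (pderiv c u z) (hess u z c c).
  by rewrite (_ : false%:R = 0 :> R) // => *; ring.
have pv0 : partial_vec s (t%:C *: coord_dir R a) = 0.
  apply: rc_inj => b; rewrite rc_partial_vec // rcZ rc_coord_dir rc0; case: ifP => bs //.
  by rewrite ac (_ : b == c = false) ?mulr0 //; apply/eqP => bc; rewrite bc (negbTE nc) in bs.
rewrite pv0 ac (negbTE nc) orTb (_ : \sum_b _ = 0); last first.
  by apply: big1 => b _; rewrite rc0; move: (hess u z c b) => ?; rewrite mulr0.
by move: (pderiv c u z) (hess u z c c) => *; rewrite (_ : true%:R = 1 :> R) // mulr0 !addr0 mulr1.
Qed.

Lemma taylor_poly0 u z s : taylor_poly u z s 0 = 0.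
Proof.
elim: s => // a s IH; rewrite [LHS]/= IH rc0.
by move: (\sum_b _) (pderiv a u z) (hess u z a a) => *; ring.
Qed.

Lemma coord_dir_true (k : 'I_n) : coord_dir R (k, true) = 'i *: coord_dir R (k, false).
Proof. by rewrite /coord_dir scale1r. Qed.

Lemma mxtrace_hermitian_form (A : 'M[R[i]]_n) :
  complex.Re (\tr A) = \sum_k hermitian_form A (coord_dir R (k, false)).
Proof.
by rewrite /mxtrace Re_sum; apply: eq_bigr => k _; rewrite hermitian_formE /coord_dir scale1r cform_delta.
Qed.

(** The diagonal entry A_kk is a quarter of the Laplacian in the k-th complex variable, by
    [quad_levi] at e_k, - e_k, i e_k and - i e_k. *)
Lemma tay_C2 Om u z : open Om -> C2_on Om u -> Om z ->
  exists2 A, tay u z A & complex.Re (\tr A) = laplacian u z / 4.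
Proof.
move=> oO C2 Oz; set s := index_enum (real_coord n).
have us : uniq s := index_enum_uniq _.
have [A qA] := quad_taylor_poly u z s.
have q' := quadD (quad_translate (- z) qA) (quad_cst n (u z)); rewrite addr0 in q'.
have T0 : taylor_poly u z s 0 = 0 := taylor_poly0 u z s.
exists A.
  exists (fun x => taylor_poly u z s (x - z) + u z); split => //.
    by rewrite subrr T0 add0r.
  move=> e e0; have [r r0 h] := taylor2 oO C2 Oz e0; exists r => // x /h.
  by rewrite [z + _]addrC subrK opprD addrA addrAC.
rewrite mxtrace_hermitian_form /laplacian mulr_suml; apply: eq_bigr => k _.
have := quad_levi 0 (coord_dir R (k, false)) qA.
rewrite -coord_dir_true !add0r T0.
have E a : taylor_poly u z s (coord_dir R a) = pderiv a u z + hess u z a a / 2 /\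
    taylor_poly u z s (- coord_dir R a) = - pderiv a u z + hess u z a a / 2.
  have := @taylor_poly_coord_dir u z s a 1 us; have := @taylor_poly_coord_dir u z s a (-1) us.
  rewrite mem_index_enum (_ : (-1)%:C *: coord_dir R a = - coord_dir R a); last first.
    by apply: rc_inj => b; rewrite rcZ rcN mulN1r.
  rewrite scale1r => -> ->; move: (pderiv a u z) (hess u z a a) => *; split; ring.
have [-> ->] := E (k, false); have [-> ->] := E (k, true).
rewrite /hess; move: (pderiv (k, false) (pderiv (k, false) u) z)
  (pderiv (k, true) (pderiv (k, true) u) z) (pderiv (k, false) u z) (pderiv (k, true) u z)
  (hermitian_form _ _) => *; lra.
Qed.

End Taylor.

(** Otherwise the sets A for which P holds on K minus A form a proper filter; at a cluster point x
    in K, the local hypothesis puts the complement of a neighbourhood of x into this filter. *)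
Lemma compact_induction (T : topologicalType) (K : set T) (P : set T -> Prop) :
    compact K -> P set0 -> (forall A B, A `<=` B -> P B -> P A) ->
    (forall A B, P A -> P B -> P (A `|` B)) ->
    (forall x, K x -> exists2 V, nbhs x V & P V) -> P K.
Proof.
move=> cK P0 Pm PU loc; apply: contrapT => nPK.
pose F : set_system T := [set A | P (K `\` A)].
have FF : ProperFilter F.
  split; first by rewrite /F /= setD0.
  split.
  - by rewrite /F /= setDT.
  - by move=> A B PA PB; rewrite /F /= setDIr; exact: PU.
  - by move=> A B AB; apply: Pm => x [Kx nB]; split => // Ax; exact/nB/AB.
have FK : F K by rewrite /F /= setDv.
have [x [Kx clx]] := cK F FF FK.
have [V nV PV] := loc x Kx.
have FV : F (~` V).
  by apply: Pm PV => y [_ /contrapT].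
by have [y [nVy Vy]] := clx _ _ FV nV.
Qed.

(* The error e_k = |t| - p_k satisfies e_{k+1} = e_k (1 - (|t| + p_k)/2), whence
   e_k (1 + k |t| / 2) <= |t|. *)
Fixpoint abs_iter (R : realType) (k : nat) (t : R) : R :=
  if k is k'.+1 then abs_iter k' t + 2^-1 * (t * t + (-1) * (abs_iter k' t * abs_iter k' t)) else 0.

Lemma abs_iterP (R : realType) k (t : R) : `|t| <= 1 ->
  0 <= abs_iter k t <= `|t| /\ (`|t| - abs_iter k t) * (1 + k%:R * `|t| / 2) <= `|t|.
Proof.
move=> t1; have t0 := normr_ge0 t.
have tt : t * t = `|t| * `|t| by rewrite -normrM ger0_norm // -expr2 sqr_ge0.
elim: k => [|k [/andP[p0 pt] IH]] /=; first by rewrite lexx t0; split => //; lra.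
rewrite tt; move: (abs_iter k t) p0 pt IH => p p0 pt IH.
move: `|t| t1 t0 {tt} pt IH => s t1 t0 pt IH.
have k0 : 0 <= k%:R :> R by rewrite ler0n.
split; first by apply/andP; split; nra.
have -> : s - (p + 2^-1 * (s * s + -1 * (p * p))) = (s - p) * (1 - (s + p) / 2) by lra.
rewrite -(natr1 k); apply: le_trans IH; rewrite -mulrA ler_wpM2l ?subr_ge0 //.
have ks : 0 <= k%:R * s by rewrite mulr_ge0.
have B0 : 0 <= p * (1 + (k%:R + 1) * s / 2) by apply: mulr_ge0 => //; nra.
have := mulr_ge0 k0 (mulr_ge0 t0 t0); have := mulr_ge0 t0 t0.
move: B0; rewrite !mulrDr !mulrDl; lra.
Qed.

(** * Approximation by harmonic polynomials *)

Section StoneWeierstrass.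
Variables (R : realType) (n : nat) (K : set 'CV[R]_n) (A : ('CV[R]_n -> R) -> Prop).
Hypotheses (cK : compact K) (A_cst : forall c, A (fun=> c))
  (A_add : forall f g, A f -> A g -> A (fun z => f z + g z))
  (A_mul : forall f g, A f -> A g -> A (fun z => f z * g z))
  (A_cts : forall f, A f -> continuous f)
  (A_sep : forall x y, x != y -> exists2 f, A f & f x != f y).

Let approx (f : 'CV[R]_n -> R) := forall e : R, 0 < e ->
  exists2 g, A g & forall x, K x -> `|f x - g x| < e.

Let approx_A f : A f -> approx f.
Proof. by move=> Af e e0; exists f => // x _; rewrite subrr normr0. Qed.

Let approx_add f g : approx f -> approx g -> approx (fun z => f z + g z).
Proof.
move=> Hf Hg e e0; have e2 : 0 < e / 2 by lra.
have [f1 Af hf] := Hf _ e2; have [g1 Ag hg] := Hg _ e2.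
exists (fun z => f1 z + g1 z); first exact: A_add.
move=> x Kx; rewrite opprD addrACA (le_lt_trans (ler_normD _ _)) //.
have := hf x Kx; have := hg x Kx; lra.
Qed.

Let approx_scale (c : R) f : approx f -> approx (fun z => c * f z).
Proof.
move=> Hf e e0; have c0 : 0 < `|c| + 1 by rewrite ltr_wpDl.
have [f1 Af hf] := Hf _ (divr_gt0 e0 c0).
exists (fun z => c * f1 z); first exact: A_mul (A_cst c) Af.
move=> x /hf; rewrite ltr_pdivlMr // => hx; rewrite -mulrBr normrM.
by have := normr_ge0 (f x - f1 x); nra.
Qed.

Let A_bounded f : A f -> exists2 M : R, 0 < M & forall x, K x -> `|f x| <= M.
Proof.
move=> Af; have [M [_ H]] : bounded_set (f @` K).
  by apply: compact_bounded; apply: continuous_compact => //; apply/continuous_subspaceT/A_cts.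
exists (`|M| + 1) => [|z Kz]; first by rewrite ltr_wpDl.
apply: (H (`|M| + 1)); last by exists z.
by rewrite (le_lt_trans (ler_norm M)) // ltrDl.
Qed.

Let approx_abs f : approx f -> approx (fun z => `|f z|).
Proof.
move=> Hf e e0; have e2 : 0 < e / 2 by lra.
have [g Ag hg] := Hf _ e2; have [M M0 bM] := A_bounded Ag.
have Me0 : 0 <= 4 * M / e by rewrite divr_ge0 ?mulr_ge0 // ltW.
(* After rescaling by M, [abs_iterP] bounds the error by 2 M / k, which is then below e / 2. *)
have [k kM] : exists k : nat, 4 * M / e < k%:R.
  by exists (Num.bound (4 * M / e)); exact: archi_boundP.
have k0 : 0 < k%:R :> R by apply: le_lt_trans kM.
have AG j : A (fun z => abs_iter j (M^-1 * g z)).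
  elim: j => [|j IH] /=; first exact: A_cst.
  have Ag1 : A (fun z => M^-1 * g z) by exact: (A_mul (A_cst M^-1) Ag).
  apply: A_add => //; apply: (A_mul (A_cst 2^-1)); apply: A_add; first exact: A_mul.
  by apply: (A_mul (A_cst (-1))); exact: A_mul.
exists (fun z => M * abs_iter k (M^-1 * g z)); first exact: (A_mul (A_cst M) (AG k)).
move=> x Kx; have gM : `|M^-1 * g x| <= 1.
  by rewrite normrM normfV (gtr0_norm M0) mulrC ler_pdivrMr // mul1r bM.
have [/andP[p0 pt] E] := abs_iterP k gM.
have gE : `|g x| = M * `|M^-1 * g x|.
  by rewrite normrM normfV (gtr0_norm M0) mulrA divff ?mul1r // gt_eqF.
have h : `| `|g x| - M * abs_iter k (M^-1 * g x) | < e / 2.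
  rewrite gE -mulrBr ger0_norm ?mulr_ge0 ?subr_ge0 ?(ltW M0) //.
  have s0 := normr_ge0 (M^-1 * g x).
  have [s sE] : exists s : R, s = `|M^-1 * g x| by exists `|M^-1 * g x|.
  rewrite -sE in s0 gM pt E *; move: (abs_iter _ _) p0 pt E => p p0 pt E {gM gE sE}.
  have h2 : (s - p) * k%:R <= 2.
    have [sE|sn0] := eqVneq s 0; first by rewrite (_ : s - p = 0) ?mul0r; lra.
    have sp : 0 < s by rewrite lt_neqAle eq_sym sn0.
    have h3 : (s - p) * (k%:R * s / 2) <= s by move: E; rewrite mulrDr mulr1; lra.
    rewrite -(ler_pM2r sp); lra.
  have h1 : 4 * M < k%:R * e by rewrite -ltr_pdivrMr.
  rewrite -(ltr_pM2r k0); have := ler_wpM2l (ltW M0) h2; lra.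
have := hg x Kx; have := ler_dist_dist (f x) (g x).
have := ler_distD `|g x| `|f x| (M * abs_iter k (M^-1 * g x)).
lra.
Qed.

Let approx_max f g : approx f -> approx g -> approx (fun z => Num.max (f z) (g z)).
Proof.
move=> Hf Hg; have Hd := approx_add Hf (approx_scale (-1) Hg).
have := approx_scale 2^-1 (approx_add (approx_add Hf Hg) (approx_abs Hd)).
by congr approx; apply/funext => z; rewrite mulN1r maxr_absE mulrC.
Qed.

Let approx_min f g : approx f -> approx g -> approx (fun z => Num.min (f z) (g z)).
Proof.
move=> Hf Hg; have Hd := approx_add Hf (approx_scale (-1) Hg).
have := approx_scale 2^-1 (approx_add (approx_add Hf Hg) (approx_scale (-1) (approx_abs Hd))).
by congr approx; apply/funext => z; rewrite !mulN1r minr_absE mulrC.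
Qed.

Let two_points x y (a b : R) : (x = y -> a = b) -> exists f, [/\ A f, f x = a & f y = b].
Proof.
move=> ab; have [xy|xy] := eqVneq x y.
  by exists (fun=> a); split => //; exact: ab.
have [f Af fxy] := A_sep xy.
exists (fun z => a + (b - a) / (f y - f x) * (f z + (-1) * f x)); split.
- apply: A_add => //; apply: (A_mul (A_cst _)); apply: A_add => //; exact: (A_cst (-1 * f x)).
- by rewrite mulN1r subrr mulr0 addr0.
- rewrite mulN1r divfK; last by rewrite subr_eq0 eq_sym.
  by rewrite [LHS]addrC subrK.
Qed.

(** For fixed x, a finite minimum of two-point interpolants equals u at x and stays below u + e / 4;
    a finite maximum of these over x also stays above u - e / 4. [compact_induction] takes the place
    of finite subcovers. *)
Theorem stone_weierstrass u (e : R) : (forall z, K z -> cts_at K u z) -> 0 < e ->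
  exists2 f, A f & forall z, K z -> `|u z - f z| < e.
Proof.
move=> cu e0; have e4 : 0 < e / 4 by lra.
have near_le f x (d : R) : A f -> K x -> 0 < d -> exists2 V, nbhs x V &
    forall z, V z -> K z -> `|(f z - u z) - (f x - u x)| < d.
  move=> Af Kx d0; have /(_ _ d0) [r r0 h] : cts_at K (fun z => f z - u z) x.
    by apply: cts_atB; [exact/continuous_cts_at/A_cts|exact: cu].
  by exists [set z | N2 (z - x) < r] => [|z zr Kz]; [apply/nbhsN2P; exists r|exact: h].
have step x : K x -> exists f, [/\ approx f, f x = u x & forall z, K z -> f z < u z + e / 4].
  move=> Kx.
  (* The repeated premise [K z] is the [V z] of the induction predicate at V = K. *)
  have [f [Af fx fz]] : exists f, [/\ approx f, f x = u x & forall z, K z -> K z -> f z < u z + e / 4].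
    apply: (@compact_induction _ K (fun V => exists f, [/\ approx f, f x = u x &
      forall z, V z -> K z -> f z < u z + e / 4])) cK _ _ _ _.
    - have [//|f [Af fx _]] := @two_points x x (u x) (u x).
      by exists f; split => //; exact: approx_A.
    - by move=> V W VW [f [Af fx fz]]; exists f; split => // z /VW; exact: fz.
    - move=> V W [f [Af fx fz]] [g [Ag gx gz]].
      exists (fun z => Num.min (f z) (g z)); split; first exact: approx_min.
        by rewrite fx gx minxx.
      move=> z [/fz h|/gz h] Kz; rewrite gt_min h ?orbT //.
    - move=> y Ky; have [|f [Af fx fy]] := @two_points x y (u x) (u y); first by move=> ->.
      have [V nV h] := near_le f y _ Af Ky e4.
      exists V => //; exists f; split => //; first exact: approx_A.
      by move=> z Vz Kz; have := h z Vz Kz; rewrite fy subrr subr0 ltr_norml => /andP[]; lra.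
  by exists f; split => // z Kz; exact: fz.
have [[x0 Kx0]|K0] := pselect (K !=set0); last first.
  by exists (fun=> 0); [exact: A_cst|move=> z Kz; case: K0; exists z].
have [f [Af f1 f2]] : exists f, [/\ approx f, forall z, K z -> f z < u z + e / 4 &
    forall z, K z -> K z -> u z - e / 4 < f z].
  apply: (@compact_induction _ K (fun V => exists f, [/\ approx f,
    forall z, K z -> f z < u z + e / 4 & forall z, V z -> K z -> u z - e / 4 < f z])) cK _ _ _ _.
  - by have [f [Af _ f1]] := step _ Kx0; exists f.
  - by move=> V W VW [f [Af fx fz]]; exists f; split => // z /VW; exact: fz.
  - move=> V W [f [Af fx fz]] [g [Ag gx gz]].
    exists (fun z => Num.max (f z) (g z)); split; first exact: approx_max.
      by move=> z Kz; rewrite gt_max fx ?gx.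
    by move=> z [/fz h|/gz h] Kz; rewrite lt_max h ?orbT.
  - move=> x Kx; have [f [Af fx fz]] := step _ Kx.
    have e16 : 0 < e / 16 by lra.
    have [g Ag hg] := Af _ e16; have [V nV h] := near_le g x _ Ag Kx e16.
    exists V => //; exists f; split => // z Vz Kz.
    have := h z Vz Kz; have := hg z Kz; have := hg x Kx; rewrite fx !ltr_norml.
    move=> /andP[a1 a2] /andP[a3 a4] /andP[a5 a6]; lra.
have [g Ag hg] := Af _ e4; exists g => // z Kz.
have := hg z Kz; have := f1 z Kz; have := f2 z Kz Kz; rewrite !ltr_norml.
move=> a1 a2 /andP[a3 a4]; apply/andP; split; lra.
Qed.

End StoneWeierstrass.

(** * Homogeneous harmonic polynomials and their restrictions to spheres *)

Section Polynomials.
Variables (R : realType) (n : nat).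
Local Notation coord := (real_coord n).
Implicit Types (a b : coord) (z w : 'CV[R]_n).

(** Syntax trees, so that differentiation is a recursive function; identities are stated between
    evaluations. *)
Inductive pol := PC of R | PX of coord | PA of pol & pol | PM of pol & pol.

Fixpoint ev (p : pol) z : R :=
  match p with
  | PC c => c
  | PX a => rc a z
  | PA p q => ev p z + ev q z
  | PM p q => ev p z * ev q z
  end.

Fixpoint pD a (p : pol) : pol :=
  match p with
  | PC _ => PC 0
  | PX b => PC (b == a)%:R
  | PA p q => PA (pD a p) (pD a q)
  | PM p q => PA (PM (pD a p) q) (PM p (pD a q))
  end.

Definition psum (s : seq coord) (F : coord -> pol) : pol :=
  foldr (fun a p => PA (F a) p) (PC 0) s.

Lemma ev_psum s F z : ev (psum s F) z = \sum_(a <- s) ev (F a) z.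
Proof. by elim: s => [|a s IH]; rewrite ?big_nil // big_cons /= IH. Qed.

Lemma pD_psum a s F z : ev (pD a (psum s F)) z = \sum_(b <- s) ev (pD a (F b)) z.
Proof. by elim: s => [|b s IH]; rewrite ?big_nil // big_cons /= IH. Qed.

Lemma ev_continuous p : continuous (ev p).
Proof.
elim: p => [c|a|p cp q cq|p cp q cq] /=.
- exact: cts_cst.
- exact: rc_continuous.
- exact: cts_add.
- exact: cts_mul.
Qed.

Lemma ev_derive p (y v : 'CV[R]_n) (t : R) :
  is_derive t (1 : R) (fun s : R => ev p (y + s%:C *: v)) (\sum_a rc a v * ev (pD a p) (y + t%:C *: v)).
Proof.
elim: p => [c|b|p dp q dq|p dp q dq] /=.
- rewrite big1 => [|a _]; last by rewrite mulr0.
  exact: is_derive_cst.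
- rewrite (bigD1 b) //= eqxx mulr1 big1 ?addr0 => [|a ab]; last first.
    by rewrite eq_sym (negbTE ab) mulr0.
  rewrite (_ : (fun s => _) = (fun s : R => rc b y + s * rc b v)); last first.
    by apply/funext => s; rewrite rcD rcZ.
  apply: is_derive_eq; rewrite /GRing.scale /=; lra.
- under eq_bigr do rewrite mulrDr.
  rewrite big_split /=; exact: is_deriveD.
- under eq_bigr do rewrite mulrDr.
  rewrite big_split /=.
  apply: is_derive_eq; rewrite [LHS]addrC /GRing.scale /=; congr (_ + _).
    by rewrite mulr_sumr; apply: eq_bigr => a _; ring.
  by rewrite mulr_sumr; apply: eq_bigr => a _; ring.
Qed.

Lemma ev_derive_coord p a z (t : R) :
  is_derive t (1 : R) (fun s : R => ev p (z + s%:C *: coord_dir R a)) (ev (pD a p) (z + t%:C *: coord_dir R a)).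
Proof.
have := ev_derive p z (coord_dir R a) t; rewrite (bigD1 a) //= rc_coord_dir eqxx mul1r big1 ?addr0 //.
by move=> b ba; rewrite rc_coord_dir (negbTE ba) mul0r.
Qed.

Lemma pderiv_ev a p : pderiv a (ev p) = ev (pD a p).
Proof.
apply/funext => z; rewrite /pderiv derive1E.
have := ev_derive_coord p a z 0; rewrite scale0r addr0 => d.
by rewrite /coord_line derive_val.
Qed.

Lemma C1_ev p : C1_on setT (ev p).
Proof.
move=> a; split=> [z _|].
  by have d := ev_derive_coord p a z 0; rewrite /coord_line; exact: ex_derive.
by rewrite pderiv_ev; apply/continuous_subspaceT/ev_continuous.
Qed.

Lemma C2_ev p : C2_on setT (ev p).
Proof.
split=> [||a]; last by rewrite pderiv_ev; exact: C1_ev.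
  by apply/continuous_subspaceT/ev_continuous.
exact: C1_ev.
Qed.

(** Formal derivatives depend only on the polynomial function, since they evaluate to true
    derivatives. *)
Lemma pD_ext p q : ev p = ev q -> forall a, ev (pD a p) = ev (pD a q).
Proof. by move=> pq a; rewrite -!pderiv_ev pq. Qed.

Lemma pDC a b p : ev (pD a (pD b p)) = ev (pD b (pD a p)).
Proof.
apply/funext => z; elim: p => [c|c|p IHp q IHq|p IHp q IHq] //=; first by rewrite IHp IHq.
by rewrite IHp IHq; ring.
Qed.

Definition lap p := psum (index_enum _) (fun a => pD a (pD a p)).

Lemma laplacian_ev p : laplacian (ev p) = ev (lap p).
Proof.
apply/funext => z; rewrite ev_psum /laplacian.
under eq_bigr do rewrite !pderiv_ev.
rewrite [RHS](eq_bigr (fun a => ev (pD (a.1, a.2) (pD (a.1, a.2) p)) z)); last by case.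
rewrite -(pair_big xpredT xpredT (fun k c => ev (pD (k, c) (pD (k, c) p)) z)) /=.
by apply: eq_bigr => k _; rewrite big_bool /= addrC.
Qed.

Lemma tay_ev p z : exists2 A, tay (ev p) z A & complex.Re (\tr A) = ev (lap p) z / 4.
Proof.
have [|A tA trA] := tay_C2 openT (C2_ev p) (_ : setT z); first by [].
by exists A => //; rewrite trA laplacian_ev.
Qed.

Definition harm p := forall z, ev (lap p) z = 0.

Lemma harm_pD a p : harm p -> harm (pD a p).
Proof.
move=> hp z; have : ev (lap p) = ev (PC 0) by apply/funext => y; exact: hp.
move=> /pD_ext/(_ a)/(congr1 (@^~ z)) /= <-; rewrite ev_psum pD_psum.
by apply: eq_bigr => b _; rewrite (pDC a b) (pD_ext (pDC b a p)).
Qed.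

(** [hom0] makes the zero function homogeneous of every degree, as is needed for derivatives: that
    of a constant has degree [0.-1], which is 0. *)
Inductive hom : nat -> pol -> Prop :=
| hom0 m p : (forall z, ev p z = 0) -> hom m p
| homC c : hom 0 (PC c)
| homX a : hom 1 (PX a)
| homA m p q : hom m p -> hom m q -> hom m (PA p q)
| homM m1 m2 p q : hom m1 p -> hom m2 q -> hom (m1 + m2) (PM p q).

Lemma pD_zero p : (forall z, ev p z = 0) -> forall a z, ev (pD a p) z = 0.
Proof.
move=> p0 a z; have pE : ev p = ev (PC 0) by apply/funext => y; exact: p0.
by rewrite (pD_ext pE).
Qed.

Lemma hom_pD0 p : hom 0 p -> forall a z, ev (pD a p) z = 0.
Proof.
suff H m : hom m p -> m = 0%N -> forall a z, ev (pD a p) z = 0 by move=> /H; exact.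
elim=> //=.
- by move=> {}m {}p p0 _; exact: pD_zero.
- by move=> {}m {}p q _ IHp _ IHq m0 a z; rewrite IHp // IHq // addr0.
- move=> m1 m2 {}p q _ IHp _ IHq /eqP; rewrite addn_eq0 => /andP[/eqP m10 /eqP m20] a z.
  by rewrite IHp // IHq // mul0r mulr0 addr0.
Qed.

Lemma hom_psum m s F : (forall a, hom m (F a)) -> hom m (psum s F).
Proof. by move=> H; elim: s => [|a s IH] /=; [exact: hom0|exact: homA]. Qed.

Lemma hom_pD m p : hom m p -> forall a, hom m.-1 (pD a p).
Proof.
elim=> [{}m {}p p0|c|b|{}m {}p q _ IHp _ IHq|m1 m2 {}p q hp IHp hq IHq] a /=.
- by apply: hom0; exact: pD_zero.
- exact: hom0.
- exact: homC.
- exact: homA.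
- apply: homA.
    have [m10|m10] := posnP m1.
      by rewrite m10 in hp; apply: hom0 => z /=; rewrite hom_pD0 // mul0r.
    rewrite (_ : (m1 + m2).-1 = (m1.-1 + m2)%N); last by rewrite -(prednK m10) addSn.
    exact: homM.
  have [m20|m20] := posnP m2.
    by rewrite m20 in hq; apply: hom0 => z /=; rewrite hom_pD0 // mulr0.
  rewrite (_ : (m1 + m2).-1 = (m1 + m2.-1)%N); last by rewrite -(prednK m20) addnS.
  exact: homM.
Qed.

Lemma hom_euler m p z : hom m p -> \sum_a rc a z * ev (pD a p) z = m%:R * ev p z.
Proof.
elim=> [{}m {}p p0|c|b|{}m {}p q _ IHp _ IHq|m1 m2 {}p q _ IHp _ IHq] /=.
- by rewrite p0 mulr0 big1 // => a _; rewrite pD_zero // mulr0.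
- by rewrite mul0r big1 // => a _; rewrite mulr0.
- rewrite mul1r (bigD1 b) //= eqxx mulr1 big1 ?addr0 // => a ab.
  by rewrite eq_sym (negbTE ab) mulr0.
- by under eq_bigr do rewrite mulrDr; rewrite big_split /= IHp IHq mulrDr.
- under eq_bigr do rewrite mulrDr mulrA [rc _ _ * (_ * _)]mulrCA.
  by rewrite big_split /= -mulr_suml IHp -mulr_sumr IHq natrD; ring.
Qed.

Lemma lapM p q z : ev (lap (PM p q)) z =
  ev (lap p) z * ev q z + 2 * (\sum_a ev (pD a p) z * ev (pD a q) z) + ev p z * ev (lap q) z.
Proof.
rewrite !ev_psum mulr_suml !mulr_sumr -!big_split; apply: eq_bigr => a _ /=; ring.
Qed.

Lemma lapA p q z : ev (lap (PA p q)) z = ev (lap p) z + ev (lap q) z.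
Proof. by rewrite !ev_psum -big_split. Qed.

Lemma lapC c z : ev (lap (PC c)) z = 0.
Proof. by rewrite ev_psum big1. Qed.

Lemma lapX a z : ev (lap (PX a)) z = 0.
Proof. by rewrite ev_psum big1. Qed.

Definition psq := psum (index_enum _) (fun a => PM (PX a) (PX a)).

Lemma ev_psq z : ev psq z = N2 z.
Proof. by rewrite ev_psum; apply: eq_bigr => a _; rewrite expr2. Qed.

Lemma ev_pD_psq a z : ev (pD a psq) z = 2 * rc a z.
Proof.
rewrite pD_psum (bigD1 a) //= eqxx (_ : true%:R = 1 :> R) // big1 ?addr0 => [|b ba]; first ring.
by rewrite (negbTE ba) mul0r mulr0 addr0.
Qed.

Definition real_dim : R := #|{: coord}|%:R.

Lemma lap_psq z : ev (lap psq) z = 2 * real_dim.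
Proof.
rewrite ev_psum; have pE a : ev (pD a psq) = ev (PM (PC 2) (PX a)).
  by apply/funext => y; rewrite ev_pD_psq.
under eq_bigr => a _ do rewrite (pD_ext (pE a)) /= eqxx mul0r add0r mulr1.
by rewrite sumr_const mulr_natr.
Qed.

(* On the sphere |z|^2 = r, multiplication by a coordinate preserves the span of
   homogeneous harmonic polynomials: for p of degree m,
   x_a p - |x|^2 (d_a p) / (d + 2 (m - 1)) is harmonic. *)
Lemma harm_mulX m p a : (0 < n)%N -> hom m p -> harm p ->
  exists c q, [/\ hom m.+1 q, harm q &
    forall z, rc a z * ev p z = ev q z + c * N2 z * ev (pD a p) z].
Proof.
move=> n0 hp lp.
have lapXp z : ev (lap (PM (PX a) p)) z = 2 * ev (pD a p) z.
  rewrite lapM lapX lp mul0r mulr0 add0r addr0 (bigD1 a) //= eqxx mul1r big1 ?addr0 // => b ba.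
  by rewrite eq_sym (negbTE ba) mul0r.
have [m0|m0] := posnP m.
  exists 0, (PM (PX a) p); split.
  - by rewrite -add1n; apply: homM => //; exact: homX.
  - by move=> z; rewrite lapXp; rewrite m0 in hp; rewrite hom_pD0 // mulr0.
  - by move=> z /=; rewrite !mul0r addr0.
have d0 : 0 < real_dim by rewrite ltr0n card_prod card_ord card_bool muln_gt0 n0.
have m1 : 0 <= m.-1%:R :> R by rewrite ler0n.
pose c : R := (real_dim + 2 * m.-1%:R)^-1.
have cE : c * (real_dim + 2 * m.-1%:R) = 1 by rewrite mulVf // gt_eqF //; lra.
pose q := PA (PM (PX a) p) (PM (PC (- c)) (PM psq (pD a p))).
exists c, q; split.
- rewrite -add1n; apply: homA; first by apply: homM => //; exact: homX.
  rewrite -[(1 + m)%N]add0n; apply: homM; first exact: homC.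
  rewrite (_ : (1 + m)%N = (2 + m.-1)%N); last by rewrite add1n -{1}(prednK m0).
  apply: homM; last exact: hom_pD.
  by apply: hom_psum => b; rewrite -[2%N]/(1 + 1)%N; apply: homM; exact: homX.
- move=> z; rewrite lapA lapXp lapM lapC mul0r add0r big1 ?mulr0 ?add0r => [|b _]; last by rewrite mul0r.
  rewrite lapM lap_psq harm_pD // mulr0 addr0.
  rewrite (eq_bigr (fun b => 2 * (rc b z * ev (pD b (pD a p)) z))) => [|b _]; last by rewrite ev_pD_psq mulrA.
  rewrite -mulr_sumr (hom_euler _ (hom_pD hp a)) /=.
  have -> : - c * (2 * real_dim * ev (pD a p) z + 2 * (2 * (m.-1%:R * ev (pD a p) z))) =
    - (c * (real_dim + 2 * m.-1%:R)) * (2 * ev (pD a p) z) by ring.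
  by rewrite cE; ring.
- by move=> z /=; rewrite ev_psq; ring.
Qed.

Variables (n0 : (0 < n)%N) (r : R).

(** Homogeneity of the summands is recorded because both the multiplication by a coordinate and the
    mean over the circle depend on the degree. *)
Inductive hspan : ('CV[R]_n -> R) -> Prop :=
| hspan_hom m p : hom m p -> harm p -> hspan (ev p)
| hspan_add f g : hspan f -> hspan g -> hspan (fun z => f z + g z).

Lemma hspan_harm f : hspan f -> exists2 p, harm p & ev p = f.
Proof.
elim=> [m p _ hp|{}f g _ [p hp pf] _ [q hq qg]]; first by exists p.
by exists (PA p q) => [z|]; [rewrite lapA hp hq addr0|rewrite -pf -qg].
Qed.

Lemma hspan_scale c f : hspan f -> hspan (fun z => c * f z).
Proof.
elim=> [m p hp lp|{}f g _ Hf _ Hg].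
  apply: (@hspan_hom m (PM (PC c) p)); first by rewrite -[m]add0n; apply: homM => //; exact: homC.
  by move=> z; rewrite lapM lapC lp mul0r mulr0 addr0 add0r big1 ?mulr0 // => a _; rewrite mul0r.
by under eq_fun do rewrite mulrDr; exact: hspan_add.
Qed.

Lemma hspan_mulX a f : hspan f -> exists2 g, hspan g & forall z, N2 z = r -> rc a z * f z = g z.
Proof.
elim=> [m p hp lp|{}f g _ [f1 Hf ff] _ [g1 Hg gg]].
  have [c [q [hq lq E]]] := harm_mulX a n0 hp lp.
  exists (fun z => ev q z + c * r * ev (pD a p) z).
    apply: hspan_add; first exact: hspan_hom hq lq.
    apply: hspan_scale; apply: hspan_hom (hom_pD hp a) _; exact: harm_pD.
  by move=> z zr; rewrite E zr.
exists (fun z => f1 z + g1 z); first exact: hspan_add.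
by move=> z zr; rewrite mulrDr ff // gg.
Qed.

Lemma hspan_mul p f : hspan f -> exists2 g, hspan g & forall z, N2 z = r -> ev p z * f z = g z.
Proof.
elim: p f => [c|a|p IHp q IHq|p IHp q IHq] f hf /=.
- by exists (fun z => c * f z) => //; exact: hspan_scale.
- exact: hspan_mulX.
- have [g1 h1 E1] := IHp _ hf; have [g2 h2 E2] := IHq _ hf.
  exists (fun z => g1 z + g2 z); first exact: hspan_add.
  by move=> z zr; rewrite mulrDl E1 // E2.
- have [g2 h2 E2] := IHq _ hf; have [g1 h1 E1] := IHp _ h2.
  by exists g1 => // z zr; rewrite -mulrA E2 // E1.
Qed.

(** Start from the constant 1 and multiply step by step. So the algebra of all polynomials, to which
    Stone-Weierstrass applies, has the same restrictions to the sphere as harmonic polynomials. *)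
Lemma hspan_on_sphere p : exists2 f, hspan f & forall z, N2 z = r -> f z = ev p z.
Proof.
have h1 : hspan (ev (PC 1)) by apply: (@hspan_hom 0); [exact: homC|exact: lapC].
have [f hf E] := hspan_mul p h1.
by exists f => // z zr; rewrite -E //= mulr1.
Qed.

Lemma hspan_approximation (u : 'CV[R]_n -> R) (e : R) :
    (forall z, N2 z = r -> cts_at [set z | N2 z = r] u z) -> 0 < e ->
  exists2 f, hspan f & forall z, N2 z = r -> `|u z - f z| < e.
Proof.
move=> cu e0.
have cS : compact [set z : 'CV[R]_n | N2 z = r].
  apply: (@compactN2 _ _ _ r) => [|z /= ->] //.
  have -> : [set z : 'CV[R]_n | N2 z = r] = (@N2 R n) @^-1` [set x | x = r] by [].
  by apply: preimage_closed => [z _|]; [exact: N2_continuous|exact: closed_eq].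
have [||||x y xy|_ [p _ <-] H] := @stone_weierstrass _ _ _ (fun f => exists2 p, True & ev p = f) cS _ _ _ _ _ u e cu e0.
- by move=> c; exists (PC c).
- by move=> _ _ [p _ <-] [q _ <-]; exists (PA p q).
- by move=> _ _ [p _ <-] [q _ <-]; exists (PM p q).
- by move=> _ [p _ <-]; exact: ev_continuous.
- have [a] : exists a, rc a x != rc a y.
    apply: contrapT => H; move/eqP: xy; apply; apply: rc_inj => a.
    by apply/eqP; apply: contrapT => /negP ha; apply: H; exists a.
  by exists (rc a) => //; exists (PX a).
have [f hf fE] := hspan_on_sphere p.
by exists f => // z zr; rewrite fE //; exact: H.
Qed.

Lemma harmonic_approximation (u : 'CV[R]_n -> R) (e : R) :
    (forall z, N2 z = r -> cts_at [set z | N2 z = r] u z) -> 0 < e ->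
  exists2 h, harm h & forall z, N2 z = r -> `|u z - ev h z| < e.
Proof.
by move=> cu /(hspan_approximation cu)[f /hspan_harm[h hh <-] E]; exists h.
Qed.

End Polynomials.

(** * Linear viscosity inequalities *)

Section ViscosityLaplacian.
Variables (R : realType) (n : nat).
Hypothesis n0 : (0 < n)%N.
Implicit Types (A B C : 'M[R[i]]_n) (z w : 'CV[R]_n) (q u v phi : 'CV[R]_n -> R) (U : set 'CV[R]_n).

Lemma mxtrace_scalarD A (e : R) : complex.Re (\tr (A + (e%:C)%:M)) = complex.Re (\tr A) + n%:R * e.
Proof. by rewrite raddfD /= ReD mxtrace_scalar -rmorphMn mulr_natl. Qed.

Lemma Re_mxtraceD A B : complex.Re (\tr (A + B)) = complex.Re (\tr A) + complex.Re (\tr B).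
Proof. by rewrite raddfD ReD. Qed.

Lemma Re_mxtraceB A B : complex.Re (\tr (A - B)) = complex.Re (\tr A) - complex.Re (\tr B).
Proof.
have ReN (x : R[i]) : complex.Re (- x) = - complex.Re x by case: x.
by rewrite raddfB /= ReD ReN.
Qed.

Lemma psd_trace_ge0 A : psd A -> 0 <= complex.Re (\tr A).
Proof. by move=> pA; rewrite mxtrace_hermitian_form; apply: sumr_ge0 => k _; exact: pA. Qed.

Definition trace_ge (c : R) : 'CV[R]_n -> R -> 'M[R[i]]_n -> Prop := fun _ _ A => c <= complex.Re (\tr A).

Lemma le_mulr_eps (a b K : R) : 0 <= K -> (forall e : R, 0 < e -> a <= b + K * e) -> a <= b.
Proof.
move=> K0 H; apply/ler_addgt0Pr => e e0.
have K1 : 0 < K + 1 by rewrite ltr_wpDl.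
apply: le_trans (H _ (divr_gt0 e0 K1)) _; rewrite lerD2l mulrCA ger_pMr //.
by rewrite ler_pdivrMr // mul1r lerDl.
Qed.

(** At an interior maximum of u - phi, the function phi could be tested, giving a trace at least c;
    so the maximum lies on the sphere. *)
Lemma vsub_trace_le c w (r : R) u phi : 0 <= r ->
    (forall z, N2 (z - w) <= r -> cts_at [set z | N2 (z - w) <= r] u z) ->
    (forall z, N2 (z - w) <= r -> cts_at [set z | N2 (z - w) <= r] phi z) ->
    vsub (trace_ge c) [set z | N2 (z - w) < r] u ->
    (forall z, N2 (z - w) < r -> exists2 A, tay phi z A & complex.Re (\tr A) < c) ->
    (forall z, N2 (z - w) = r -> u z <= phi z) ->
  forall z, N2 (z - w) <= r -> u z <= phi z.
Proof.
move=> r0 cu cp vu hp bd.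
have [z zr|z1 z1r zmax] := @ball_max _ _ w r (fun z => u z - phi z) r0.
  by apply: cts_atB; [exact: cu|exact: cp].
suff : u z1 - phi z1 <= 0 by move=> h z zr; have := zmax z zr; lra.
have [zr|zr] : N2 (z1 - w) = r \/ N2 (z1 - w) < r.
  by move: z1r; rewrite le_eqVlt => /orP[/eqP|]; [left|right].
  by rewrite subr_le0; exact: bd.
exfalso; have [A tA] := hp _ zr; apply/negP; rewrite -leNgt.
apply: (@le_mulr_eps _ _ n%:R); first by rewrite ler0n.
move=> e e0; rewrite -mxtrace_scalarD.
apply: (vsub_tay vu zr tA e0).
have /openN2P/(_ z1 zr)[s s0 hs] := @open_ballN2 R n w r.
by apply/nbhsN2P; exists s => // x /hs /= /ltW; exact: zmax.
Qed.

Lemma cts_at_translate U u t z : cts_at U u (z + t) -> cts_at [set y | U (y + t)] (fun y => u (y + t)) z.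
Proof.
move=> cu e /cu[r r0 h]; exists r => // y Uy yr; apply: h => //.
by rewrite opprD addrACA subrr addr0.
Qed.

Lemma cts_at_quad A q U z : quad A q -> cts_at U q z.
Proof. by move=> qA; apply/continuous_cts_at/(quad_continuous qA). Qed.

Lemma cts_at_ev (p : pol R n) w U z : cts_at U (fun y => ev p (y - w)) z.
Proof.
apply: (@cts_at_sub _ _ [set y | setT (y + - w)]) => //.
by apply: (@cts_at_translate setT (ev p)); apply/continuous_cts_at/ev_continuous.
Qed.

(** A quadratic touching u1 + u2 touches neither summand, so the two inequalities cannot be used at
    z0 directly. Comparison with harmonic polynomials plus multiples of |z - z0|^2 replaces both
    summands by smooth functions, whose traces do add. *)
Lemma vsub_trace_add c1 c2 U u1 u2 : open U ->
    (forall z, U z -> cts_at U u1 z) -> (forall z, U z -> cts_at U u2 z) ->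
    vsub (trace_ge c1) U u1 -> vsub (trace_ge c2) U u2 ->
  vsub (trace_ge (c1 + c2)) U (fun z => u1 z + u2 z).
Proof.
move=> oU cu1 cu2 v1 v2 z0 A q Uz0 qA [q0 /nbhsN2P[r1 r10 hq]].
rewrite /trace_ge leNgt; apply/negP => trA.
have nR : 0 < n%:R :> R by rewrite ltr0n.
have [e [e0 eA]] : exists e : R, 0 < e /\ complex.Re (\tr A) + n%:R * e < c1 + c2.
  exists ((c1 + c2 - complex.Re (\tr A)) / (2 * n%:R)).
  split; first by rewrite divr_gt0 ?mulr_gt0 // subr_gt0.
  rewrite (_ : n%:R * _ = (c1 + c2 - complex.Re (\tr A)) / 2); first lra.
  by field; rewrite gt_eqF.
have [r2 r20 hU] := (openN2P _).1 oU z0 Uz0.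
pose r := Num.min r1 r2 / 2.
have [rpos rr1 rr2] : [/\ 0 < r, r < r1 & r < r2].
  have m0 : 0 < Num.min r1 r2 by rewrite lt_min r10.
  have m1 : Num.min r1 r2 <= r1 by rewrite ge_min lexx.
  have m2 : Num.min r1 r2 <= r2 by rewrite ge_min lexx orbT.
  by rewrite /r; move: (Num.min r1 r2) m0 m1 m2 => m m0 m1 m2; split; lra.
pose Bc := [set z | N2 (z - z0) <= r].
have BU : Bc `<=` U by move=> z zr; apply: hU; exact: le_lt_trans zr rr2.
(* The replacement costs at most 2 d on the sphere and 4 d at the centre, while e |z - z0|^2 lowers
   the sphere by e r = 8 d. *)
pose d := e * r / 8.
have d0 : 0 < d by rewrite /d; have := mulr_gt0 e0 rpos; lra.
have dE : e * r = 8 * d by rewrite /d; lra.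
have apx c u : (forall z, U z -> cts_at U u z) -> vsub (trace_ge c) U u ->
    exists h, [/\ harm h, forall z, N2 (z - z0) = r ->
       `|u z - (c / n%:R * N2 (z - z0)) - ev h (z - z0)| < d
     & u z0 <= ev h 0 + 2 * d].
  (* k |z - z0|^2 has trace c, so the difference to be approximated is subharmonic. *)
  move=> cu vu; pose k : R := c / n%:R.
  have kn : n%:R * k = c by rewrite /k mulrC divfK // gt_eqF.
  have qk : quad (k%:C)%:M (fun z => k * N2 (z - z0)) by exact: quad_N2_shift.
  have [y yr|h hh H] := @harmonic_approximation R n n0 r (fun y => u (y + z0) - k * N2 (y + z0 - z0)) d _ d0.
    have Uy : U (y + z0) by apply: BU; rewrite /Bc /= addrK yr.
    have : cts_at [set y | U (y + z0)] (fun y => u (y + z0) - k * N2 (y + z0 - z0)) y.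
      apply: (@cts_at_translate U (fun z => u z - k * N2 (z - z0))).
      by apply: cts_atB; [exact: cu|exact: cts_at_quad qk].
    by apply: cts_at_sub => x /= xr; apply: BU; rewrite /Bc /= addrK xr.
  exists h; split => // [z zr|]; first by have := H (z - z0) zr; rewrite subrK.
  (* - kap |z - z0|^2 makes the comparison function strict; on the sphere it costs d, whence the
     constant 2 d. *)
  pose kap := d / r.
  have kap0 : 0 < kap by rewrite divr_gt0.
  have kapr : kap * r = d by rewrite /kap divfK // gt_eqF.
  pose phi z := ev h (z - z0) + (k * N2 (z - z0) + ((- kap) * N2 (z - z0) + 2 * d)).
  have qq := quadD qk (quadD (quad_N2_shift (- kap) z0) (quad_cst n (2 * d))).
  have := @vsub_trace_le c z0 r u phi (ltW rpos) _ _ _ _ _ z0.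
  rewrite subrr N2_0 /phi subrr N2_0 !mulr0 !add0r; apply => //; last exact: ltW.
  - by move=> z zr; apply: (@cts_at_sub _ _ U) => //; apply: cu; exact: BU.
  - move=> z zr; apply: cts_atD; last exact: cts_at_quad qq.
    exact: cts_at_ev.
  - by move=> z B p /= zr; apply: vu; apply: BU; rewrite /Bc /= ltW.
  - move=> z zr; have [B tB trB] := tay_ev h (z - z0).
    exists (B + ((k%:C)%:M + (((- kap)%:C)%:M + 0))).
      apply: tayD (quad_tay z qq); exact: (tay_translate tB).
    rewrite addr0 addrA !mxtrace_scalarD trB hh mul0r add0r kn.
    by rewrite mulrN -ltrBrDr opprK ltrDl mulr_gt0.
  - move=> z zr; have := H (z - z0) zr; rewrite subrK zr ltr_norml => /andP[_ h1].
    rewrite mulNr kapr; lra.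
have [h1 [hh1 H1 hz1]] := apx _ _ cu1 v1; have [h2 [hh2 H2 hz2]] := apx _ _ cu2 v2.
pose k : R := c1 / n%:R + c2 / n%:R.
have kn : n%:R * k = c1 + c2 by rewrite /k -mulrDl mulrC divfK // gt_eqF.
pose psi z := ev h1 (z - z0) + ev h2 (z - z0) + k * N2 (z - z0).
pose q' z := q z + e * N2 (z - z0).
have qq' := quadD qA (quad_N2_shift e z0).
have cpsi z (V : set 'CV[R]_n) : cts_at V psi z.
  apply: cts_atD; last exact: cts_at_quad (quad_N2_shift _ _).
  by apply: cts_atD; exact: cts_at_ev.
have [z zr|z1 z1r zmax] := @ball_max _ _ z0 r (fun z => psi z - q' z) (ltW rpos).
  by apply: cts_atB => //; exact: cts_at_quad qq'.
(* An interior maximum would compare the traces: c1 + c2 <= tr A + n e, against the choice of e. *)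
have z1r' : N2 (z1 - z0) = r.
  apply/eqP; rewrite eq_le z1r leNgt; apply/negP => zr.
  have [B1 tB1 trB1] := tay_ev h1 (z1 - z0); have [B2 tB2 trB2] := tay_ev h2 (z1 - z0).
  have tpsi := tayD (tayD (tay_translate tB1) (tay_translate tB2)) (quad_tay z1 (quad_N2_shift k z0)).
  have nz : \forall z \near z1, psi z - q' z <= psi z1 - q' z1.
    have /openN2P/(_ z1 zr)[s s0 hs] := @open_ballN2 R n z0 r.
    by apply/nbhsN2P; exists s => // x /hs /= /ltW; exact: zmax.
  have /psd_trace_ge0 := tay_below_quad tpsi qq' nz.
  rewrite Re_mxtraceB !mxtrace_scalarD Re_mxtraceD trB1 trB2 hh1 hh2 kn mul0r; lra.
have uq z : N2 (z - z0) <= r -> u1 z + u2 z <= q z by move=> zr; apply: hq; lra.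
have := zmax z0; rewrite /psi /q' subrr N2_0 !mulr0 !addr0 z1r' => /(_ (ltW rpos)).
have := uq z1 z1r; have := H1 z1 z1r'; have := H2 z1 z1r'; rewrite z1r' !ltr_norml.
move=> /andP[a1 a2] /andP[a3 a4]; rewrite q0 in hz1 hz2 *.
rewrite /k mulrDl; lra.
Qed.

(** The left side is a quadratic in w, bounded near 0 by continuity; homogeneity makes the bound
    global. *)
Lemma N2_mulmx m (C : 'M[R[i]]_(m, n)) : exists2 K : R, 0 < K & forall w : 'CV[R]_m, N2 (w *m C) <= K * N2 w.
Proof.
have qC := quad_comp_linear C (quad_N2 R n).
have [r r0 h] := continuous_cts_at setT (0 : 'CV[R]_m) (quad_continuous qC) (@ltr01 R).
exists (2 / r) => [|w]; first by rewrite divr_gt0.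
have [->|w0] := eqVneq w 0; first by rewrite mul0mx !N2_0 mulr0.
have Nw := N2_gt0 w0; pose t := Num.sqrt (r / (2 * N2 w)).
have t2 : t ^+ 2 = r / (2 * N2 w) by rewrite sqr_sqrtr // divr_ge0 ?mulr_ge0 // ltW.
have t20 : 0 < t ^+ 2 by rewrite t2 divr_gt0 ?mulr_gt0.
have tw : N2 (t%:C *: w - 0) < r.
  rewrite subr0 N2Z t2 (_ : _ * N2 w = r / 2); first lra.
  by field; rewrite gt_eqF.
have := h _ I tw; rewrite mul0mx N2_0 subr0 ger0_norm ?N2_ge0 // -scalemxAl N2Z => hw.
rewrite -(ler_pM2l t20); apply: le_trans (ltW hw) _.
rewrite (_ : _ * (_ * _) = 1) // t2; field; rewrite !gt_eqF //.
Qed.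

Lemma congmx_comp C B A : congmx C (congmx B A) = congmx (C *m B) A.
Proof. by rewrite /congmx map_mxM trmx_mul !mulmxA. Qed.

Lemma congmx1 A : congmx 1%:M A = A.
Proof.
rewrite /congmx trmx1 mulmx1 (_ : map_mx conjc 1%:M = 1%:M) ?mul1mx //.
by apply/matrixP => i j; rewrite !mxE; case: (i == j); rewrite /= ?oppr0 ?rmorph0.
Qed.

(* The viscosity inequality c <= sum_k dd^c u (C e_k, C e_k), the Laplacian of u in
   the coordinates w, z = w C. *)
Definition lap_ge C (c : R) : 'CV[R]_n -> R -> 'M[R[i]]_n -> Prop :=
  fun _ _ A => c <= complex.Re (\tr (congmx C A)).

Lemma near_mulmx C w0 (P : 'CV[R]_n -> Prop) :
  (\forall z \near (w0 *m C), P z) -> \forall w \near w0, P (w *m C).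
Proof.
move=> /nbhsN2P[r r0 h]; have [K K0 hK] := N2_mulmx C.
apply/nbhsN2P; exists (r / K) => [|w wr]; first by rewrite divr_gt0.
by apply: h; rewrite -mulmxBl (le_lt_trans (hK _)) // mulrC -ltr_pdivlMr.
Qed.

Lemma cts_at_mulmx C U u w : cts_at U u (w *m C) -> cts_at [set w | U (w *m C)] (fun w => u (w *m C)) w.
Proof.
move=> cu e /cu[r r0 h]; have [K K0 hK] := N2_mulmx C.
exists (r / K) => [|y Uy yr]; first by rewrite divr_gt0.
by apply: h => //; rewrite -mulmxBl (le_lt_trans (hK _)) // mulrC -ltr_pdivlMr.
Qed.

Lemma vsub_lap_trace C c U u : C \in unitmx -> vsub (lap_ge C c) U u ->
  vsub (trace_ge c) [set w | U (w *m C)] (fun w => u (w *m C)).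
Proof.
move=> uC vu w0 A q Uw qA [q0 hq].
have := vu (w0 *m C) _ _ Uw (quad_comp_linear (invmx C) qA).
rewrite /lap_ge congmx_comp mulmxV // congmx1 => H; apply: H; split; first by rewrite mulmxK.
have := @near_mulmx (invmx C) (w0 *m C) (fun w => u (w *m C) <= q w).
rewrite mulmxK // => /(_ hq); apply: filterS => z; rewrite mulmxKV //.
Qed.

Lemma vsub_trace_lap C c U u : C \in unitmx ->
    vsub (trace_ge c) [set w | U (w *m C)] (fun w => u (w *m C)) -> vsub (lap_ge C c) U u.
Proof.
move=> uC vu z0 A q Uz qA [q0 hq].
have := vu (z0 *m invmx C) (congmx C A) (fun w => q (w *m C)).
rewrite /= mulmxKV // => /(_ Uz (quad_comp_linear C qA)); apply; split; rewrite ?mulmxKV //.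
by apply: (@near_mulmx C _ (fun z => u z <= q z)); rewrite mulmxKV.
Qed.

Lemma vsub_lap_add C c1 c2 U u1 u2 : C \in unitmx -> open U ->
    (forall z, U z -> cts_at U u1 z) -> (forall z, U z -> cts_at U u2 z) ->
    vsub (lap_ge C c1) U u1 -> vsub (lap_ge C c2) U u2 ->
  vsub (lap_ge C (c1 + c2)) U (fun z => u1 z + u2 z).
Proof.
move=> uC /openN2P oU cu1 cu2 /(vsub_lap_trace uC) v1 /(vsub_lap_trace uC) v2.
apply: vsub_trace_lap => //.
apply: (@vsub_trace_add c1 c2 _ (fun w => u1 (w *m C)) (fun w => u2 (w *m C))) => //.
- apply/openN2P => w /= /oU[r r0 h].
  have /nbhsN2P // : \forall w' \near w, U (w' *m C).
  by apply: near_mulmx; apply/nbhsN2P; exists r.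
- by move=> w Uw; apply: cts_at_mulmx; exact: cu1.
- by move=> w Uw; apply: cts_at_mulmx; exact: cu2.
Qed.

Lemma congmxZ C (t : R) A : congmx C (t%:C *: A) = t%:C *: congmx C A.
Proof. by rewrite /congmx -scalemxAr -scalemxAl. Qed.

Lemma vsub_lap_scale C c (t : R) U u : 0 < t -> vsub (lap_ge C c) U u ->
  vsub (lap_ge C (t * c)) U (fun z => t * u z).
Proof.
move=> t0 vu z0 A q Uz qA [q0 hq].
have := vu z0 _ _ Uz (quadZ t^-1 qA).
rewrite /lap_ge congmxZ mxtraceZ ReZ -ler_pdivrMl ?invr_gt0 // invrK; apply; split.
  by rewrite q0 mulKf // gt_eqF.
by apply: filterS hq => z; rewrite ler_pdivlMl.
Qed.

Lemma vsub_translate P U u t : vsub P U u ->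
  vsub (fun z s A => P (z + t) s A) [set z | U (z + t)] (fun z => u (z + t)).
Proof.
move=> vu z0 A q Uz qA [q0 /nbhsN2P[r r0 hq]].
apply: (vu _ _ (fun z => q (z - t)) Uz); first exact: quad_translate.
split; first by rewrite addrK.
apply/nbhsN2P; exists r => // z zr; have := hq (z - t); rewrite subrK; apply.
by rewrite -addrA -opprD [t + _]addrC.
Qed.

Lemma vsub_subset P U V u : V `<=` U -> vsub P U u -> vsub P V u.
Proof. by move=> VU vu z A q Vz; apply: vu; exact: VU. Qed.

Lemma vsub_weaken P P' U u : (forall z s A, U z -> A \is hermsymmx -> P z s A -> P' z s A) ->
  vsub P U u -> vsub P' U u.
Proof. by move=> PP vu z A q Uz qA hq; apply: PP => //; [exact: quad_herm qA|exact: vu qA hq]. Qed.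

Lemma vsub_lap_zero C U : vsub (lap_ge C 0) U (fun=> 0).
Proof.
move=> z0 A q _ qA [q0 /nbhsN2P[r r0 hq]]; apply: trace_congmx_ge0.
apply: (quad_nonneg (z0 := z0) qA); first by rewrite q0.
move=> e e0; exists r => // z zr; rewrite q0 sub0r; apply: le_trans (hq z zr).
by rewrite oppr_le0 mulr_ge0 ?N2_ge0 // ltW.
Qed.

Lemma vsub_lap_sum C c U (N : nat) (u : nat -> 'CV[R]_n -> R) : C \in unitmx -> open U ->
    (forall j z, U z -> cts_at U (u j) z) -> (forall j, vsub (lap_ge C c) U (u j)) ->
  vsub (lap_ge C (c *+ N)) U (fun z => \sum_(j < N) u j z).
Proof.
move=> uC oU cu vu; elim: N => [|N IH].
  by under eq_fun do rewrite big_ord0; rewrite mulr0n; exact: vsub_lap_zero.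
under eq_fun do rewrite big_ord_recr /=.
rewrite mulrSr; apply: vsub_lap_add => // z Uz; last exact: cu.
elim: {IH}N => [|N IH].
  by under eq_fun do rewrite big_ord0; apply: continuous_cts_at; exact: cts_cst.
by under eq_fun do rewrite big_ord_recr /=; apply: cts_atD => //; exact: cu.
Qed.

End ViscosityLaplacian.

(** * Box averages *)

Section Means.
Variable R : realType.
Implicit Types (phi psi Phi : R -> R).
Local Notation mu := (@lebesgue_measure R).

Lemma derivable_eps phi (L : R) :
    (forall e : R, 0 < e -> exists2 d : R, 0 < d &
       forall s : R, `|s| < d -> `|phi s - phi 0 - s * L| <= e * `|s|) ->
  derivable phi 0 1 /\ derive1 phi 0 = L.
Proof.
move=> H.
have cv : h^-1 *: ((phi \o shift 0) (h *: (1 : R)) - phi 0) @[h --> 0^'] --> L.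
  apply/cvgrPdist_le => e e0; have [d d0 hd] := H e e0.
  near=> h.
  have h0 : h != 0 by near: h; exact: nbhs_dnbhs_neq.
  have hdd : `|h| < d.
    near: h; apply: dnbhs0_lt; exact: d0.
  have := hd h hdd; rewrite /= /GRing.scale /= mulr1 addr0 => hh.
  rewrite -(ler_pM2r (_ : 0 < `|h|)) ?normr_gt0 //; apply: le_trans hh.
  rewrite -normrM mulrBl mulrAC mulVf // mul1r distrC [L * h]mulrC.
  by rewrite le_eqVlt eqxx.
split; first by apply/cvg_ex; exists L.
by rewrite derive1E /derive; exact: cvg_lim cv.
Unshelve. all: by end_near. Qed.

Lemma antiderivative phi (a : R) : continuous phi ->
  exists Phi, forall t, a < t -> is_derive t (1 : R) Phi (phi t).
Proof.
move=> cphi; exists (fun x => \int[mu]_(t in `[a, x]) phi t) => t at_.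
have tu : t < t + 1 by rewrite ltrDl.
have int : mu.-integrable `[a, t + 1] (EFin \o phi).
  apply: continuous_compact_integrable; first exact: segment_compact.
  exact: continuous_subspaceT.
have [d1 d2] := @continuous_FTC1_closed R phi a t (t + 1) tu int at_ (cphi t).
by split; [exact: d1|rewrite -derive1E; exact: d2].
Qed.

Lemma integral_antiderivative phi Phi (a b : R) : a < b -> continuous phi ->
    (forall t, a <= t <= b -> is_derive t (1 : R) Phi (phi t)) ->
  \int[mu]_(t in `[a, b]) phi t = Phi b - Phi a.
Proof.
move=> ab cphi H; rewrite /Rintegral.
have cPhi t : a <= t <= b -> {for t, continuous Phi}.
  move=> /H dt; apply/differentiable_continuous/derivable1_diffP; exact: ex_derive.
rewrite (@continuous_FTC2 R phi Phi a b ab) //.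
- exact: continuous_subspaceT.
- split.
  + move=> t; rewrite in_itv /= => /andP[at_ tb].
    have dt : is_derive t (1 : R) Phi (phi t) by apply: H; rewrite !ltW.
    exact: ex_derive.
  + by apply: cvg_at_right_filter; apply: cPhi; rewrite lexx ltW.
  + by apply: cvg_at_left_filter; apply: cPhi; rewrite lexx ltW.
- move=> t; rewrite in_itv /= => /andP[at_ tb].
  have dt : is_derive t (1 : R) Phi (phi t) by apply: H; rewrite !ltW.
  by rewrite derive1E derive_val.
Qed.

Definition mean (h : R) phi := (2 * h)^-1 * \int[mu]_(t in `[- h, h]) phi t.

Variables (h : R) (h0 : 0 < h).

Lemma mean_antiderivative phi Phi : continuous phi ->
    (forall t, - h <= t <= h -> is_derive t (1 : R) Phi (phi t)) ->
  mean h phi = (2 * h)^-1 * (Phi h - Phi (- h)).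
Proof.
move=> cphi H; rewrite /mean (@integral_antiderivative phi Phi) //.
by rewrite gtrN.
Qed.

(** Reduces every estimate of an average to a pointwise one. *)
Lemma mean_point phi : continuous phi -> exists2 x, `|x| <= h & mean h phi = phi x.
Proof.
(* Starting the antiderivative left of - h makes it differentiable at the end point - h as well. *)
move=> cphi; have [Phi HP] := antiderivative (- h - 1) cphi.
have H t : - h <= t <= h -> is_derive t (1 : R) Phi (phi t) by move=> /andP[a b]; apply: HP; lra.
have hh : - h < h by rewrite gtrN.
have [||c cI E] := @MVT _ Phi phi (- h) h hh.
- by move=> t; rewrite in_itv /= => /andP[a b]; apply: H; rewrite !ltW.
- apply: derivable_within_continuous => t; rewrite in_itv /= => tI.
  have dt := H t tI; exact: ex_derive.
exists c; first by move: cI; rewrite in_itv /= ler_norml => /andP[a b]; rewrite !ltW.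
by rewrite (mean_antiderivative cphi H) E; field; rewrite gt_eqF.
Qed.

Lemma mean_linear phi psi (c : R) : continuous phi -> continuous psi ->
  mean h (fun t => phi t + c * psi t) = mean h phi + c * mean h psi.
Proof.
move=> c1 c2; have [Phi HP] := antiderivative (- h - 1) c1; have [Psi HQ] := antiderivative (- h - 1) c2.
have H1 t : - h <= t <= h -> is_derive t (1 : R) Phi (phi t) by move=> /andP[a b]; apply: HP; lra.
have H2 t : - h <= t <= h -> is_derive t (1 : R) Psi (psi t) by move=> /andP[a b]; apply: HQ; lra.
rewrite (mean_antiderivative c1 H1) (mean_antiderivative c2 H2).
have -> : mean h (fun t => phi t + c * psi t) =
    (2 * h)^-1 * ((Phi h + c * Psi h) - (Phi (- h) + c * Psi (- h))).
  apply: (@mean_antiderivative (fun t => phi t + c * psi t) (fun t => Phi t + c * Psi t)).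
    exact: cts_add c1 (cts_mul (@cts_cst R R c) c2).
  move=> t tI; have d1 := H1 t tI; have d2 := H2 t tI.
  by apply: is_derive_eq; rewrite /GRing.scale /=; ring.
ring.
Qed.

(** Averaging gains a derivative: for phi merely continuous, the derivative of the sliding mean is a
    difference quotient of phi. *)
Lemma mean_shift_derive phi : continuous phi ->
  derivable (fun s => mean h (fun t => phi (t + s))) 0 1 /\
  derive1 (fun s => mean h (fun t => phi (t + s))) 0 = (2 * h)^-1 * (phi h - phi (- h)).
Proof.
(* The base point - h - 2 leaves room for shifts with |s| < 1. *)
move=> cphi; have h0' := h0; have [Phi HP] := antiderivative (- h - 2) cphi.
have E s : `|s| < 1 -> mean h (fun t => phi (t + s)) = (2 * h)^-1 * (Phi (h + s) - Phi (- h + s)).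
  rewrite ltr_norml => /andP[s1 s2].
  apply: (@mean_antiderivative (fun t => phi (t + s)) (fun t => Phi (t + s))).
    move=> t; apply: continuous_comp; last exact: cphi.
    exact: (cts_add (fun x => @cvg_id _ (nbhs x)) (@cts_cst R R s)).
  move=> t /andP[t1 t2]; have dP : is_derive (t + s) (1 : R) Phi (phi (t + s)) by apply: HP; lra.
  have := @is_derive1_comp R Phi (fun t => t + s) t (phi (t + s)) 1 dP _.
  by rewrite mulr1; apply; apply: is_derive_eq; rewrite addr0.
apply: derivable_eps => e e0.
have e2 : 0 < e * h by rewrite mulr_gt0.
have /cvgrPdist_lt/(_ _ e2)/nbhs_ballP[d1 /= d10 hd1] := cphi h.
have /cvgrPdist_lt/(_ _ e2)/nbhs_ballP[d2 /= d20 hd2] := cphi (- h).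
exists (Num.min 1 (Num.min d1 d2)); first by rewrite !lt_min ltr01 d10.
move=> s; rewrite !lt_min => /and3P[s1 sd1 sd2].
rewrite !E ?normr0 //= !addr0.
have key p : (p = h \/ p = - h) -> exists2 c, `|c| <= `|s| & Phi (p + s) - Phi p = s * phi (p + c).
  move=> ph; have [t ht|c cs Ec] := @mean_value R (fun t => Phi (p + t)) (fun t => phi (p + t)) s.
    have dP : is_derive (p + t) (1 : R) Phi (phi (p + t)).
      apply: HP; have : `|t| < 1 by lra.
      by rewrite ltr_norml => /andP[t1 t2]; case: ph => ->; lra.
    have := @is_derive1_comp R Phi (fun t => p + t) t (phi (p + t)) 1 dP _.
    by rewrite mulr1; apply; apply: is_derive_eq; rewrite add0r mulr1.
  by exists c => //; rewrite -Ec addr0.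
have [c1 c1s E1] := key h (or_introl erefl); have [c2 c2s E2] := key (- h) (or_intror erefl).
have k1 : `|phi h - phi (h + c1)| < e * h.
  by apply: hd1; rewrite /ball /= opprD addrA subrr sub0r normrN; lra.
have k2 : `|phi (- h) - phi (- h + c2)| < e * h.
  by apply: hd2; rewrite /ball /= opprD addrA subrr sub0r normrN; lra.
have -> : (2 * h)^-1 * (Phi (h + s) - Phi (- h + s)) - (2 * h)^-1 * (Phi h - Phi (- h)) -
   s * ((2 * h)^-1 * (phi h - phi (- h))) =
   s * ((2 * h)^-1 * ((phi (- h) - phi (- h + c2)) - (phi h - phi (h + c1)))).
  have -> : Phi (h + s) = Phi h + s * phi (h + c1) by move: E1; lra.
  have -> : Phi (- h + s) = Phi (- h) + s * phi (- h + c2) by move: E2; lra.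
  ring.
have hh : 0 < (2 * h)^-1 by rewrite invr_gt0; lra.
rewrite normrM mulrC ler_wpM2r // normrM gtr0_norm // mulrC ler_pdivrMr; last lra.
by apply: le_trans (ler_normB _ _) _; lra.
Qed.

(** The mean value theorem for the antiderivative on each of the N + 1 intervals, summed by
    telescoping, makes the Riemann sum exact. *)
Lemma mean_riemann phi (N : nat) : continuous phi -> exists x : nat -> R,
  (forall j, (j < N.+1)%N -> - h + 2 * h / N.+1%:R * j%:R <= x j <= - h + 2 * h / N.+1%:R * j.+1%:R) /\
  mean h phi = N.+1%:R^-1 * \sum_(j < N.+1) phi (x j).
Proof.
move=> cphi; have h0' := h0; have [Phi HP] := antiderivative (- h - 1) cphi.
have N0 : 0 < N.+1%:R :> R by rewrite ltr0n.
have H t : - h <= t <= h -> is_derive t (1 : R) Phi (phi t) by move=> /andP[a b]; apply: HP; lra.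
pose k : R := 2 * h / N.+1%:R; have k0 : 0 < k by rewrite divr_gt0 //; lra.
have kN : k * N.+1%:R = 2 * h by rewrite /k divfK // gt_eqF.
pose t j := - h + k * j%:R.
have tS j : t j.+1 = t j + k by rewrite /t -natr1; ring.
have ex j : exists x, t j <= x <= t j.+1 /\ Phi (t j.+1) - Phi (t j) = k * phi x.
  have tj : - h <= t j by rewrite /t lerDl mulr_ge0 // ltW.
  have tjS : t j < t j.+1 by rewrite tS; lra.
  have [||c cI E] := @MVT _ Phi phi (t j) (t j.+1) tjS.
  - by move=> s; rewrite in_itv /= => /andP[a b]; apply: HP; lra.
  - apply: derivable_within_continuous => s; rewrite in_itv /= => /andP[a b].
    have dt : is_derive s (1 : R) Phi (phi s) by apply: HP; lra.
    exact: ex_derive.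
  exists c; split; first by move: cI; rewrite in_itv /= => /andP[a b]; rewrite !ltW.
  by rewrite E tS mulrC; congr (_ * _); ring.
have [x hx] := choice ex; exists x; split => [j _|]; first exact: (hx j).1.
rewrite (mean_antiderivative cphi H).
have -> : Phi h - Phi (- h) = \sum_(j < N.+1) (Phi (t j.+1) - Phi (t j)).
  rewrite -(big_mkord xpredT (fun j => Phi (t j.+1) - Phi (t j))) telescope_sumr //.
  by rewrite /t kN mulr0 addr0; congr (Phi _ - _); ring.
rewrite (eq_bigr (fun j : 'I__ => k * phi (x j))) => [|j _]; last exact: (hx j).2.
rewrite -mulr_sumr mulrA; congr (_ * _); rewrite /k; field.
by rewrite !gt_eqF.
Qed.

End Means.

(** * Smoothing by iterated averages along the coordinate directions *)

Section Averages.
Variables (R : realType) (n : nat) (h : R) (h0 : 0 < h).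
Implicit Types (a b : real_coord n) (z w : 'CV[R]_n) (phi : 'CV[R]_n -> R) (U V : set 'CV[R]_n).

Lemma N2_coord_dir a (t : R) : N2 (t%:C *: coord_dir R a) = t ^+ 2.
Proof.
rewrite N2Z /N2 (bigD1 a) //= rc_coord_dir eqxx expr1n big1 ?addr0 ?mulr1 // => b ba.
by rewrite rc_coord_dir (negbTE ba) expr0n.
Qed.

Lemma line_continuous phi z w : continuous phi -> continuous (fun t : R => phi (z + t%:C *: w)).
Proof.
move=> cphi t; apply/(@cvgrPdist_lt _ _ _ (nbhs t)) => e e0.
have [r r0 hr] := continuous_cts_at setT (z + t%:C *: w) cphi e0.
have w1 : 0 < N2 w + 1 by rewrite ltr_wpDl // N2_ge0.
pose d := Num.min 1 (r / (N2 w + 1)).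
have d0 : 0 < d by rewrite lt_min ltr01 divr_gt0.
have dr : d * (N2 w + 1) <= r by rewrite -ler_pdivlMr // ge_min lexx orbT.
have d1 : d <= 1 by rewrite ge_min lexx.
apply/nbhs_ballP; exists d => //= s; rewrite /ball /= distrC => st.
rewrite distrC; apply: hr => //.
rewrite opprD addrACA subrr add0r -scalerBl -rmorphB N2Z.
have N0 := N2_ge0 w.
have : (s - t) ^+ 2 <= d.
  rewrite -(real_normK (num_real (s - t))) expr2; have := normr_ge0 (s - t); nra.
move=> k; apply: (@le_lt_trans _ _ (d * N2 w)); first by rewrite ler_wpM2r.
by apply: lt_le_trans dr; rewrite ltr_pM2l // ltrDl.
Qed.

Definition avg a phi z := mean h (fun t => phi (z + t%:C *: coord_dir R a)).

Lemma avg_point a phi z : continuous phi ->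
  exists2 x : R, `|x| <= h & avg a phi z = phi (z + x%:C *: coord_dir R a).
Proof. by move=> cphi; apply: mean_point => //; exact: line_continuous. Qed.

Lemma avg_linear a phi psi (c : R) z : continuous phi -> continuous psi ->
  avg a (fun z => phi z + c * psi z) z = avg a phi z + c * avg a psi z.
Proof. by move=> c1 c2; apply: mean_linear => //; exact: line_continuous. Qed.

Lemma translate_continuous phi w : continuous phi -> continuous (fun z => phi (z + w)).
Proof.
move=> cphi; apply/continuousN2P => z.
apply: (@cts_at_sub _ _ [set y | setT (y + w)]) => //.
by apply: cts_at_translate; exact: continuous_cts_at.
Qed.

Lemma avg_translate a phi z w : avg a (fun y => phi (y + w)) z = avg a phi (z + w).
Proof. by rewrite /avg; congr mean; apply/funext => t; rewrite addrAC. Qed.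

Lemma avg_uniform a phi z (e : R) : continuous phi -> 0 < e ->
  exists2 d : R, 0 < d & forall x y, N2 (x - z) <= h ^+ 2 -> N2 (y - x) < d -> `|phi y - phi x| < e.
Proof.
move=> cphi e0.
have [|d d0 hd] := @uniformly_continuousN2 R n _ phi e (@compact_ballN2 R n z (h ^+ 2)) _ e0.
  by move=> x _; exact: continuous_cts_at.
by exists d => // x y xz yx; exact: (hd x xz y yx).
Qed.

Lemma line_in_ball a z (x : R) : `|x| <= h -> N2 (z + x%:C *: coord_dir R a - z) <= h ^+ 2.
Proof.
move=> xh; rewrite addrC addKr N2_coord_dir -(real_normK (num_real x)).
by rewrite ler_pXn2r ?nnegrE // ltW.
Qed.

Lemma avg_continuous a phi : continuous phi -> continuous (avg a phi).
Proof.
move=> cphi; apply/continuousN2P => z e e0.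
have [d d0 hd] := avg_uniform a z cphi e0.
exists d => // y _ yd.
have -> : avg a phi y - avg a phi z = avg a (fun x => phi (x + (y - z)) + (-1) * phi x) z.
  by rewrite avg_linear ?avg_translate ?mulN1r ?[z + _]addrC ?subrK //; exact: translate_continuous.
have [|x xh ->] := @avg_point a (fun x => phi (x + (y - z)) + (-1) * phi x) z.
  apply: cts_add; first exact: translate_continuous.
  by apply: cts_mul => //; exact: cts_cst.
rewrite mulN1r; apply: hd; first exact: line_in_ball.
by rewrite addrC addKr.
Qed.

Definition C1_dir b phi := [/\ continuous phi, forall z, derivable (coord_line phi b z) 0 1
  & continuous (pderiv b phi)].

Lemma avg_C1_same a phi : continuous phi -> C1_dir a (avg a phi).
Proof.
move=> cphi.
have E z : coord_line (avg a phi) a z = (fun s => mean h (fun t => phi (z + (t + s)%:C *: coord_dir R a))).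
  apply/funext => s; rewrite /coord_line /avg; congr mean; apply/funext => t.
  by rewrite rmorphD scalerDl addrA addrAC.
have D z := mean_shift_derive h0 (@line_continuous phi z (coord_dir R a) cphi).
split; first exact: avg_continuous.
  by move=> z; rewrite E; exact: (D z).1.
have P : pderiv a (avg a phi) = fun z => (2 * h)^-1 *
   (phi (z + h%:C *: coord_dir R a) - phi (z + (- h)%:C *: coord_dir R a)).
  by apply/funext => z; rewrite /pderiv E; exact: (D z).2.
rewrite P; apply: cts_mul; first exact: cts_cst.
by apply: cts_sub; exact: translate_continuous.
Qed.

Lemma C1_dir_is_derive b phi z (t : R) : C1_dir b phi ->
  is_derive t (1 : R) (fun s : R => phi (z + s%:C *: coord_dir R b)) (pderiv b phi (z + t%:C *: coord_dir R b)).
Proof.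
move=> [_ dphi _].
have E k : phi (z + (k *: (1 : R) + t)%:C *: coord_dir R b) =
  coord_line phi b (z + t%:C *: coord_dir R b) (k *: (1 : R) + 0).
  by rewrite /coord_line addr0 rmorphD scalerDl -addrA [X in z + X]addrC.
have E0 : phi (z + t%:C *: coord_dir R b) = coord_line phi b (z + t%:C *: coord_dir R b) 0.
  by rewrite /coord_line scale0r addr0.
pose F s : R := phi (z + s%:C *: coord_dir R b).
pose G := coord_line phi b (z + t%:C *: coord_dir R b).
have EE : (fun k : R => k^-1 *: ((F \o shift t) (k *: (1 : R)) - F t)) =
          (fun k : R => k^-1 *: ((G \o shift 0) (k *: (1 : R)) - G 0)).
  by apply/funext => k; rewrite /= /F /G E E0.
split.
  by rewrite /derivable -/F EE; exact: dphi.
by rewrite /pderiv derive1E /derive -/F EE.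
Qed.

Lemma avg_C1_dir a b phi : C1_dir b phi -> C1_dir b (avg a phi) /\ pderiv b (avg a phi) = avg a (pderiv b phi).
Proof.
move=> Cb; have [cphi _ cd] := Cb.
have D z : derivable (coord_line (avg a phi) b z) 0 1 /\
    derive1 (coord_line (avg a phi) b z) 0 = avg a (pderiv b phi) z.
  apply: derivable_eps => e e0.
  have [d d0 hd] := avg_uniform a z cd e0.
  exists (Num.sqrt d) => [|s sd]; first by rewrite sqrtr_gt0.
  have sd2 : s ^+ 2 < d.
    by rewrite -(sqr_sqrtr (ltW d0)) -(real_normK (num_real s)) ltr_pXn2r ?nnegrE ?sqrtr_ge0.
  (* The increment of the average minus its linear part is the average of [g], hence a value of [g],
     to which the mean value theorem applies. *)
  pose g (x : 'CV[R]_n) := phi (x + s%:C *: coord_dir R b) + (-1) * phi x + (- s) * pderiv b phi x.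
  have c1 : continuous (fun x : 'CV[R]_n => phi (x + s%:C *: coord_dir R b)) by exact: translate_continuous.
  have c2 : continuous (fun x : 'CV[R]_n => phi (x + s%:C *: coord_dir R b) + (-1) * phi x).
    by apply: cts_add => //; apply: cts_mul => //; exact: cts_cst.
  have cg : continuous g by apply: cts_add => //; apply: cts_mul => //; exact: cts_cst.
  have -> : coord_line (avg a phi) b z s - coord_line (avg a phi) b z 0 - s * avg a (pderiv b phi) z = avg a g z.
    rewrite /g (avg_linear a (- s) z c2 cd) (avg_linear a (-1) z c1 cphi) avg_translate.
    by rewrite /coord_line scale0r addr0 mulN1r mulNr.
  have [x xh ->] := avg_point a z cg.
  set y := z + x%:C *: coord_dir R a.
  have [t _|c cs Ec] := @mean_value R (fun t => phi (y + t%:C *: coord_dir R b))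
     (fun t => pderiv b phi (y + t%:C *: coord_dir R b)) s.
    exact: C1_dir_is_derive.
  rewrite scale0r addr0 in Ec.
  have gE (P1 P2 F1 F2 : R) : F1 - F2 = s * P2 -> F1 + (-1) * F2 + (- s) * P1 = s * (P2 - P1).
    by move=> E; rewrite mulrBr -E; ring.
  have -> : g y = s * (pderiv b phi (y + c%:C *: coord_dir R b) - pderiv b phi y) by exact: gE Ec.
  have k : `|pderiv b phi (y + c%:C *: coord_dir R b) - pderiv b phi y| < e; last first.
    by move: (_ - _) k => K k; rewrite normrM mulrC ler_wpM2r // ltW.
  apply: hd; first exact: line_in_ball.
  rewrite addrC addKr N2_coord_dir; apply: le_lt_trans sd2.
  by rewrite -(real_normK (num_real c)) -(real_normK (num_real s)) ler_pXn2r ?nnegrE.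
have P : pderiv b (avg a phi) = avg a (pderiv b phi).
  by apply/funext => z; exact: (D z).2.
split=> //; split; [exact: avg_continuous|by move=> z; exact: (D z).1|].
by rewrite P; exact: avg_continuous.
Qed.

Definition avgs (s : seq (real_coord n)) phi := foldr avg phi s.

Lemma avgs_continuous s phi : continuous phi -> continuous (avgs s phi).
Proof. by move=> cphi; elim: s => // a s IH; exact: avg_continuous. Qed.

Lemma avgs_C1_dir s b phi : C1_dir b phi -> C1_dir b (avgs s phi) /\ pderiv b (avgs s phi) = avgs s (pderiv b phi).
Proof.
move=> Cb; elim: s => [|a s [IH1 IH2]] //=.
by have [H1 H2] := avg_C1_dir a IH1; split => //; rewrite H2 IH2.
Qed.

Lemma avgs_C1 s b phi : continuous phi -> b \in s -> C1_dir b (avgs s phi).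
Proof.
move=> cphi; elim: s => // a s IH; rewrite in_cons => /orP[/eqP ->|bs].
  exact/avg_C1_same/avgs_continuous.
exact: (avg_C1_dir a (IH bs)).1.
Qed.

(** One pass over all coordinates makes a continuous function C^1, and derivatives commute with
    averages; the second pass therefore gives C^2. *)
Definition smooth phi := let s := index_enum (real_coord n) in avgs s (avgs s phi).

Lemma smooth_C2 phi : continuous phi -> C2_on setT (smooth phi).
Proof.
move=> cphi; set s := index_enum (real_coord n).
have C1 psi : continuous psi -> C1_on setT (avgs s psi).
  move=> cpsi b; have [_ d c] := avgs_C1 cpsi (mem_index_enum b).
  by split=> [z _|]; [exact: d|exact: continuous_subspaceT].
have cs : continuous (avgs s phi) by exact: avgs_continuous.
split; [by apply/continuous_subspaceT; exact: avgs_continuous|exact: C1|] => b.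
have Cb := avgs_C1 cphi (mem_index_enum b).
by rewrite /smooth (avgs_C1_dir s Cb).2; apply: C1; case: Cb.
Qed.

Lemma avgs_point s phi z : continuous phi ->
  exists2 w, (forall b, `|rc b w| <= (size s)%:R * h) & avgs s phi z = phi (z + w).
Proof.
move=> cphi; elim: s z => [|a s IH] z /=.
  by exists 0; rewrite ?addr0 // => b; rewrite rc0 normr0 mul0r.
have [x xh ->] := avg_point a z (@avgs_continuous s phi cphi).
have [w hw ->] := IH (z + x%:C *: coord_dir R a).
exists (x%:C *: coord_dir R a + w); last by rewrite addrA.
move=> b; rewrite rcD rcZ rc_coord_dir -natr1 mulrDl mul1r addrC.
apply: le_trans (ler_normD _ _) _; rewrite lerD //.
by case: (b == a); rewrite ?mulr1 ?mulr0 ?normr0 // ltW.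
Qed.

(** Two passes over the 2n real coordinates, each average moving a coordinate by at most h. *)
Definition reach : R := 2 * (size (index_enum (real_coord n)))%:R * h.

Lemma smooth_point phi z : continuous phi ->
  exists2 w, (forall b, `|rc b w| <= reach) & smooth phi z = phi (z + w).
Proof.
move=> cphi; rewrite /smooth.
have [w1 h1 ->] := avgs_point (index_enum _) z (@avgs_continuous (index_enum _) phi cphi).
have [w2 h2 ->] := avgs_point (index_enum _) (z + w1) cphi.
exists (w1 + w2); last by rewrite addrA.
move=> b; rewrite rcD /reach; apply: le_trans (ler_normD _ _) _.
have := h1 b; have := h2 b; lra.
Qed.

End Averages.

Section AverageSubsolutions.
Variables (R : realType) (n : nat) (n0 : (0 < n)%N).
Implicit Types (a b : real_coord n) (z w p : 'CV[R]_n) (phi : 'CV[R]_n -> R) (U V : set 'CV[R]_n) (C A : 'M[R[i]]_n).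

Lemma trace_congmx_scalarD C A (e : R) :
  complex.Re (\tr (congmx C (A + (e%:C)%:M))) = complex.Re (\tr (congmx C A)) + complex.Re (\tr (congmx C 1%:M)) * e.
Proof. by rewrite congmxD Re_mxtraceD scalar_herm congmxZ mxtraceZ ReZ mulrC. Qed.

Lemma psd1 : psd (1%:M : 'M[R[i]]_n).
Proof. by move=> w; have := hermitian_form_scalar 1 w; rewrite mul1r => ->; exact: N2_ge0. Qed.

(** Riemann sums of the average are means of translates of phi, hence subsolutions of the same
    linear inequality; they converge uniformly near z0, and [vsub_stable] passes to the limit. *)
Lemma vsub_lap_avg C (c h : R) a U V phi : 0 < h -> C \in unitmx -> open V ->
    (forall z (t : R), V z -> `|t| <= h -> U (z + t%:C *: coord_dir R a)) ->
    continuous phi -> vsub (lap_ge C c) U phi ->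
  vsub (lap_ge C c) V (avg h a phi).
Proof.
move=> h0 uC /openN2P oV VU cphi vphi z0 A q Vz0 qA hq.
have [r0 r00 hr0] := oV z0 Vz0.
suff stable e : 0 < e -> c <= complex.Re (\tr (congmx C (A + (e%:C)%:M))).
  apply: (@le_mulr_eps _ _ _ (complex.Re (\tr (congmx C 1%:M)))).
    by apply: trace_congmx_ge0; exact: psd1.
  by move=> e e0; rewrite -trace_congmx_scalarD; exact: stable.
move=> e0.
have [|z1 [v [_ _ _ _]]] := @vsub_stable R n (lap_ge C c) (avg h a phi) z0 A q r0 e qA hq r00 _ e0; last by [].
move=> d d0 {q qA hq e e0}.
have [|de de0 hde] := @uniformly_continuousN2 R n _ phi d (@compact_ballN2 R n z0 (2 * r0 + 2 * h ^+ 2)) _ d0.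
  by move=> x _; exact: continuous_cts_at.
pose B := [set z | N2 (z - z0) < r0].
have unif z (t s : R) : N2 (z - z0) < r0 -> `|t| <= h -> (s - t) ^+ 2 < de ->
    `|phi (z + s%:C *: coord_dir R a) - phi (z + t%:C *: coord_dir R a)| < d.
  move=> zr th st; apply: hde => /=.
    rewrite addrAC; apply: le_trans (N2D _ _) _; rewrite N2_coord_dir.
    have : t ^+ 2 <= h ^+ 2 by rewrite -(real_normK (num_real t)) ler_pXn2r ?nnegrE // ltW.
    lra.
  by rewrite opprD addrACA subrr add0r -scalerBl -rmorphB N2_coord_dir.
have [N Nde] : exists N : nat, (2 * h / N.+1%:R) ^+ 2 < de.
  pose X := 4 * h ^+ 2 / de; have X0 : 0 <= X by rewrite divr_ge0 ?mulr_ge0 ?exprn_ge0 // ltW.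
  have := archi_boundP X0; set N := Num.bound X => XN; exists N.
  have N1 : 1 <= N.+1%:R :> R by rewrite ler1n.
  have : X < N.+1%:R by apply: lt_trans XN _; rewrite ltr_nat.
  rewrite /X ltr_pdivrMr // expr_div_n ltr_pdivrMr ?exprn_gt0 // ?(lt_le_trans ltr01) //.
  move: N.+1%:R N1 => M M1 hM; have := mulr_gt0 de0 (lt_le_trans ltr01 M1); nra.
have N0 : 0 < N.+1%:R :> R by rewrite ltr0n.
pose k : R := 2 * h / N.+1%:R; have k0 : 0 < k by rewrite divr_gt0 //; lra.
have kN : k * N.+1%:R = 2 * h by rewrite /k divfK // gt_eqF.
(* The left end points of the subintervals, within one mesh of the exact nodes. The default 0 keeps
   |t j| <= h for every natural j, as the hypotheses of [vsub_lap_sum] quantify over all of them. *)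
pose t (j : nat) : R := if (j < N.+1)%N then - h + k * j%:R else 0.
have th j : `|t j| <= h.
  rewrite /t; case: ifP => jN; last by rewrite normr0 ltW.
  have : j%:R <= N.+1%:R :> R by rewrite ler_nat ltnW.
  have : 0 <= j%:R :> R by [].
  by move=> j0 jN'; rewrite ler_norml; apply/andP; split; nra.
pose u (j : nat) z := phi (z + (t j)%:C *: coord_dir R a).
exists (fun z => N.+1%:R^-1 * \sum_(j < N.+1) u j z).
have cu j : continuous (u j) by exact: translate_continuous.
have apx z : N2 (z - z0) < r0 -> `|N.+1%:R^-1 * (\sum_(j < N.+1) u j z) - avg h a phi z| <= d.
  move=> zr; have [x [hx Ex]] := @mean_riemann R h h0 _ N (@line_continuous R n phi z (coord_dir R a) cphi).
  rewrite /avg Ex -mulrBr normrM gtr0_norm ?invr_gt0 // ler_pdivrMl // -sumrB.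
  apply: le_trans (ler_norm_sum _ _ _) _.
  apply: (@le_trans _ _ (\sum_(j < N.+1) d)); last by rewrite sumr_const card_ord mulr_natl.
  apply: ler_sum => j _; rewrite /u distrC ltW //; apply: unif => //.
  have := hx j (ltn_ord j); rewrite /t ltn_ord -/k -natr1 => /andP[x1 x2].
  apply: le_lt_trans Nde; rewrite -/k -(real_normK (num_real (_ - _))) ler_pXn2r ?nnegrE ?(ltW k0) //.
  by rewrite ler_norml; apply/andP; split; lra.
split.
- have -> : c = N.+1%:R^-1 * (c *+ N.+1) by rewrite -[c *+ _]mulr_natl mulKf // gt_eqF.
  apply: vsub_lap_scale; first by rewrite invr_gt0.
  apply: vsub_lap_sum => //; first exact: open_ballN2.
    by move=> j z _; exact: continuous_cts_at.
  move=> j; have := @vsub_translate R n _ _ _ ((t j)%:C *: coord_dir R a) vphi.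
  by apply: vsub_subset => z zr; apply: VU => //; exact: hr0.
- move=> z zr; apply: continuous_cts_at; apply: cts_mul; first exact: cts_cst.
  by apply: continuous_sumr => j; exact: cu.
- by move=> z /apx; rewrite ler_norml => /andP[_ x2]; rewrite -lerBlDl.
- have := apx z0; rewrite subrr N2_0 => /(_ r00); rewrite ler_norml => /andP[x1 _].
  by move: x1; rewrite lerBrDr addrC.
Qed.

(** A cube in the real coordinates: one average along a coordinate enlarges it by exactly h. *)
Definition cube p (s : R) := [set z | forall b, `|rc b (z - p)| < s].

Lemma open_cube p s : open (cube p s).
Proof.
apply/openN2P => z zs.
exists (\big[Num.min/1]_b (s - `|rc b (z - p)|) ^+ 2).
  elim/big_ind: _ => // [x y x0 y0|b _]; first by rewrite lt_min x0.
  by rewrite exprn_gt0 // subr_gt0.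
move=> y yz b.
have h : `|rc b (y - z)| < s - `|rc b (z - p)|.
  rewrite -(ltr_pXn2r (n := 2)) ?nnegrE // ?subr_ge0 ?(ltW (zs b)) //.
  rewrite real_normK ?num_real //; apply: le_lt_trans (rc_le_N2 _ _) _.
  by apply: lt_le_trans yz _; rewrite (bigD1 b) //= ge_min lexx.
have -> : y - p = (y - z) + (z - p) by rewrite addrA subrK.
by rewrite rcD; apply: le_lt_trans (ler_normD _ _) _; rewrite -ltrBrDr.
Qed.

Lemma cube_line p (s h : R) a z (t : R) : cube p s z -> `|t| <= h -> cube p (s + h) (z + t%:C *: coord_dir R a).
Proof.
move=> zs th b; rewrite addrAC rcD rcZ rc_coord_dir.
apply: le_lt_trans (ler_normD _ _) _; have := zs b; have := normr_ge0 t.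
by case: (b == a); rewrite ?mulr1 ?mulr0 ?normr0; lra.
Qed.

Lemma vsub_lap_avgs C (c h s : R) p (l : seq (real_coord n)) phi : 0 < h -> C \in unitmx ->
    continuous phi -> vsub (lap_ge C c) (cube p (s + (size l)%:R * h)) phi ->
  vsub (lap_ge C c) (cube p s) (avgs h l phi).
Proof.
move=> h0 uC cphi; elim: l s => [|a l IH] s /=; first by rewrite mul0r addr0.
move=> v; have {}IH : vsub (lap_ge C c) (cube p (s + h)) (avgs h l phi).
  by apply: IH; move: v; rewrite -natr1 (_ : s + h + _ = s + ((size l)%:R + 1) * h) //; ring.
apply: (vsub_lap_avg h0 uC _ _ _ IH); first exact: open_cube.
  by move=> z t zs th; exact: cube_line.
exact: avgs_continuous.
Qed.

Lemma vsub_lap_smooth C (c h s : R) p phi : 0 < h -> C \in unitmx ->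
    continuous phi -> vsub (lap_ge C c) (cube p (s + reach n h)) phi ->
  vsub (lap_ge C c) (cube p s) (smooth h phi).
Proof.
move=> h0 uC cphi v; apply: vsub_lap_avgs => //; first exact: avgs_continuous.
apply: vsub_lap_avgs => //; move: v; rewrite /reach.
by rewrite (_ : s + _ = s + (size (index_enum (real_coord n)))%:R * h +
  (size (index_enum (real_coord n)))%:R * h) //; ring.
Qed.

End AverageSubsolutions.

(** * The Monge-Ampere inequality and comparison *)

Section MongeAmpere.
Variables (R : realType) (n : nat) (n0 : (0 < n)%N).
Implicit Types (z w p : 'CV[R]_n) (u v phi q : 'CV[R]_n -> R) (U V : set 'CV[R]_n) (C A B : 'M[R[i]]_n).

Definition MA A : R := complex.Re (\det (2%:R *: A)).

Lemma MAE A : MA A = 2 ^+ n * complex.Re (\det A).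
Proof.
rewrite /MA detZ (_ : 2%:R ^+ n = (2 ^+ n : R)%:C); last by rewrite rmorphXn rmorph_nat.
exact: ReZ.
Qed.

Lemma nonneg_hermitianP A : nonneg_hermitian A <-> A \is hermsymmx /\ psd A.
Proof.
split=> [[hA H]|[hA pA]].
  by split=> // w; have := H w; rewrite -/(cform A w) hermitian_formE lecE => /andP[].
split=> // w; rewrite -/(cform A w) lecE /= -hermitian_formE pA andbT.
have : (cform A w)^* = cform A w.
  rewrite /cform rmorph_sum exchange_big; apply: eq_bigr => i _.
  rewrite rmorph_sum; apply: eq_bigr => j _; rewrite ((hermsymP _ hA) j i).
  by case: (A i j) => ? ?; case: (w 0 i) => ? ?; case: (w 0 j) => ? ? /=; congr (_ +i* _); ring.
by case: (cform A w) => a b [hb]; apply/eqP => /=; lra.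
Qed.

(** Polarisation of the form: its derivative at z in direction w. *)
Definition bform A z w : R := hermitian_form A (z + w) - hermitian_form A z - hermitian_form A w.

Lemma hermitian_formZr A (t : R) w : hermitian_form A (t%:C *: w) = t ^+ 2 * hermitian_form A w.
Proof.
rewrite /hermitian_form -ReZ mulr_sumr; congr complex.Re; apply: eq_bigr => i _.
rewrite mulr_sumr; apply: eq_bigr => j _; rewrite !mxE.
by case: (A j i) => ? ?; case: (w 0 i) => ? ?; case: (w 0 j) => ? ? /=; congr (_ +i* _); ring.
Qed.

Lemma bformE A z w : bform A z w =
  complex.Re (\sum_i \sum_j (A j i * z 0 i * (w 0 j)^* + A j i * w 0 i * (z 0 j)^*)).
Proof.
rewrite /bform; apply/eqP; rewrite subr_eq subr_eq; apply/eqP.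
rewrite -!ReD -!big_split; congr complex.Re; apply: eq_bigr => i _; rewrite -!big_split.
by apply: eq_bigr => j _; rewrite !mxE rmorphD /=; ring.
Qed.

Lemma bformC A z w : bform A z w = bform A w z.
Proof. by rewrite /bform [w + z]addrC; ring. Qed.

Lemma bformZr A z (t : R) w : bform A z (t%:C *: w) = t * bform A z w.
Proof.
rewrite !bformE -ReZ mulr_sumr; congr complex.Re; apply: eq_bigr => i _.
rewrite mulr_sumr; apply: eq_bigr => j _; rewrite !mxE.
case: (A j i) => ? ?; case: (w 0 i) => ? ?; case: (w 0 j) => ? ?.
by case: (z 0 i) => ? ?; case: (z 0 j) => ? ? /=; congr (_ +i* _); ring.
Qed.

Lemma bformDl A z z' w : bform A (z + z') w = bform A z w + bform A z' w.
Proof.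
rewrite !bformE -ReD -big_split; congr complex.Re; apply: eq_bigr => i _.
by rewrite -big_split; apply: eq_bigr => j _; rewrite !mxE rmorphD /=; ring.
Qed.

Lemma pderiv_hermitian_form A a : pderiv a (hermitian_form A) = fun z => bform A z (coord_dir R a).
Proof.
apply/funext => z; rewrite /pderiv derive1E.
have -> : coord_line (hermitian_form A) a z =
   fun t => hermitian_form A z + t * bform A z (coord_dir R a) + t ^+ 2 * hermitian_form A (coord_dir R a).
  apply/funext => t; rewrite /coord_line -bformZr -hermitian_formZr /bform; ring.
have d : is_derive (0 : R) (1 : R) (fun t : R => hermitian_form A z + t * bform A z (coord_dir R a)
    + t ^+ 2 * hermitian_form A (coord_dir R a)) (bform A z (coord_dir R a)).
  move: (hermitian_form A z) (bform A z _) (hermitian_form A _) => x y s.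
  by apply: is_derive_eq; rewrite /GRing.scale /=; ring.
by rewrite derive_val.
Qed.

Lemma pderiv2_hermitian_form A a b z :
  pderiv b (pderiv a (hermitian_form A)) z = bform A (coord_dir R a) (coord_dir R b).
Proof.
rewrite pderiv_hermitian_form /pderiv derive1E.
have -> : coord_line (fun z => bform A z (coord_dir R a)) b z =
   fun t => bform A z (coord_dir R a) + t * bform A (coord_dir R a) (coord_dir R b).
  by apply/funext => t; rewrite /coord_line bformDl [bform _ (_ *: _) _]bformC bformZr.
have d : is_derive (0 : R) (1 : R) (fun t : R => bform A z (coord_dir R a) + t * bform A (coord_dir R a) (coord_dir R b))
    (bform A (coord_dir R a) (coord_dir R b)).
  move: (bform A z _) (bform A (coord_dir R a) _) => x y.
  by apply: is_derive_eq; rewrite /GRing.scale /=; ring.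
by rewrite derive_val.
Qed.

Lemma bform_coord A a b : bform A (coord_dir R a) (coord_dir R b) =
  complex.Re (A b.1 a.1 * (if a.2 then 'i else 1) * (if b.2 then 'i else 1)^*
    + A a.1 b.1 * (if b.2 then 'i else 1) * (if a.2 then 'i else 1)^*).
Proof.
rewrite bformE (eq_bigr _ (fun i _ => big_split _ _ _ _ _)) big_split.
congr complex.Re; congr (_ + _).
  rewrite (bigD1 a.1) //= (bigD1 b.1) //= !big1 ?addr0.
  - by rewrite !mxE !eqxx !mulr1.
  - by move=> i ia; rewrite big1 // => j _; rewrite !mxE (negbTE ia) andbF !mulr0 mul0r.
  - by move=> j jb; rewrite !mxE (negbTE jb) andbF mulr0 rmorph0 mulr0.
rewrite (bigD1 b.1) //= (bigD1 a.1) //= !big1 ?addr0.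
- by rewrite !mxE !eqxx !mulr1.
- by move=> i ia; rewrite big1 // => j _; rewrite !mxE (negbTE ia) andbF !mulr0 mul0r.
- by move=> j jb; rewrite !mxE (negbTE jb) andbF mulr0 rmorph0 mulr0.
Qed.

Lemma wirtinger2_hermitian_form A j i z : A \is hermsymmx -> wirtinger2 (hermitian_form A) j i z = A j i.
Proof.
move=> hA.
have [G [GE ->]] : exists G : real_coord n -> real_coord n -> R,
    (forall a b, G a b = bform A (coord_dir R a) (coord_dir R b)) /\
    wirtinger2 (hermitian_form A) j i z = 4%:R^-1 * ((G (j, false) (i, false) + G (j, true) (i, true))%:C
      + 'i * (G (j, true) (i, false) - G (j, false) (i, true))%:C).
  exists (fun a b => pderiv b (pderiv a (hermitian_form A)) z); split => // a b.
  exact: pderiv2_hermitian_form.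
rewrite !GE !bform_coord /=.
rewrite ((hermsymP _ hA) i j); case: (A j i) => x y.
have f4 : (4%:R : R[i]) != 0 by rewrite pnatr_eq0.
apply: (mulfI f4); rewrite mulrA divff // mul1r.
rewrite (_ : (4%:R : R[i]) = 4 +i* 0); last by rewrite -(rmorph_nat (real_complex R) 4).
apply/eqP; rewrite eq_complex /=; apply/andP; split; apply/eqP; ring.
Qed.

Lemma MC_hermitian_form A z : A \is hermsymmx -> MC (hermitian_form A) z = MA A.
Proof.
move=> hA; rewrite /MC /MA; congr (complex.Re (\det _)); apply/matrixP => j i.
by rewrite !mxE wirtinger2_hermitian_form.
Qed.

(** The determinant alone does not see an even number of negative eigenvalues; requiring A >= 0 as
    well restores both plurisubharmonicity and the link with traces. *)
Definition ma_ge (f : 'CV[R]_n -> R -> R) : 'CV[R]_n -> R -> 'M[R[i]]_n -> Prop :=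
  fun z s A => psd A /\ f z s <= MA A.

Lemma subsolution_vsub f U u : (forall z0 A q, U z0 -> quad A q -> touches_above q u z0 -> psd A) ->
  viscosity_subsolution U f u -> vsub (ma_ge f) U u.
Proof.
move=> Hpsd [_ H] z0 A q Uz0 qA tq; have pA := Hpsd _ _ _ Uz0 qA tq.
split=> //; have [hA [h hh qE]] := qA.
rewrite -(MC_hermitian_form z0 hA); apply: H => //; last by exists h => //; rewrite -qE.
by exists A => //; apply/nonneg_hermitianP.
Qed.

Lemma vsub_subsolution f U u : continuous_psh U u -> vsub (ma_ge f) U u -> viscosity_subsolution U f u.
Proof.
move=> cu vu; split=> // p [A /nonneg_hermitianP[hA pA] <-] z0 Uz0 [h hh tq].
rewrite MC_hermitian_form //; apply: (vu _ _ _ Uz0 _ tq).2.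
by split=> //; exists h.
Qed.

(* The arithmetic-geometric inequality turns the bound on the determinant into a
   bound on every normalised Laplacian. *)
Lemma vsub_ma_lap f U V u C (k : R) : vsub (ma_ge f) U u -> V `<=` U -> 0 <= k ->
    (forall z, V z -> k ^+ n <= f z (u z)) -> Normc.normc (\det C) = 1 ->
  vsub (lap_ge C (n%:R * (k / 2))) V u.
Proof.
move=> vu VU k0 kf C1 z A q Vz qA tq; have [pA fA] := vu _ _ _ (VU _ Vz) qA tq.
have nR : 0 < n%:R :> R by rewrite ltr0n.
have := det_le_trace_congmx (quad_herm qA) pA C1.
have := le_trans (kf _ Vz) fA; rewrite MAE => h1 h2.
rewrite /lap_ge mulrC -ler_pdivlMr //.
rewrite -(ler_pXn2r n0) ?nnegrE ?divr_ge0 ?(ltW nR) ?trace_congmx_ge0 //.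
apply: le_trans h2; rewrite expr_div_n ler_pdivrMr ?exprn_gt0 // mulrC //.
Qed.

Lemma vsub_ma_lap0 f U u C : vsub (ma_ge f) U u -> vsub (lap_ge C 0) U u.
Proof. by move=> vu z A q Uz qA tq; have [pA _] := vu _ _ _ Uz qA tq; exact: trace_congmx_ge0. Qed.

(** For each C with |det C| = 1 the bound n k / 2 on the trace survives averaging, and the average
    can be tested against its own Taylor polynomial; [det_ge_of_traces] then reassembles the
    determinant. The term e makes the Hessian strictly positive, as required there. The constant k /
    2 reflects the factor 2 in det (2A). *)
Lemma smooth_ma f U u p A (h s k e : R) : 0 < h -> 0 < s -> continuous u ->
    vsub (ma_ge f) U u -> cube p (s + reach n h) `<=` U -> 0 <= k ->
    (forall z, cube p (s + reach n h) z -> k ^+ n <= f z (u z)) ->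
    tay (smooth h u) p A -> 0 < e ->
  psd A /\ (k + 2 * e) ^+ n <= MA (A + (e%:C)%:M).
Proof.
move=> h0 s0 cu vu cubeU k0 kf tA e0.
have pc : cube p s p by move=> b; rewrite subrr rc0 normr0.
have hA : A \is hermsymmx by case: tA => q [] /quad_herm.
have lapA C c : C \in unitmx -> vsub (lap_ge C c) (cube p (s + reach n h)) u -> c <= complex.Re (\tr (congmx C A)).
  move=> uC vc; apply: (@le_mulr_eps _ _ _ (complex.Re (\tr (congmx C 1%:M)))).
    by apply: trace_congmx_ge0; exact: psd1.
  move=> d d0; rewrite -trace_congmx_scalarD.
  apply: (vsub_tay (vsub_lap_smooth n0 h0 uC cu vc) pc tA d0).
  by apply/nbhsN2P; exists 1 => // z _; rewrite !subrr.
have unit_det C : \det C != 0 -> C \in unitmx by rewrite unitmxE unitfE.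
have pA : psd A.
  apply: psd_of_traces => // C /unit_det uC; apply: lapA => //.
  by apply: vsub_subset cubeU _; exact: (vsub_ma_lap0 C vu).
split=> //; rewrite MAE.
have he := herm_scalar n e.
have : (k / 2 + e) ^+ n <= complex.Re (\det (A + (e%:C)%:M)).
  have pAe : psd (A + (e%:C)%:M + ((- e)%:C)%:M).
    rewrite (_ : A + _ + _ = A); first exact: pA.
    by rewrite -addrA -raddfD -rmorphD subrr rmorph0 raddf0 addr0.
  have ke : 0 <= k / 2 + e by rewrite addr_ge0 ?divr_ge0 // ltW.
  apply: (det_ge_of_traces n0 (hermD hA he) e0 pAe ke).
  move=> C C1; rewrite trace_congmx_scalarD mulrDr lerD //.
    apply: lapA; last exact: (vsub_ma_lap vu cubeU k0 kf C1).
    apply: unit_det; apply: contra_eqN C1 => /eqP ->.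
    by rewrite /= expr0n /= addr0 sqrtr0 eq_sym oner_eq0.
  (* The identity matrix has determinant 1, so its normalised trace is at least n: e contributes n
     e. *)
  rewrite ler_wpM2r ?(ltW e0) //.
  have := @det_le_trace_congmx R n C 1%:M (herm_scalar n (1 : R)) (@psd1 R n) C1.
  rewrite det1 /= -[X in X <= _](expr1n _ n) ler_pXn2r ?nnegrE ?divr_ge0 ?trace_congmx_ge0 //; last exact: psd1.
  by rewrite ler_pdivlMr ?ltr0n // mul1r.
move=> h1; apply: (@le_trans _ _ (2 ^+ n * (k / 2 + e) ^+ n)).
  by rewrite -exprMn mulrDr [2 * (k / 2)]mulrC divfK.
by rewrite ler_wpM2l ?exprn_ge0.
Qed.

End MongeAmpere.

(** * The comparison principle *)

Section Comparison.
Variables (R : realType) (n : nat) (n0 : (0 < n)%N) (Om : set 'CV[R]_n) (f : 'CV[R]_n -> R -> R).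
Implicit Types (z w p : 'CV[R]_n) (u v phi q : 'CV[R]_n -> R) (U V : set 'CV[R]_n) (C A B : 'M[R[i]]_n).
Hypotheses (oOm : open Om) (cOm : compact (closure Om))
  (f_cont : forall z t, closure Om z -> forall e : R, 0 < e -> exists2 r : R, 0 < r &
     forall z' t', closure Om z' -> N2 (z' - z) < r -> `|t' - t| < r -> `|f z' t' - f z t| < e)
  (f_ge0 : forall z t, closure Om z -> 0 <= f z t)
  (f_nd : forall z, Om z -> {homo f z : s t / s <= t}).

Lemma vsub_eq P U u v : open U -> (forall z, U z -> u z = v z) -> vsub P U u -> vsub P U v.
Proof.
move=> /openN2P oU uv vu z A q Uz qA [q0 hq]; rewrite -uv //; apply: vu qA _ => //.
split; first by rewrite uv.
have [r r0 hr] := oU z Uz; have /nbhsN2P[s s0 hs] := hq.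
apply/nbhsN2P; exists (Num.min r s) => [|y]; first by rewrite lt_min r0.
by rewrite lt_min => /andP[/hr Uy /hs]; rewrite uv.
Qed.

Lemma N2_cube p (s : R) z : 0 <= s -> cube p s z -> N2 (z - p) <= real_dim R n * s ^+ 2.
Proof.
move=> s0 zs; have -> : real_dim R n * s ^+ 2 = \sum_(b : real_coord n) s ^+ 2.
  by rewrite sumr_const mulr_natl.
apply: ler_sum => b _; rewrite -(real_normK (num_real (rc b _))) ler_pXn2r ?nnegrE //.
exact: ltW (zs b).
Qed.

Lemma reach_dim (h : R) : reach n h = 2 * real_dim R n * h.
Proof.
rewrite /reach /real_dim; congr (_ * _%:R * _).
by rewrite cardE /index_enum; case: index_enum_key; rewrite enumT.
Qed.

Lemma small_cube (d : R) : 0 < d -> exists h s : R, [/\ 0 < h, 0 < s,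
    forall z y, cube z (s + reach n h) y -> N2 (y - z) < d &
    forall u z, continuous u -> exists2 y, N2 (y - z) < d & smooth h u z = u y].
Proof.
move=> d0; pose D := real_dim R n; have D0 : 0 <= D by rewrite ler0n.
have [s0 s00 sD] : exists2 s : R, 0 < s & D * s ^+ 2 < d.
  exists (Num.sqrt (d / (D + 1))); first by rewrite sqrtr_gt0 divr_gt0 // ltr_wpDl.
  rewrite sqr_sqrtr ?divr_ge0 ?(ltW d0) ?addr_ge0 // mulrA ltr_pdivrMr ?ltr_wpDl // mulrC.
  by rewrite ltr_pM2l // ltrDl.
pose h := s0 / (4 * (D + 1)); pose s := s0 / 2.
have hE : h * (4 * (D + 1)) = s0 by rewrite /h divfK // gt_eqF //; lra.
have h0 : 0 < h by rewrite divr_gt0 //; lra.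
have sr : s + reach n h <= s0 by rewrite reach_dim -/D /s; nra.
have spos : 0 < s by rewrite /s; lra.
have r0 : 0 <= reach n h by rewrite reach_dim -/D; apply: mulr_ge0; [rewrite mulr_ge0|exact: ltW].
have cubed z y : cube z (s + reach n h) y -> N2 (y - z) < d.
  move=> zy; apply: le_lt_trans sD; apply: le_trans (N2_cube _ zy) _; first lra.
  rewrite -/D ler_wpM2l // ler_pXn2r ?nnegrE //; lra.
exists h, s; split=> // u z cu; have [w hw E] := smooth_point h0 z cu.
exists (z + w) => //; apply: cubed => b; rewrite addrC addKr; apply: le_lt_trans (hw b) _; lra.
Qed.

Theorem comparison_principle u v :
    (forall z, closure Om z -> cts_at (closure Om) u z) ->
    (forall z, closure Om z -> cts_at (closure Om) v z) ->
    vsub (ma_ge f) Om u ->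
    (forall z0 A q, Om z0 -> quad A q -> psd A -> touches_below q v z0 -> MA A <= f z0 (v z0)) ->
    (forall z, closure Om z -> ~ Om z -> u z <= v z) ->
  forall z, closure Om z -> u z <= v z.
Proof.
move=> cu cv vu sv bd zs czs; rewrite leNgt; apply/negP => uvs.
have [m m3 m0] : exists2 m : R, 3 * m = u zs - v zs & 0 < m.
  by exists ((u zs - v zs) / 3); lra.
have clK : closed (closure Om) by exact: closed_closure.
have [u1 cu1 u1E] := tietzeN2 cOm clK ((withinN2P _ _).2 cu).
have clo z : Om z -> closure Om z by move=> Oz; exact: subset_closure.
pose K := [set z | closure Om z /\ m <= u z - v z].
have KOm : K `<=` Om.
  by move=> z [cz mz]; apply: contrapT => nOz; have := bd z cz nOz; lra.
have cK : compact K.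
  apply: subclosed_compact cOm _ => [|z []//].
  rewrite (_ : K = closure K); first exact: closed_closure.
  rewrite eqEsubset; split; first exact: subset_closure.
  move=> z clz; have cz : closure Om z.
    by rewrite ((closure_id _).1 clK); apply: closure_subset clz => y [].
  split=> //; rewrite leNgt; apply/negP => h.
  have d0 : 0 < m - (u z - v z) by lra.
  have [r r0 hr] := cts_atB (cu z cz) (cv z cz) d0.
  have [y [cy my] yr] := (closureN2P _ _).1 clz r r0.
  have := hr y cy yr; rewrite ltr_norml => /andP[]; lra.
have vu1 : vsub (ma_ge f) Om u1 by apply: vsub_eq vu => // z /clo/u1E ->.
have [M hM] : exists M : R, forall z, closure Om z -> `|N2 z| <= M.
  have [y cy hy] := compact_max cOm (ex_intro _ zs czs) (fun z _ => continuous_cts_at _ _ (@N2_continuous R n)).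
  by exists (N2 y) => x /hy; rewrite ger0_norm ?N2_ge0.
have M0 : 0 <= M by apply: le_trans (hM zs czs); exact: normr_ge0.
(* So that e (|z|^2 - M) lies between - m / 4 and 0 on the closure. *)
pose e := m / (4 * (M + 1)).
have eM : e * (4 * (M + 1)) = m by rewrite /e divfK // gt_eqF //; lra.
have e0 : 0 < e by rewrite divr_gt0 //; lra.
have en0 : 0 < e ^+ n by rewrite exprn_gt0.
(* Half of the gain in (k + e)^n >= k^n + e^n pays for the oscillation of f near the contact point;
   the other half leaves a strict inequality. *)
pose gap := e ^+ n / 2.
have gap0 : 0 < gap by rewrite /gap; lra.
have [d1 d10 hd1] : exists2 d : R, 0 < d & forall x, K x -> forall y, N2 (y - x) < d ->
    Om y /\ f x (u x) - gap <= f y (u y).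
  apply: lebesgue_number => // z Kz; have Oz := KOm z Kz; have cz := clo z Oz.
  have g2 : 0 < gap / 2 by lra.
  have [r1 r10 hr1] := f_cont (u z) cz g2.
  have [r2 r20 hr2] := cu z cz _ r10.
  have [r3 r30 hr3] := (openN2P _).1 oOm z Oz.
  exists (Num.min r1 (Num.min r2 r3)); first by rewrite !lt_min r10 r20.
  move=> x y Kx; rewrite !lt_min => /and3P[x1 x2 x3] /and3P[y1 y2 y3].
  have Oy := hr3 y y3; split=> //; have Ox := KOm x Kx.
  have := hr1 x (u x) (clo x Ox) x1 (hr2 x (clo x Ox) x2).
  have := hr1 y (u y) (clo y Oy) y1 (hr2 y (clo y Oy) y2).
  rewrite !ltr_norml => /andP[a1 a2] /andP[a3 a4]; lra.
have m8 : 0 < m / 8 by lra.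
have [d2 d20 hd2] := @uniformly_continuousN2 R n K u1 (m / 8) cK (fun z _ => continuous_cts_at _ _ cu1) m8.
have d12 : 0 < Num.min d1 d2 by rewrite lt_min d10.
have [h [s [h0 spos cubed near]]] := small_cube d12.
pose W z := smooth h u1 z + e * (N2 z - M).
have WE z : K z -> `|smooth h u1 z - u z| < m / 8.
  move=> Kz; have [y yz ->] := near _ z cu1; rewrite -u1E; last exact/clo/KOm.
  by apply: hd2 => //; move: yz; rewrite lt_min => /andP[].
have Kzs : K zs by split=> //; lra.
have cWv z : K z -> cts_at K (fun z => W z - v z) z.
  move=> Kz; apply: cts_atB; last first.
    by apply: (@cts_at_sub _ _ (closure Om)) (cv z (clo z (KOm z Kz))) => y /KOm/clo.
  apply: continuous_cts_at; apply: cts_add.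
    by apply: avgs_continuous => //; apply: avgs_continuous.
  apply: cts_mul; first exact: cts_cst.
  by apply: cts_sub; [exact: N2_continuous|exact: cts_cst].
have [z0 Kz0 z0max] := compact_max cK (ex_intro _ zs Kzs) cWv.
have Oz0 := KOm z0 Kz0; have cz0 := clo z0 Oz0.
have eN z : closure Om z -> - (m / 4) <= e * (N2 z - M) <= 0.
  move=> cz; have := hM z cz; have := N2_ge0 z; rewrite ler_norml => N1 /andP[N3 N4].
  by apply/andP; split; nra.
have uvz0 : m < u z0 - v z0.
  have := z0max zs Kzs; rewrite /W.
  have := WE zs Kzs; have := WE z0 Kz0; have /andP[] := eN zs czs; have /andP[] := eN z0 cz0.
  rewrite !ltr_norml => a1 a2 a3 a4 /andP[a5 a6] /andP[a7 a8]; lra.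
have [r1 r10 hr1] : exists2 r : R, 0 < r & forall z, N2 (z - z0) < r -> K z.
  have dd : 0 < (u z0 - v z0) - m by lra.
  have [r1 r10 hr1] := cts_atB (cu z0 cz0) (cv z0 cz0) dd.
  have [r2 r20 hr2] := (openN2P _).1 oOm z0 Oz0.
  exists (Num.min r1 r2) => [|z]; first by rewrite lt_min r10.
  rewrite lt_min => /andP[zr1 /hr2/clo cz]; split=> //.
  by have := hr1 z cz zr1; rewrite ltr_norml => /andP[]; lra.
have [A tA _] := tay_C2 openT (smooth_C2 h0 cu1) (I : setT z0).
(* k^n is the lower bound f (z0, u (z0)) - gap for f on the cube, replaced by 0 when it is not
   positive. *)
have [k k0 kn] : exists2 k : R, 0 <= k & f z0 (u z0) - gap <= k ^+ n /\
    (forall y, cube z0 (s + reach n h) y -> k ^+ n <= f y (u1 y)).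
  have cubeOm y : cube z0 (s + reach n h) y -> Om y /\ f z0 (u z0) - gap <= f y (u1 y).
    move=> /cubed; rewrite lt_min => /andP[/(hd1 z0 Kz0)[Oy fy] _].
    by rewrite (u1E _ (clo _ Oy)).
  have [fg|fg] := leP (f z0 (u z0) - gap) 0.
    exists 0 => //; rewrite expr0n (gtn_eqF n0) /=; split => // y /cubeOm[Oy _].
    exact: f_ge0 (clo y Oy).
  have [k kpos kE] := nth_root fg n0.
  by exists k; rewrite ?(ltW kpos) // kE; split => // y /cubeOm[].
have e2 : 0 < e / 2 by lra.
have [|pA MAA] := smooth_ma n0 h0 spos cu1 vu1 _ k0 kn.2 tA e2.
  by move=> y /cubed; rewrite lt_min => /andP[/(hd1 z0 Kz0)[]].
have kexp : f z0 (u z0) < MA (A + ((e / 2)%:C)%:M).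
  apply: lt_le_trans MAA; rewrite mulrC divfK //.
  have : k ^+ n + e ^+ n <= (k + e) ^+ n.
    have := @prodr_addX R n e (fun=> k) n0 (ltW e0) (fun=> k0).
    by rewrite !prodr_const card_ord.
  have := kn.1; rewrite /gap; lra.
move: kexp; apply/negP; rewrite -leNgt.
have [q [qA q0 hq]] := tA; have hA := quad_herm qA.
(* e |z|^2 is split into halves: one stays in the Hessian, and the other is traded against - (e / 2)
   |z - z0|^2, which absorbs the Taylor remainder of the smoothed function. *)
have qq := quadD (quadD qA (quad_N2_shift (e / 2) 0))
  (quadD (quad_N2_shift (e / 2) 0) (quad_N2_shift (- (e / 2)) z0)).
have qt := quadD qq (quad_cst n (- (e * M) + (v z0 - W z0))).
set q' := (X in quad _ X) in qt.
set A' := (X in quad X _) in qt.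
have A'E : A' = A + ((e / 2)%:C)%:M.
  rewrite /A' addr0 -addrA; congr (_ + _).
  rewrite [X in _ + X](_ : _ = 0) ?addr0 //.
  by apply/matrixP => i j; rewrite !mxE -mulrnDl -rmorphD subrr mul0rn.
(* The monotonicity of f enters here only: v (z0) lies below u (z0) at the contact point. *)
apply: le_trans (f_nd Oz0 (_ : v z0 <= u z0)); last lra.
rewrite -A'E; apply: (sv z0 A' q') => //.
  rewrite A'E; apply: psdD => // w; rewrite hermitian_form_scalar mulr_ge0 ?N2_ge0 // ltW //.
split; first by rewrite /q' /W q0 !subr0 subrr N2_0; lra.
have [r2 r20 hr2] := hq _ e2.
apply/nbhsN2P; exists (Num.min r1 r2) => [|z]; first by rewrite lt_min r10.
rewrite lt_min => /andP[/hr1 Kz /hr2]; rewrite ler_norml => /andP[b1 b2].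
have := z0max z Kz; rewrite /q' /W !subr0; lra.
Qed.

End Comparison.

(** * Plurisubharmonic functions *)

Section Circle.
Variable R : realType.
Implicit Types (f g : 'CV[R]_1 -> R) (p q : pol R 1) (t : R).

Definition circle t : 'CV[R]_1 := (cos t +i* sin t)%:M.

Lemma rc_circle t b : rc (0, b) (circle t) = if b then sin t else cos t.
Proof. by rewrite /rc /circle mxE eqxx; case: b. Qed.

Lemma sum_coord1 (F : real_coord 1 -> R) : \sum_a F a = F (0, false) + F (0, true).
Proof.
rewrite (bigD1 (0, false)) //= (bigD1 (0, true)) //= big1 ?addr0 // => -[i b].
by rewrite (ord1 i); case: b.
Qed.

Lemma N2_circle t : N2 (circle t) = 1.
Proof. by rewrite /N2 sum_coord1 !rc_circle cos2Dsin2. Qed.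

(** The rotation field x d/dy - y d/dx, which is d/dt along the circle. *)
Definition rot p := PA (PM (PX _ (0, false)) (pD (0, true) p))
  (PM (PM (PC _ (-1)) (PX _ (0, true))) (pD (0, false) p)).

Lemma is_derive_ev_circle p t : is_derive t 1 (fun s => ev p (circle s)) (ev (rot p) (circle t)).
Proof.
elim: p => [c|[i b]|p IHp q IHq|p IHp q IHq].
- by rewrite /=; apply: is_derive_eq; ring.
- rewrite (ord1 i) /=; case: b.
    under eq_fun do rewrite rc_circle.
    by apply: is_derive_eq; rewrite /= !rc_circle; ring.
  under eq_fun do rewrite rc_circle.
  by apply: is_derive_eq; rewrite /= !rc_circle; ring.
- by rewrite /=; apply: is_derive_eq => /=; ring.
- by rewrite /=; apply: is_derive_eq; rewrite /GRing.scale /=; ring.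
Qed.

Lemma circle_periodic : circle (2 * pi) = circle 0.
Proof. by rewrite /circle mulr_natl cos2pi sin2pi cos0 sin0. Qed.

(* With the Euler operator E, rot^2 + E^2 = |z|^2 times the Laplacian, and E = m. *)
Lemma rot_rot_harm m p z : hom m p -> harm p -> ev (rot (rot p)) z = - (m%:R ^+ 2) * ev p z.
Proof.
move=> hp lp.
have Ep := hom_euler z hp.
have Ex := hom_euler z (hom_pD hp (0, false)); have Ey := hom_euler z (hom_pD hp (0, true)).
have := lp z; rewrite /lap ev_psum.
move: Ep Ex Ey; rewrite !sum_coord1 /= (pDC (0, true) (0, false) p).
have mm : m%:R * (1 + m.-1%:R) = m%:R ^+ 2 :> R.
  by case: (m) => [|k]; rewrite ?mul0r ?expr0n // /= expr2 nat1r.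
move: (rc (0, false) z) (rc (0, true) z) (ev p z) => x y P.
move: (ev (pD (0, false) p) z) (ev (pD (0, true) p) z) (ev (pD (0, false) (pD (0, false) p)) z)
  (ev (pD (0, false) (pD (0, true) p)) z) (ev (pD (0, true) (pD (0, true) p)) z).
move=> px py pxx pxy pyy Ep Ex Ey L.
transitivity (- (x * px + y * py) - x * (x * pxx + y * pxy) - y * (x * pxy + y * pyy)
   + (x ^+ 2 + y ^+ 2) * (pxx + pyy)); first by ring.
rewrite Ex Ey L mulr0 addr0 -mm.
transitivity (- ((1 + m.-1%:R) * (x * px + y * py))); first by ring.
by rewrite Ep; ring.
Qed.

Lemma integral_circle (phi : R -> R) : continuous phi ->
  (\int[lebesgue_measure]_(t in `[0%R, (2 * pi)%R]%classic) (phi t)%:E)%E =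
  (\int[lebesgue_measure]_(t in `[0%R, (2 * pi)%R]%classic) phi t)%:E.
Proof.
move=> cphi; rewrite /Rintegral fineK //.
apply: integrable_fin_num => //; apply: continuous_compact_integrable; first exact: segment_compact.
exact: continuous_subspaceT.
Qed.

Lemma le_integral_circle (phi psi : R -> R) : continuous phi -> continuous psi -> (forall t, phi t <= psi t) ->
  \int[lebesgue_measure]_(t in `[0%R, (2 * pi)%R]%classic) phi t <=
  \int[lebesgue_measure]_(t in `[0%R, (2 * pi)%R]%classic) psi t.
Proof.
move=> cphi cpsi H; apply: le_Rintegral => //.
  by apply: continuous_compact_integrable; [exact: segment_compact|exact: continuous_subspaceT].
by apply: continuous_compact_integrable; [exact: segment_compact|exact: continuous_subspaceT].
Qed.

Lemma circle_is_derive (phi : R -> R) (psi : R -> R) : (forall t, is_derive t (1 : R) phi (psi t)) -> continuous phi.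
Proof. by move=> H t; apply/differentiable_continuous/derivable1_diffP; have := H t => d; exact: ex_derive. Qed.

Lemma pi2_gt0 : 0 < 2 * pi :> R.
Proof. by rewrite mulr_gt0 // pi_gt0. Qed.

(** In degree m > 0, p = - rot (rot p) / m^2 on the circle is the derivative of a periodic function,
    so its integral vanishes, as does p (0). In degree 0, p is constant. *)
Lemma hspan_mean f : hspan f -> continuous (fun t => f (circle t)) /\
  \int[lebesgue_measure]_(t in `[0%R, (2 * pi)%R]%classic) f (circle t) = 2 * pi * f 0.
Proof.
elim=> [m p hp lp|{}f g _ [cf If] _ [cg Ig]].
  have cp q : continuous (fun t => ev q (circle t)).
    exact: (circle_is_derive (fun t => is_derive_ev_circle q t)).
  split=> //; have pi2 := pi2_gt0.
  have [m0|m0] := eqVneq m 0%N.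
    have hp0 : hom 0 p by move: hp; rewrite m0.
    have c t : ev p (circle t) = ev p 0.
      have [x _|x _ E] := @mean_value R (fun s => ev p (0 + s%:C *: circle t)) (fun=> 0) 1.
        have := ev_derive p 0 (circle t) x; rewrite big1 // => a _.
        by rewrite (hom_pD0 hp0) mulr0.
      by move: E; rewrite mulr0 !add0r scale0r scale1r => /eqP; rewrite subr_eq0 => /eqP.
    under eq_Rintegral do rewrite c.
    have d t : is_derive t (1 : R) (fun t => t * ev p 0) (ev p 0).
      by move: (ev p 0) => k; apply: is_derive_eq; rewrite /GRing.scale /=; ring.
    have -> := @integral_antiderivative R (fun=> ev p 0) _ 0 (2 * pi) pi2 (@cts_cst R R _) (fun t _ => d t).
    by rewrite mul0r subr0.
  have -> : ev p 0 = 0.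
    have := hom_euler 0 hp; rewrite big1 => [|a _]; last by rewrite rc0 mul0r.
    by move/esym/eqP; rewrite mulf_eq0 pnatr_eq0 (negbTE m0) => /eqP.
  have d t : is_derive t (1 : R) (fun t => - (m%:R ^+ 2)^-1 * ev (rot p) (circle t)) (ev p (circle t)).
    have := is_derive_ev_circle (rot p) t; rewrite (rot_rot_harm (circle t) hp lp) => d.
    apply: is_derive_eq; rewrite /GRing.scale /=.
    by rewrite mulrA mulNr mulrN opprK mulVf ?mul1r // expf_neq0 // pnatr_eq0.
  have -> := @integral_antiderivative R _ _ 0 (2 * pi) pi2 (cp p) (fun t _ => d t).
  by rewrite circle_periodic subrr mulr0.
split; first exact: cts_add.
rewrite RintegralD //.
- by rewrite If Ig; ring.
- by apply: continuous_compact_integrable; [exact: segment_compact|exact: continuous_subspaceT].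
- by apply: continuous_compact_integrable; [exact: segment_compact|exact: continuous_subspaceT].
Qed.

End Circle.

Section Psh.
Variables (R : realType) (n : nat).
Implicit Types (z w a b : 'CV[R]_n) (u v phi q : 'CV[R]_n -> R) (U Om : set 'CV[R]_n) (A B : 'M[R[i]]_n).

Definition curve a b (t : R) : 'CV[R]_n := a + (cos t +i* sin t) *: b.

Lemma N2_scale (c : R[i]) b : N2 (c *: b) = (complex.Re c ^+ 2 + complex.Im c ^+ 2) * N2 b.
Proof.
rewrite !N2_complex mulr_sumr; apply: eq_bigr => k _; rewrite mxE Normc.normcM exprMn.
by case: c => x y /=; rewrite sqr_sqrtr // addr_ge0 ?sqr_ge0.
Qed.

Lemma curve_near a b t0 (P : 'CV[R]_n -> Prop) :
  (\forall z \near curve a b t0, P z) -> \forall t \near t0, P (curve a b t).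
Proof.
move=> /nbhsN2P[r r0 h].
pose d (t : R) := ((cos t - cos t0) ^+ 2 + (sin t - sin t0) ^+ 2) * N2 b.
have cd : {for t0, continuous d}.
  have cc : continuous (fun t : R => cos t - cos t0) by apply: cts_sub; [exact: continuous_cos|exact: cts_cst].
  have cs : continuous (fun t : R => sin t - sin t0) by apply: cts_sub; [exact: continuous_sin|exact: cts_cst].
  have : continuous d by apply: cts_mul; [apply: cts_add; exact: cts_mul|exact: cts_cst].
  by apply.
have : \forall t \near t0, d t < r.
  apply: (cd (fun x => x < r)); rewrite /d !subrr expr0n /= addr0 mul0r; exact: lt_nbhsl.
apply: filterS => t dt; apply: h; rewrite /curve opprD addrACA subrr add0r -scalerBl N2_scale.
exact: dt.
Qed.

Lemma continuous_curve Om u a b : open Om -> (forall z, Om z -> cts_at Om u z) ->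
  (forall t, Om (curve a b t)) -> continuous (fun t => u (curve a b t)).
Proof.
move=> /openN2P oOm cu Oc t; apply/cvgrPdist_lt => e e0.
have [r r0 hr] := cu _ (Oc t) e e0; have [s s0 hs] := oOm _ (Oc t).
have : \forall z \near curve a b t, `|u (curve a b t) - u z| < e.
  apply/nbhsN2P; exists (Num.min r s) => [|z]; first by rewrite lt_min r0.
  by rewrite lt_min => /andP[zr /hs Oz]; rewrite distrC; exact: hr.
exact: curve_near.
Qed.

Lemma circle_curve t : @circle R t = 0 + (cos t +i* sin t) *: 1%:M.
Proof. by rewrite add0r scalemx1. Qed.

Lemma curve_circle a b t : curve a b t = a + circle t *m b.
Proof. by rewrite /circle mul_scalar_mx. Qed.

(** On the circle the Hermitian part is constant, and Re h contributes only the frequencies 1 and 2,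
    written with sin and cos of t itself. *)
Lemma quad_circle A q z b : quad A q -> exists c : (R * R) * (R * R), forall t,
  q (curve z b t) = q z + hermitian_form A b + (c.1.1 * cos t + c.1.2 * sin t)
     + (c.2.1 * (cos t ^+ 2 - sin t ^+ 2) + c.2.2 * (2 * sin t * cos t)).
Proof.
move=> /(quad_translate z)[hA [h [c [bb [Q ->]]] E]].
have E' w : q (w + z) = hermitian_form A w + complex.Re (poly_deg2 c bb Q w).
  by have := congr1 (fun f => f w) E.
pose L : R[i] := \sum_i bb 0 i * b 0 i; pose S : R[i] := \sum_i \sum_j Q i j * b 0 i * b 0 j.
exists ((complex.Re L, - complex.Im L), (complex.Re S, - complex.Im S)) => t /=.
have -> : q z = complex.Re c.
  rewrite -[z in LHS]add0r E' /poly_deg2 !big1 => [|i _|i _]; last 2 first.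
  - by rewrite big1 // => j _; rewrite mxE mulr0 mul0r.
  - by rewrite mxE mulr0.
  rewrite !addr0 /hermitian_form big1 ?add0r // => i _; rewrite big1 // => j _.
  by rewrite mxE mulr0 mul0r.
rewrite /curve addrC E'.
set e : R[i] := _ +i* _.
have -> : hermitian_form A (e *: b) = hermitian_form A b.
  rewrite /hermitian_form; congr complex.Re; apply: eq_bigr => i _; apply: eq_bigr => j _.
  have ee : e * e^* = 1.
    by rewrite /e; apply/eqP; rewrite eq_complex /=; apply/andP; split; apply/eqP;
      rewrite -?(cos2Dsin2 t); ring.
  by rewrite !mxE rmorphM /= -[RHS]mul1r -ee; ring.
have -> : poly_deg2 c bb Q (e *: b) = c + e * L + e ^+ 2 * S.
  rewrite /poly_deg2 /L /S; congr (_ + _ + _).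
    by rewrite mulr_sumr; apply: eq_bigr => i _; rewrite mxE; ring.
  rewrite mulr_sumr; apply: eq_bigr => i _; rewrite mulr_sumr; apply: eq_bigr => j _.
  by rewrite !mxE; ring.
rewrite !ReD /e; case: c E E' => c1 c2 _ _; case: L => l1 l2; case: S => s1 s2 /=; ring.
Qed.

Lemma quad_circle_mean A q z b : quad A q -> continuous (fun t => q (curve z b t)) /\
  \int[lebesgue_measure]_(t in `[0%R, (2 * pi)%R]%classic) q (curve z b t) =
  2 * pi * (q z + hermitian_form A b).
Proof.
move=> qA; have [c E] := quad_circle z b qA; set k : R := q z + hermitian_form A b.
have cq : continuous (fun t => q (curve z b t)).
  by apply: (continuous_curve openT) => // w _; exact: continuous_cts_at (quad_continuous qA).
split=> //.
(* sin t cos t and sin^2 t are antiderivatives of the two terms of frequency 2. *)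
have d t : is_derive t (1 : R) (fun t => k * t + (c.1.1 * sin t - c.1.2 * cos t) +
    (c.2.1 * (sin t * cos t) + c.2.2 * (sin t * sin t))) (q (curve z b t)).
  rewrite E -/k; apply: is_derive_eq; rewrite /GRing.scale /=; ring.
have -> := @integral_antiderivative R _ _ 0 (2 * pi) (pi2_gt0 R) cq (fun t _ => d t).
by rewrite mulr_natl sin0 cos0 sin2pi cos2pi; ring.
Qed.

Lemma norm_le1 (c : R[i]) : `|c| <= 1 -> complex.Re c ^+ 2 + complex.Im c ^+ 2 <= 1.
Proof.
case: c => x y /=; rewrite normc_def lecE /= => /andP[_ h].
by rewrite -[leLHS]sqr_sqrtr ?addr_ge0 ?sqr_ge0 // exprn_ile1.
Qed.

Lemma psh_touching_psd Om u A q z0 : open Om -> (forall z, Om z -> cts_at Om u z) ->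
  psh Om (EFin \o u) -> Om z0 -> quad A q -> touches_above q u z0 -> psd A.
Proof.
move=> oOm cu [_ _ mu] Oz0 qA [q0 /nbhsN2P[r1 r10 hr1]] w.
have [r2 r20 hr2] := (openN2P _).1 oOm z0 Oz0.
have m0 : 0 < Num.min r1 r2 by rewrite lt_min r10.
pose m := Num.min r1 r2; have N0 := N2_ge0 w.
have N1 : 0 < N2 w + 1 by lra.
pose t := Num.sqrt (m / (N2 w + 1)).
have tt : t ^+ 2 = m / (N2 w + 1) by rewrite sqr_sqrtr // divr_ge0 // ltW.
have t0 : 0 < t ^+ 2 by rewrite tt divr_gt0.
have tm : t ^+ 2 * N2 w < m.
  have : t ^+ 2 * (N2 w + 1) = m by rewrite tt divfK // gt_eqF.
  by rewrite mulrDr mulr1; lra.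
pose b := t%:C *: w; have Nb : N2 b < m by rewrite N2Z.
have disc (c : R[i]) : `|c| <= 1 -> N2 (z0 + c *: b - z0) < m.
  move=> /norm_le1 c1; rewrite addrC addKr N2_scale; apply: le_lt_trans Nb.
  by apply: ler_piMl => //; exact: N2_ge0.
have cu1 (s : R) : `|cos s +i* sin s| <= 1 by rewrite normc_def /= cos2Dsin2 sqrtr1 lexx.
have Oc c : `|c| <= 1 -> Om (z0 + c *: b).
  by move=> /disc; rewrite lt_min => /andP[_ /hr2].
have cc := continuous_curve oOm cu (fun s => Oc _ (cu1 s)).
have [cq Iq] := quad_circle_mean z0 b qA.
have : ((u z0)%:E <= ((2 * pi)^-1)%:E * \int[lebesgue_measure]_(t in `[0%R, (2 * pi)%R]%classic) (u (curve z0 b t))%:E)%E.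
  by apply: mu Oc.
rewrite integral_circle // -EFinM lee_fin => h.
have := le_integral_circle cc cq (fun s => _); rewrite Iq => /(_ _) le.
have {}le : \int[lebesgue_measure]_(t in `[0%R, (2 * pi)%R]%classic) u (curve z0 b t) <= 2 * pi * (u z0 + hermitian_form A b).
  rewrite -q0; apply: le => s; apply: hr1; have := disc _ (cu1 s); rewrite lt_min => /andP[]//.
have pi2 := pi2_gt0 R.
have : u z0 <= u z0 + hermitian_form A b.
  apply: le_trans h _; rewrite ler_pdivrMl //.
by rewrite lerDl hermitian_formZr pmulr_rge0.
Qed.

End Psh.

(** * The sub-mean value inequality on the unit disc *)

Section Subharmonic.
Variable R : realType.

Lemma integral_circleD (phi : R -> R) (c : R) : continuous phi ->
  \int[lebesgue_measure]_(t in `[0%R, (2 * pi)%R]%classic) (phi t + c) =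
  \int[lebesgue_measure]_(t in `[0%R, (2 * pi)%R]%classic) phi t + 2 * pi * c.
Proof.
move=> cphi; rewrite RintegralD //; last 2 first.
- by apply: continuous_compact_integrable; [exact: segment_compact|exact: continuous_subspaceT].
- apply: continuous_compact_integrable; [exact: segment_compact|].
  by apply: continuous_subspaceT; exact: (@cts_cst R R c).
congr (_ + _); have d t : is_derive t (1 : R) (fun t => t * c) c.
  by apply: is_derive_eq; rewrite /GRing.scale /=; ring.
have -> := @integral_antiderivative R (fun=> c) _ 0 (2 * pi) (pi2_gt0 R) (@cts_cst R R _) (fun t _ => d t).
by rewrite mul0r subr0.
Qed.

Lemma subharmonic_mean (w : 'CV[R]_1 -> R) : continuous w ->
    (forall z, N2 z < 1 -> exists2 A, tay w z A & 0 <= complex.Re (\tr A)) ->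
  2 * pi * w 0 <= \int[lebesgue_measure]_(t in `[0%R, (2 * pi)%R]%classic) w (circle t).
Proof.
move=> cw hw; have pi2 := pi2_gt0 R.
(* The harmonic approximant loses 2 e at the centre and e on the circle, times the length 2 pi. *)
apply: (@le_mulr_eps _ _ _ (6 * pi)) => [|e e0]; first by rewrite mulr_ge0 // pi_ge0.
have [f hf fe] := @hspan_approximation R 1 isT 1 w e (fun z _ => continuous_cts_at _ _ cw) e0.
have [cf If] := hspan_mean hf; have [p lp pE] := hspan_harm hf.
have max0 : w 0 <= ev p 0 + 2 * e.
  (* - e |z|^2 makes the majorant strictly superharmonic; the constant 2 e restores phi >= w on the
     circle. *)
  pose phi (z : 'CV[R]_1) := ev p z + (2 * e + (- e) * N2 (z - 0)).
  have cphi : continuous phi.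
    apply: cts_add; first exact: ev_continuous.
    apply: cts_add; first exact: cts_cst.
    apply: cts_mul; [exact: cts_cst|exact: N2_dist_continuous].
  have := @vsub_trace_le R 1 0 0 1 w phi ler01
    (fun z _ => continuous_cts_at _ _ cw) (fun z _ => continuous_cts_at _ _ cphi) _ _ _ 0.
  rewrite /phi subrr N2_0 mulr0 addr0; apply => //.
  - move=> z A q zr qA [q0 hq]; move: zr; rewrite /= subr0 => /hw[B tB B0].
    have pAB : psd (A - B).
      by apply: (tay_below_quad tB qA); apply: filterS hq => y; rewrite q0 subrr subr_le0.
    by have := psd_trace_ge0 pAB; rewrite /trace_ge Re_mxtraceB; lra.
  - move=> z _; have [B tB trB] := tay_ev p z.
    have tq := tayD tB (quad_tay z (quadD (quad_cst 1 (2 * e)) (quad_N2_shift (- e) 0))).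
    exists (B + (0 + ((- e)%:C)%:M)); first exact: tq.
    rewrite [0 + _]add0r mxtrace_scalarD trB lp; lra.
  - move=> z; rewrite subr0 => z1; have := fe z z1; rewrite z1 -pE ltr_norml => /andP[]; lra.
rewrite pE in max0; have Iw : 2 * pi * (f 0 - e) <= \int[lebesgue_measure]_(t in `[0%R, (2 * pi)%R]%classic) w (circle t).
  rewrite mulrDr -If -integral_circleD //; apply: le_integral_circle.
  - exact: (cts_add cf (@cts_cst R R _)).
  - rewrite (_ : (fun t => _) = fun t => w (curve 0 1%:M t)).
      by apply: (continuous_curve openT) => // z _; exact: continuous_cts_at.
    by apply/funext => t; rewrite circle_curve.
  - by move=> t; have := fe (circle t) (N2_circle t); rewrite ltr_norml => /andP[]; lra.
apply: le_trans (_ : 2 * pi * (f 0 + 2 * e) <= _); first by rewrite ler_pM2l.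
move: Iw; move: (\int[_]_(_ in _) _) => I; lra.
Qed.

End Subharmonic.

Section PshViscosity.
Variables (R : realType) (n : nat) (n0 : (0 < n)%N).
Implicit Types (z w a b : 'CV[R]_n) (u v phi q : 'CV[R]_n -> R) (U Om : set 'CV[R]_n) (A B : 'M[R[i]]_n).

Lemma tay_comp_affine m (C : 'M[R[i]]_(m, n)) a phi (z0 : 'CV[R]_m) A : tay phi (z0 *m C + a) A ->
  tay (fun z : 'CV[R]_m => phi (z *m C + a)) z0 (congmx C A).
Proof.
move=> [q [qA q0 hq]]; exists (fun z : 'CV[R]_m => q (z *m C + a)); split => //.
  by have := quad_comp_linear C (quad_translate a qA).
have [K K0 hK] := N2_mulmx C; move=> e e0.
have [r r0 hr] := hq _ (divr_gt0 e0 K0); exists (r / K) => [|z zr]; first by rewrite divr_gt0.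
have zE : z *m C + a - (z0 *m C + a) = (z - z0) *m C by rewrite mulmxBl opprD addrACA subrr addr0.
have Nz := hK (z - z0); apply: le_trans (hr _ _) _; rewrite zE.
  by apply: le_lt_trans Nz _; rewrite mulrC -ltr_pdivlMr.
by rewrite -mulrA ler_wpM2l ?(ltW e0) // mulrC ler_pdivrMr // mulrC.
Qed.

Lemma continuous_affine m (C : 'M[R[i]]_(m, n)) a : continuous (fun z : 'CV[R]_m => z *m C + a).
Proof.
move=> z U /nbhsN2P[r r0 hr]; have [K K0 hK] := N2_mulmx C.
apply/nbhsN2P; exists (r / K) => [|y yr]; first by rewrite divr_gt0.
apply: hr; rewrite opprD addrACA subrr addr0 -mulmxBl.
by apply: le_lt_trans (hK _) _; rewrite mulrC -ltr_pdivlMr.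
Qed.

Lemma vsub_psh Om u : open Om -> compact (closure Om) ->
    (forall z, closure Om z -> cts_at (closure Om) u z) ->
    vsub (fun _ _ A => psd A) Om u ->
  psh Om (EFin \o u).
Proof.
move=> oOm cOm cu vu.
have clo z : Om z -> closure Om z by move=> Oz; exact: subset_closure.
have cuO z : Om z -> cts_at Om u z by move=> /clo/cu; apply: cts_at_sub.
split=> [z _|z Oz c|a b disc]; first by rewrite ltry.
  rewrite lte_fin => uc; have d0 : 0 < c - u z by lra.
  have [r r0 hr] := cuO z Oz _ d0; have [s s0 hs] := (openN2P _).1 oOm z Oz.
  apply/nbhsN2P; exists (Num.min r s) => [|y]; first by rewrite lt_min r0.
  by rewrite lt_min => /andP[yr /hs Oy]; rewrite lte_fin; have := hr y Oy yr; rewrite ltr_norml => /andP[]; lra.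
have cu1 (s : R) : `|cos s +i* sin s| <= 1 by rewrite normc_def /= cos2Dsin2 sqrtr1 lexx.
have Oc t : Om (curve a b t) by exact: disc.
have cc := continuous_curve oOm cuO Oc.
suff : 2 * pi * u a <= \int[lebesgue_measure]_(t in `[0%R, (2 * pi)%R]%classic) u (curve a b t).
  rewrite mulrC -ler_pdivlMr ?pi2_gt0 // mulrC -lee_fin EFinM -integral_circle //.
have [v cv vE] := tietzeN2 cOm (@closed_closure _ Om) ((withinN2P _ _).2 cu).
(* The condition A >= 0 is the Monge-Ampere inequality with right-hand side 0, so the smoothing
   result applies to it. *)
have vv : vsub (ma_ge (fun _ _ => 0)) Om v.
  apply: (@vsub_eq R n _ _ u) => // [z /clo/vE ->//|].
  apply: vsub_weaken vu => z s A _ hA pA; split=> //.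
  by rewrite MAE mulr_ge0 ?exprn_ge0 // psd_det_ge0.
pose D : set 'CV[R]_1 := [set z | N2 (z - 0) <= 1].
pose K := (fun z : 'CV[R]_1 => z *m b + a) @` D.
have cK : compact K.
  by apply: continuous_compact; [apply: continuous_subspaceT; exact: continuous_affine|exact: compact_ballN2].
have KOm : K `<=` Om.
  move=> _ [z Dz <-]; have -> : z = (z 0 0)%:M by rewrite -mx11_scalar.
  rewrite mul_scalar_mx addrC; apply: disc; rewrite normc_def lecE /= eqxx /=.
  move: Dz; rewrite /D /= subr0 /N2 sum_coord1 /rc /=; case: (z 0 0) => x y /= h.
  by rewrite -sqrtr1 ler_wsqrtr.
have [d1 d10 hd1] := compact_subset_open cK oOm KOm.
(* The smoothing error e enters at the centre and on the circle, each time multiplied by 2 pi. *)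
apply: (@le_mulr_eps _ _ _ (4 * pi)) => [|e e0]; first by rewrite mulr_ge0 // pi_ge0.
have [d2 d20 hd2] := @uniformly_continuousN2 R n K v e cK (fun z _ => continuous_cts_at _ _ cv) e0.
have d12 : 0 < Num.min d1 d2 by rewrite lt_min d10.
have [h [s [h0 s0 cubed near]]] := small_cube n d12.
pose w (z : 'CV[R]_1) := smooth h v (z *m b + a).
have cw : continuous w.
  move=> z; apply: (@continuous_comp _ _ _ (fun z : 'CV[R]_1 => z *m b + a)); first exact: continuous_affine.
  by apply: avgs_continuous => //; exact: avgs_continuous.
have wv (z : 'CV[R]_1) : N2 z <= 1 -> `|w z - u (z *m b + a)| < e.
  move=> z1; have Kz : K (z *m b + a) by exists z => //; rewrite /D /= subr0.
  rewrite -vE; last exact/clo/KOm.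
  have [y yz] := near _ (z *m b + a) cv; rewrite /w => ->.
  by apply: hd2 => //; move: yz; rewrite lt_min => /andP[].
have := @subharmonic_mean R w cw.
have h1 (z : 'CV[R]_1) : N2 z < 1 -> exists2 A, tay w z A & 0 <= complex.Re (\tr A).
  move=> z1; have Kz : K (z *m b + a) by exists z => //; rewrite /D /= subr0 ltW.
  have [A tA _] := tay_C2 openT (smooth_C2 h0 cv) (I : setT (z *m b + a)).
  exists (congmx b A); first exact: tay_comp_affine.
  apply: trace_congmx_ge0.
  have [||//] := @smooth_ma R n n0 _ Om v (z *m b + a) A h s 0 1 h0 s0 cv vv _ (lexx 0) _ tA ltr01.
    by move=> y /cubed; rewrite lt_min => /andP[/(hd1 _ Kz)].
  by move=> y _; rewrite expr0n (gtn_eqF n0).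
move=> /(_ h1) Iw.
have w0 : u a - e <= w 0.
  by have := wv 0; rewrite N2_0 mul0mx add0r => /(_ ler01); rewrite ltr_norml => /andP[]; lra.
have : \int[lebesgue_measure]_(t in `[0%R, (2 * pi)%R]%classic) w (circle t) <=
    \int[lebesgue_measure]_(t in `[0%R, (2 * pi)%R]%classic) u (curve a b t) + 2 * pi * e.
  rewrite -integral_circleD //; apply: le_integral_circle.
  - rewrite (_ : (fun t => _) = fun t => w (curve 0 1%:M t)).
      by apply: (continuous_curve openT) => // z _; exact: continuous_cts_at.
    by apply/funext => t; rewrite circle_curve.
  - exact: (cts_add cc (@cts_cst R R _)).
  - move=> t; have := wv (circle t); rewrite N2_circle lexx => /(_ isT).
    by rewrite curve_circle [a + _]addrC ltr_norml => /andP[]; lra.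
move: Iw; move: (\int[_]_(_ in _) _) (\int[_]_(_ in _) _) => I1 I2 h2 h3.
have pi2 := pi2_gt0 R; have : 2 * pi * (u a - e) <= 2 * pi * w 0 by rewrite ler_pM2l.
lra.
Qed.

End PshViscosity.

(** * Perron's method *)

Section Gluing.
Variables (R : realType) (n : nat) (n0 : (0 < n)%N) (Om : set 'CV[R]_n).
Implicit Types (z w : 'CV[R]_n) (u v V phi q : 'CV[R]_n -> R) (U W : set 'CV[R]_n) (A B : 'M[R[i]]_n).
Hypotheses (oOm : open Om) (cOm : compact (closure Om)).

Lemma vsub_le_harmonic u h :
    (forall z, closure Om z -> cts_at (closure Om) u z) ->
    (forall z, closure Om z -> cts_at (closure Om) h z) ->
    vsub (fun _ _ A => psd A) Om u -> harmonic_on Om h ->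
    (forall z, closure Om z -> ~ Om z -> u z <= h z) ->
  forall z, closure Om z -> u z <= h z.
Proof.
move=> cu ch vu [h2 hh] bd zs czs; rewrite leNgt; apply/negP => uh.
have [y cy hy] := compact_max cOm (ex_intro _ zs czs) (fun z _ => continuous_cts_at _ _ (@N2_continuous R n)).
(* e |z|^2 is at most half of the excess at zs, so the maximum of u - phi still lies where u > h,
   inside Om. There the test Hessian has trace - n e / 2. *)
have M0 := N2_ge0 y; pose e := (u zs - h zs) / (2 * (N2 y + 1)).
have eM : e * (2 * (N2 y + 1)) = u zs - h zs by rewrite /e divfK // gt_eqF //; lra.
have e0 : 0 < e by rewrite divr_gt0 //; lra.
pose phi z := h z + (- e) * N2 (z - 0).
have cphi z : closure Om z -> cts_at (closure Om) (fun z => u z - phi z) z.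
  move=> cz; apply: cts_atB; first exact: cu.
  apply: cts_atD; first exact: ch.
  by apply: continuous_cts_at; apply: cts_mul; [exact: cts_cst|exact: N2_dist_continuous].
have [z1 cz1 z1max] := compact_max cOm (ex_intro _ zs czs) cphi.
have z1y := hy z1 cz1; have zs0 := N2_ge0 zs.
have val : u zs - h zs <= u z1 - h z1 + e * N2 z1.
  have := z1max zs czs; rewrite /phi !subr0; nra.
have Oz1 : Om z1.
  apply: contrapT => nO; have := bd z1 cz1 nO; nra.
have [A tA trA] := tay_C2 oOm h2 Oz1.
have tphi := tayD tA (quad_tay z1 (quad_N2_shift (- e) 0)).
have e2 : 0 < e / 2 by lra.
have near1 : \forall z \near z1, u z - phi z <= u z1 - phi z1.
  have [r r0 hr] := (openN2P _).1 oOm z1 Oz1.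
  by apply/nbhsN2P; exists r => // z /hr Oz; apply: z1max; exact: subset_closure.
have /psd_trace_ge0 := vsub_tay vu Oz1 tphi e2 near1.
rewrite !mxtrace_scalarD trA hh // mul0r => h1.
have n1 : 0 < n%:R :> R by rewrite ltr0n.
nra.
Qed.

Definition glue W u V z : R := if `[< W z >] then Num.max (u z) (V z) else u z.

Lemma glue_ge W u V z : u z <= glue W u V z.
Proof. by rewrite /glue; case: ifP => // _; rewrite le_max lexx. Qed.

Lemma glue_in W u V z : W z -> V z <= glue W u V z.
Proof. by move=> Wz; rewrite /glue asboolT // le_max lexx orbT. Qed.

Lemma glue_out W u V z : ~ W z -> glue W u V z = u z.
Proof. by move=> Wz; rewrite /glue asboolF. Qed.

Lemma glue_max W u V z : W z -> glue W u V z = Num.max (u z) (V z).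
Proof. by move=> Wz; rewrite /glue asboolT. Qed.

(** A test function for the glued function also touches whichever of u and V attains the maximum at
    the point; if it is V alone, W being open makes the contact local. *)
Lemma vsub_glue P W U u V : open W -> W `<=` U -> vsub P U u -> vsub P W V -> vsub P U (glue W u V).
Proof.
move=> /openN2P oW WU vu vV z A q Uz qA [q0 hq].
have gu : glue W u V z = u z -> P z (glue W u V z) A.
  move=> gz; rewrite gz; apply: vu qA _ => //; split; first by rewrite q0.
  by apply: filterS hq => y; apply: le_trans; exact: glue_ge.
have [Wz|/glue_out/gu//] := pselect (W z).
have [uV|Vu] := leP (u z) (V z); last by apply: gu; rewrite glue_max // max_l // ltW.
have gz : glue W u V z = V z by rewrite glue_max // max_r.
rewrite gz; apply: vV qA _ => //; split; first by rewrite q0.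
have [r r0 hr] := oW z Wz; have Wn : \forall y \near z, W y by apply/nbhsN2P; exists r.
by near=> y; apply: le_trans (_ : glue W u V y <= _); [apply: glue_in; near: y|near: y].
Unshelve. all: by end_near. Qed.

(** Near a point outside W the glued function is u itself, because V <= u on the nearby part of
    W. *)
Lemma cts_glue K W u V z : open W -> cts_at K u z -> (W z -> cts_at K V z) ->
    (~ W z -> exists2 r : R, 0 < r & forall y, W y -> N2 (y - z) < r -> V y <= u y) ->
  cts_at K (glue W u V) z.
Proof.
move=> /openN2P oW cu cV bd e e0; have [r r0 hr] := cu e e0.
have [Wz|Wz] := pselect (W z).
  have [s s0 hs] := cV Wz e e0; have [t t0 ht] := oW z Wz.
  exists (Num.min t (Num.min r s)) => [|y Ky]; first by rewrite !lt_min t0 r0.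
  rewrite !lt_min => /and3P[/ht Wy yr ys]; rewrite !glue_max //.
  have := hr y Ky yr; have := hs y Ky ys; rewrite !ltr_norml => /andP[h1 h2] /andP[h3 h4].
  by apply/andP; case: (leP (u y)) => h5; case: (leP (u z)) => h6; split; lra.
have [s s0 hs] := bd Wz.
exists (Num.min r s) => [|y Ky]; first by rewrite lt_min r0.
rewrite lt_min => /andP[yr ys]; rewrite (glue_out _ _ Wz).
have -> : glue W u V y = u y.
  have [Wy|/glue_out//] := pselect (W y); rewrite glue_max // max_l //; exact: hs.
exact: hr.
Qed.

(** Compactness twice: of [- M, M], to make the radius around z independent of t, then of the
    closure of Om, to make it independent of z. *)
Lemma uniform_in_z (f : 'CV[R]_n -> R -> R) (M e : R) :
    (forall z t, closure Om z -> forall e : R, 0 < e -> exists2 r : R, 0 < r &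
     forall z' t', closure Om z' -> N2 (z' - z) < r -> `|t' - t| < r -> `|f z' t' - f z t| < e) ->
    0 < e ->
  exists2 d : R, 0 < d & forall z z' t, closure Om z -> closure Om z' -> N2 (z' - z) < d ->
    - M <= t <= M -> `|f z' t - f z t| < e.
Proof.
move=> cf e0; have [//|z cz|d d0 hd] := @lebesgue_number R n (closure Om)
  (fun z z' => closure Om z' -> forall t, - M <= t <= M -> `|f z' t - f z t| < e); last first.
  exists d; [exact: d0|move=> z z' t cz cz' zz' tM; exact: (hd z cz z' zz' cz' t tM)].
have e4 : 0 < e / 4 by lra.
have [|t _|d d0 hd] := @compact_uniform_radius R R `[- M, M]%classic
  (fun d t => forall x, closure Om x -> N2 (x - z) < d -> `|f x t - f z t| < e / 2).
- exact: segment_compact.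
- have [r r0 hr] := cf z t cz _ e4; exists r => //.
  apply/nbhs_ballP; exists r => // s; rewrite /ball /= distrC => st d d0 dr _ x cx xd.
  have := hr x s cx (lt_trans xd dr) st; have := hr z s cz _ st.
  rewrite subrr N2_0 => /(_ r0); rewrite !ltr_norml => /andP[h1 h2] /andP[h3 h4].
  by apply/andP; split; lra.
exists d => // x y cx xd yd cy t tM.
have tI : `[- M, M]%classic t by rewrite /= in_itv.
have := hd t tI x cx xd; have := hd t tI y cy yd.
rewrite !ltr_norml => /andP[h1 h2] /andP[h3 h4]; apply/andP; split; lra.
Qed.

End Gluing.

(** * The Perron envelope *)

Section Perron.
Variables (R : realType) (n : nat) (n0 : (0 < n)%N) (Om : set 'CV[R]_n) (f : 'CV[R]_n -> R -> R)
  (us ub : 'CV[R]_n -> R).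
Implicit Types (z w x y : 'CV[R]_n) (u v V phi q : 'CV[R]_n -> R) (U W : set 'CV[R]_n) (A B C : 'M[R[i]]_n).
Hypotheses (oOm : open Om) (cOm : compact (closure Om))
  (f_cont : forall z t, closure Om z -> forall e : R, 0 < e -> exists2 r : R, 0 < r &
     forall z' t', closure Om z' -> N2 (z' - z) < r -> `|t' - t| < r -> `|f z' t' - f z t| < e)
  (f_ge0 : forall z t, closure Om z -> 0 <= f z t)
  (f_nd : forall z, Om z -> {homo f z : s t / s <= t})
  (cus : forall z, closure Om z -> cts_at (closure Om) us z)
  (cub : forall z, closure Om z -> cts_at (closure Om) ub z)
  (vus : vsub (ma_ge f) Om us) (hub : harmonic_on Om ub)
  (us_ub : forall z, closure Om z -> ~ Om z -> us z = ub z).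

Definition perron_family v :=
  [/\ forall z, closure Om z -> cts_at (closure Om) v z, vsub (ma_ge f) Om v,
      forall z, closure Om z -> us z <= v z & forall z, closure Om z -> ~ Om z -> v z = us z].

Definition perron z := sup [set v z | v in perron_family].

Lemma perron_family_sub : perron_family us.
Proof. by split. Qed.

Lemma perron_family_le v : perron_family v -> forall z, closure Om z -> v z <= ub z.
Proof.
move=> [cv vv _ bv]; apply: vsub_le_harmonic => //.
  by apply: vsub_weaken vv => z s A _ _ [].
by move=> z cz nOz; rewrite bv // us_ub.
Qed.

Lemma perron_has_sup z : closure Om z -> has_sup [set v z | v in perron_family].
Proof.
move=> cz; split; first by exists (us z); exists us => //; exact: perron_family_sub.
by exists (ub z) => _ [v /perron_family_le vF <-]; exact: vF.
Qed.

Lemma perron_ge v z : perron_family v -> closure Om z -> v z <= perron z.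
Proof. by move=> vF cz; apply: sup_upper_bound; [exact: perron_has_sup|exists v]. Qed.

Lemma perron_le z (c : R) : (forall v, perron_family v -> v z <= c) -> perron z <= c.
Proof.
move=> H; apply: ge_sup; first by exists (us z); exists us => //; exact: perron_family_sub.
by move=> _ [v vF <-]; exact: H.
Qed.

Lemma perron_approx z (e : R) : closure Om z -> 0 < e ->
  exists2 v, perron_family v & perron z - e < v z.
Proof.
by move=> cz e0; have [_ [v vF <-] h] := sup_adherent e0 (perron_has_sup cz); exists v.
Qed.

Lemma MA_scalar_ge A (s : R) : A \is hermsymmx -> psd A -> 0 <= s -> MA A + (2 * s) ^+ n <= MA (A + (s%:C)%:M).
Proof.
move=> hA pA s0; rewrite !MAE exprMn -mulrDr ler_wpM2l ?exprn_ge0 //.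
exact: det_add_scalar.
Qed.

(* Adding eta |z|^2 raises the Monge-Ampere operator by (2 eta)^n, which absorbs the
   oscillation of f between z and z + t. *)
Lemma vsub_ma_translate v (t : 'CV[R]_n) (eta c M : R) W : 0 < eta -> vsub (ma_ge f) Om v ->
    (forall z, W z -> [/\ Om z, Om (z + t), N2 z <= c & - M <= v (z + t) <= M]) ->
    (forall z s, W z -> - M <= s <= M -> f z s <= f (z + t) s + (2 * eta) ^+ n) ->
  forall b : R, 0 <= b -> vsub (ma_ge f) W (fun z => v (z + t) + (eta * N2 (z - 0) + (- (eta * c) - b))).
Proof.
move=> eta0 vv HW fW b b0 z A q Wz qA [q0 hq].
have [Oz Ozt Nz vM] := HW z Wz.
have qB := quadD qA (quadD (quad_N2_shift (- eta) 0) (quad_cst n (eta * c + b))).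
have [|pB fB] := @vsub_translate R n _ _ _ t vv z _ _ Ozt qB.
  split; first by rewrite q0 subr0; ring.
  by apply: filterS hq => y; rewrite subr0; lra.
have hB := quad_herm qB; have AE : A = A + (((- eta)%:C)%:M + 0) + (eta%:C)%:M.
  by rewrite addr0 -addrA -raddfD -rmorphD addNr rmorph0 raddf0 addr0.
have := MA_scalar_ge hB pB (ltW eta0); rewrite -AE => MAA; split.
  by rewrite AE; apply: psdD => // w; rewrite hermitian_form_scalar mulr_ge0 ?N2_ge0 // ltW.
apply: le_trans MAA; apply: le_trans (lerD fB (lexx _)).
apply: le_trans (fW z _ Wz vM); apply: f_nd => //.
by rewrite subr0; nra.
Qed.

Lemma perron_translate (e : R) : 0 < e -> exists2 d : R, 0 < d &
  forall z w, closure Om z -> closure Om w -> N2 (w - z) < d -> perron w <= perron z + e.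
Proof.
move=> e0.
have clK : closed (closure Om) by exact: closed_closure.
have clo z : Om z -> closure Om z by move=> Oz; exact: subset_closure.
have [e1|[x cx]] : (forall z, ~ closure Om z) \/ closure Om !=set0.
  have [->|/set0P h] := eqVneq (closure Om) set0; [by left=> z []|by right].
  by exists 1; [exact: ltr01|move=> z w /e1].
have [c [M [c0 NC vM]]] : exists c M : R, [/\ 0 <= c, forall z, closure Om z -> N2 z <= c &
   forall v z, perron_family v -> closure Om z -> - M <= v z <= M].
  have [y1 cy1 h1] := compact_max cOm (ex_intro _ x cx) (fun z _ => continuous_cts_at _ _ (@N2_continuous R n)).
  have [y2 cy2 h2] := compact_max cOm (ex_intro _ x cx) cub.
  have [y3 cy3 h3] := compact_max cOm (ex_intro _ x cx) (fun z cz => cts_atN (cus cz)).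
  exists (N2 y1), (Num.max (ub y2) (- us y3)); split=> [||v z vF cz]; [exact: N2_ge0|exact: h1|].
  have := h2 z cz; have := h3 z cz; have := perron_family_le vF cz; have [_ _ /(_ z cz) + _] := vF.
  move=> a1 a2 a3 a4; rewrite lerNl !le_max.
  apply/andP; split; apply/orP; [right; lra|left; lra].
(* eta c <= e / 2 and b = e / 2: the lowering eta c + b of the translate is at most e. *)
pose eta := e / (2 * (c + 1)); have etac : eta * (2 * (c + 1)) = e by rewrite /eta divfK // gt_eqF //; lra.
have eta0 : 0 < eta by rewrite divr_gt0 //; lra.
pose b := e / 2; have b0 : 0 < b by rewrite /b; lra.
have kap0 : 0 < (2 * eta) ^+ n by rewrite exprn_gt0 //; lra.
have [d1 d10 hd1] := uniform_in_z cOm M f_cont kap0.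
have [us1 cus1 us1E] := tietzeN2 cOm clK ((withinN2P _ _).2 cus).
have [ub1 cub1 ub1E] := tietzeN2 cOm clK ((withinN2P _ _).2 cub).
have b2 : 0 < b / 2 by lra.
have [d2 d20 hd2] := @uniformly_continuousN2 R n _ us1 (b / 2) cOm (fun z _ => continuous_cts_at _ _ cus1) b2.
have [d3 d30 hd3] := @uniformly_continuousN2 R n _ ub1 (b / 2) cOm (fun z _ => continuous_cts_at _ _ cub1) b2.
exists (Num.min d1 (Num.min d2 d3)); first by rewrite !lt_min d10 d20.
move=> z w cz cw; rewrite !lt_min => /and3P[t1 t2 t3].
pose t := w - z; have zt : z + t = w by rewrite addrC subrK.
have Nt y : N2 (y + t - y) = N2 (w - z) by rewrite addrC addKr.
pose W : set 'CV[R]_n := [set y | Om y /\ Om (y + t)].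
(* Off W one of y and y + t lies outside Om: if y + t, then v = us there; if y, then v <= ub and ub
   = us at y. The bound b / 2, against the lowering b, makes V < us strictly, hence also nearby,
   which gives continuity of the glued function. *)
have edge v y : perron_family v -> closure Om y -> closure Om (y + t) -> ~ W y -> v (y + t) <= us y + b / 2.
  move=> vF cy cyt nW; have [Oy|nOy] := pselect (Om y).
    have nOt : ~ Om (y + t) by move=> Ot; apply: nW.
    have [_ _ _ ->//] := vF; have := hd2 y cy (y + t); rewrite Nt => /(_ t2).
    by rewrite !us1E // ltr_norml => /andP[]; lra.
  apply: le_trans (perron_family_le vF cyt) _; rewrite us_ub //.
  by have := hd3 y cy (y + t); rewrite Nt => /(_ t3); rewrite !ub1E // ltr_norml => /andP[]; lra.
apply: perron_le => v vF; have [cv vv usv vbd] := vF.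
have [Wz|nWz] := pselect (W z); last first.
  have := edge v z vF cz; rewrite zt => /(_ cw nWz).
  have := perron_ge perron_family_sub cz; rewrite /b; lra.
have [v1 cv1 v1E] := tietzeN2 cOm clK ((withinN2P _ _).2 cv).
pose V y := v1 (y + t) + (eta * N2 (y - 0) + (- (eta * c) - b)).
have cV : continuous V.
  apply: cts_add; first exact: translate_continuous.
  apply: cts_add; last exact: cts_cst.
  by apply: cts_mul; [exact: cts_cst|exact: N2_dist_continuous].
have oW : open W.
  apply/openN2P => y [Oy Oyt]; have [r1 r10 hr1] := (openN2P _).1 oOm y Oy.
  have [r2 r20 hr2] := (openN2P _).1 oOm _ Oyt.
  exists (Num.min r1 r2) => [|y']; first by rewrite lt_min r10.
  rewrite lt_min => /andP[/hr1 y1 y2]; split=> //; apply: hr2.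
  by rewrite opprD addrACA subrr addr0.
have vV : vsub (ma_ge f) W V.
  apply: (@vsub_ma_translate v1 t eta c M) => //; last exact: ltW.
  - by apply: vsub_eq vv => // y /clo/v1E.
  - move=> y [Oy Oyt]; have cyt := clo _ Oyt.
    split; [exact: Oy|exact: Oyt|exact: (NC _ (clo _ Oy))|].
    by rewrite (v1E _ cyt); exact: (vM _ _ vF cyt).
  - move=> y s [/clo cy /clo cyt] sM; have := hd1 y (y + t) s cy cyt; rewrite Nt => /(_ t1 sM).
    by rewrite ltr_norml => /andP[]; lra.
have WOm : W `<=` Om by move=> y [].
have gF : perron_family (glue W us V).
  split=> [y cy||y _|y cy nOy]; last 2 first.
  - exact: glue_ge.
  - by rewrite glue_out // => -[].
  - apply: cts_glue => //; first exact: cus.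
      by move=> _; exact: continuous_cts_at.
    move=> nW; have [cyt|ncyt] := pselect (closure Om (y + t)); last first.
      have [r r0 hr] := (openN2P _).1 (closed_openC clK) _ ncyt.
      exists r; first exact: r0.
      move=> y' [_ /clo Oyt'] yr; exfalso; apply: (hr (y' + t)) Oyt'.
      by rewrite opprD addrACA subrr addr0.
    have Vy : V y < us1 y.
      rewrite (us1E _ cy) /V (v1E _ cyt); have := edge v y vF cy cyt nW; have := NC y cy.
      rewrite subr0 => h1 h2; nra.
    have dd : 0 < us1 y - V y by lra.
    have [r r0 hr] := continuous_cts_at setT y (cts_sub cus1 cV) dd.
    exists r; first exact: r0.
    move=> y' [Oy' _] yr; rewrite -(us1E _ (clo _ Oy')).
    by have := hr y' I yr; rewrite ltr_norml => /andP[]; lra.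
  - exact: vsub_glue.
have := le_trans (glue_in us V Wz) (perron_ge gF cz).
rewrite /V zt (v1E _ cw) subr0; have := N2_ge0 z; rewrite /b => h1 h2; nra.
Qed.

Lemma perron_cts z : closure Om z -> cts_at (closure Om) perron z.
Proof.
move=> cz e e0; have e2 : 0 < e / 2 by lra.
have [d d0 hd] := perron_translate e2; exists d; first exact: d0.
move=> y cy yz; have h1 := hd z y cz cy yz.
by have := hd y z cy cz; rewrite N2C => /(_ yz) h2; rewrite ltr_norml; apply/andP; split; lra.
Qed.

Lemma MA_continuous A (e : R) : A \is hermsymmx -> 0 < e ->
  exists2 d : R, 0 < d & forall s : R, `|s| < d -> `|MA (A + (s%:C)%:M) - MA A| < e.
Proof.
move=> hA e0; have p0 : 0 < 2 ^+ n :> R by rewrite exprn_gt0.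
have /cvgrPdist_lt/(_ _ (divr_gt0 e0 p0))/nbhs_ballP[d /= d0 hd] := det_scalar_continuous hA (x := 0).
exists d => // s sd; have := hd s; rewrite /ball /= sub0r normrN => /(_ sd).
rewrite !MAE -mulrBr normrM (gtr0_norm p0) distrC addmx_scalar0 ltr_pdivlMr // mulrC //.
Qed.

(** Competitors almost attaining the supremum at z0 satisfy the one-sided hypotheses of
    [vsub_stable]. The inequality then holds at nearby points, values and Hessians, and f and the
    determinant are continuous. *)
Lemma perron_vsub : vsub (ma_ge f) Om perron.
Proof.
move=> z0 A q Oz0 qA tq; have clo z : Om z -> closure Om z by move=> Oz; exact: subset_closure.
have [r0 r00 hr0] := (openN2P _).1 oOm z0 Oz0; have hA := quad_herm qA.
have key e : 0 < e -> exists (z1 : 'CV[R]_n) (s : R), [/\ Om z1, N2 (z1 - z0) < e,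
    `|s - perron z0| <= e & ma_ge f z1 s (A + (e%:C)%:M)].
  move=> e0; have [d d0|z1 [v [h1 h2 h3 _ h4]]] := @vsub_stable R n (ma_ge f) _ _ _ _ _ _ qA tq r00 _ e0; last first.
    by exists z1, (v z1); split=> //; exact: hr0.
  have [v [cv vv usv bv] hv] := perron_approx (clo _ Oz0) d0.
  exists v; split.
  - by apply: vsub_subset vv => z /hr0.
  - move=> z /hr0/clo cz; apply: (@cts_at_sub _ _ (closure Om)) (cv z cz) => y /hr0/clo //.
  - move=> z /hr0/clo cz; apply: le_trans (perron_ge _ cz) _; first by split.
    by rewrite lerDl ltW.
  - exact: ltW.
split.
  move=> w; apply: (@le_mulr_eps R 0 _ (N2 w)) => [|e e0]; first exact: N2_ge0.
  have [z1 [s [_ _ _ [pw _]]]] := key e e0; have := pw w.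
  by rewrite hermitian_formD hermitian_form_scalar mulrC.
rewrite leNgt; apply/negP => lt; pose g := (f z0 (perron z0) - MA A) / 2.
have g0 : 0 < g by rewrite /g; lra.
have [r r1 hr] := f_cont (perron z0) (clo _ Oz0) g0.
have [d d0 hd] := MA_continuous hA g0.
pose e := Num.min r d / 2; have m0 : 0 < Num.min r d by rewrite lt_min r1.
have e0 : 0 < e by rewrite /e; lra.
have er : e < r by apply: (@lt_le_trans _ _ (Num.min r d)); [rewrite /e; lra|rewrite ge_min lexx].
have ed : e < d by apply: (@lt_le_trans _ _ (Num.min r d)); [rewrite /e; lra|rewrite ge_min lexx orbT].
have [z1 [s [Oz1 z1e se [_ fA]]]] := key e e0.
have := hr z1 s (clo _ Oz1) (lt_trans z1e er) (le_lt_trans se er).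
have := hd e; rewrite gtr0_norm // => /(_ ed).
rewrite !ltr_norml => /andP[h1 h2] /andP[h3 h4]; move: h1 h2 h3 h4; rewrite /g; lra.
Qed.

Lemma perron_in_family : perron_family perron.
Proof.
split; [exact: perron_cts|exact: perron_vsub| |].
  by move=> z cz; exact: perron_ge perron_family_sub cz.
move=> z cz nOz; apply/eqP; rewrite eq_le (perron_ge perron_family_sub cz) andbT.
by apply: perron_le => v [_ _ _ bv]; rewrite bv.
Qed.

Lemma MA_le B C : B \is hermsymmx -> C \is hermsymmx -> psd B -> psd (C - B) -> MA B <= MA C.
Proof.
move=> hB hC pB pCB; have hCB : C - B \is hermsymmx.
  have -> : C - B = C + (-1)%:C *: B by rewrite rmorphN scaleN1r.
  exact: (hermD hC (hermZ _ hB)).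
have := det_mono n0 hB hCB pB pCB; rewrite [B + _]addrC subrK => h.
by rewrite !MAE; apply: ler_wpM2l => //; exact: exprn_ge0.
Qed.

Lemma perron_supersolution z0 A q : Om z0 -> quad A q -> psd A -> touches_below q perron z0 ->
  MA A <= f z0 (perron z0).
Proof.
move=> Oz0 qA pA [q0 /nbhsN2P[r1 r10 hr1]]; have clo z : Om z -> closure Om z by move=> Oz; exact: subset_closure.
have cz0 := clo _ Oz0; have hA := quad_herm qA.
rewrite leNgt; apply/negP => lt; pose g := (MA A - f z0 (perron z0)) / 2.
have g0 : 0 < g by rewrite /g; lra.
have dA : 0 < complex.Re (\det A).
  have : 0 < MA A by apply: le_lt_trans lt; exact: f_ge0.
  by rewrite MAE pmulr_rgt0 // exprn_gt0.
have [s1 s10 ps1] := psd_sub_scalar n0 hA pA dA.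
have [d d0 hd] := MA_continuous hA g0.
have [r2 r20 hr2] := f_cont (perron z0) cz0 g0.
have [r3 r30 hr3] := (openN2P _).1 oOm z0 Oz0.
(* Lowering the Hessian by k keeps it positive, as k < s1, and keeps its Monge-Ampere value within g
   of that of A, as k < d. *)
pose k := Num.min s1 d / 2; have m0 : 0 < Num.min s1 d by rewrite lt_min s10.
have k0 : 0 < k by rewrite /k; lra.
have ks : k < s1 by apply: (@lt_le_trans _ _ (Num.min s1 d)); [rewrite /k; lra|rewrite ge_min lexx].
have kd : k < d by apply: (@lt_le_trans _ _ (Num.min s1 d)); [rewrite /k; lra|rewrite ge_min lexx orbT].
pose B := A + ((- k)%:C)%:M.
have hB : B \is hermsymmx by apply: hermD => //; exact: herm_scalar.
have pB : psd B.
  have -> : B = (A + ((- s1)%:C)%:M) + ((s1 - k)%:C)%:M.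
    by rewrite /B -addrA -raddfD -rmorphD; congr (_ + _%:C%:M); ring.
  by apply: psdD => // w; rewrite hermitian_form_scalar mulr_ge0 ?N2_ge0 //; lra.
have MB : MA A - g < MA B.
  by have := hd (- k); rewrite normrN gtr0_norm // => /(_ kd); rewrite ltr_norml => /andP[]; lra.
have r20' : 0 < r2 / 2 by lra.
have [r4 r40 hr4] := continuous_cts_at setT z0 (quad_continuous qA) r20'.
pose m := Num.min (Num.min r1 r2) (Num.min r3 r4).
have mpos : 0 < m by rewrite /m !lt_min r10 r20 r30.
(* The second bound gives k r < r2 / 2, so the values of V stay within r2 of the envelope at z0 and
   f changes by less than g. *)
pose r := Num.min m (r2 / (k + 1)) / 2.
have mm0 : 0 < Num.min m (r2 / (k + 1)) by rewrite lt_min mpos divr_gt0 //; lra.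
have rpos : 0 < r by rewrite /r; lra.
have rm : r < m by apply: (@lt_le_trans _ _ (Num.min m (r2 / (k + 1)))); [rewrite /r; lra|rewrite ge_min lexx].
have rk : k * r < r2 / 2.
  have : r <= r2 / (k + 1) / 2 by rewrite /r ler_pM2r ?invr_gt0 // ge_min lexx orbT.
  rewrite ler_pdivlMr // ler_pdivlMr; [nra|lra].
have rm' : [/\ r < r1, r < r2, r < r3 & r < r4].
  by move: rm; rewrite /m !lt_min => /andP[/andP[-> ->] /andP[-> ->]].
have [rr1 rr2 rr3 rr4] := rm'.
pose W := [set z | N2 (z - z0) < r].
have WOm : W `<=` Om by move=> z zr; apply: hr3; exact: lt_trans zr rr3.
(* V exceeds the envelope by k r / 2 at z0, and lies below q, hence below the envelope, once |z -
   z0|^2 > r / 2 in W. *)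
pose V z := q z + ((- k) * N2 (z - z0) + k * r / 2).
have qV : quad B V.
  have := quadD qA (quadD (quad_N2_shift (- k) z0) (quad_cst n (k * r / 2))).
  by rewrite addr0.
have vV : vsub (ma_ge f) W V.
  move=> z C p Wz pC [p0 hp].
  (* A quadratic touching V from above has Hessian C >= B, so the inequality for B suffices. *)
  have pCB : psd (C - B).
    apply: (tay_below_quad (quad_tay z qV) pC).
    by apply: filterS hp => y; rewrite p0 subrr subr_le0.
  have hC := quad_herm pC; split; first by have := psdD pB pCB; rewrite addrC subrK.
  have MC := MA_le hB hC pB pCB.
  have Oz := WOm _ Wz; have Vz : `|V z - perron z0| < r2.
    have := hr4 z I (lt_trans Wz rr4); rewrite -q0 /V; have := N2_ge0 (z - z0); have w1 : N2 (z - z0) < r := Wz.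
    have kN : k * N2 (z - z0) <= k * r by rewrite ler_pM2l // ltW.
    have kN0 : 0 <= k * N2 (z - z0) by rewrite mulr_ge0 ?N2_ge0 // ltW.
    by rewrite !ltr_norml => h1 /andP[h2 h3]; apply/andP; split; lra.
  have := hr2 z (V z) (clo _ Oz) (lt_trans Wz rr2) Vz; rewrite ltr_norml => /andP[h1 h2].
  apply: le_trans MC; apply: le_trans (ltW MB); move: h2; rewrite /g; lra.
have [cP vP usP bP] := perron_in_family.
have gF : perron_family (glue W perron V).
  split=> [y cy||y cy|y cy nOy].
  - apply: cts_glue; [exact: open_ballN2|exact: perron_cts| |].
      by move=> _; exact: continuous_cts_at (quad_continuous qV).
    move=> nW; have yr : r <= N2 (y - z0) by rewrite leNgt; apply/negP.
    have rh : 0 < r / 2 by lra.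
    have [s s0 hs] := continuous_cts_at setT y (@N2_dist_continuous R n z0) rh.
    exists s; first exact: s0.
    move=> y' Wy' ys; have := hs y' I ys; have := hr1 y' (lt_trans Wy' rr1).
    by rewrite /V ltr_norml => h1 /andP[h2 h3]; nra.
  - apply: vsub_glue => //; exact: open_ballN2.
  - exact: le_trans (usP y cy) (glue_ge _ _ _ _).
  - by rewrite glue_out; [exact: bP|move=> /WOm].
have Wz0 : W z0 by rewrite /W /= subrr N2_0.
have := le_trans (glue_in perron V Wz0) (perron_ge gF cz0).
rewrite /V subrr N2_0 q0; nra.
Qed.

End Perron.

(** * From the definitions of the statement to Hessian conditions, and the Dirichlet problem *)

Section Dirichlet.
Variables (R : realType) (n : nat) (n0 : (0 < n)%N) (Om : set 'CV[R]_n) (f : 'CV[R]_n -> R -> R).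
Implicit Types (z w : 'CV[R]_n) (u v q : 'CV[R]_n -> R) (A : 'M[R[i]]_n).
Hypotheses (oOm : open Om).

Lemma boundary_open z : boundary Om z <-> closure Om z /\ ~ Om z.
Proof. by rewrite /boundary (interior_id _).1. Qed.

Lemma within_prod_continuous (K : set 'CV[R]_n) :
    {within K `*` [set: R], continuous (fun x : 'CV[R]_n * R => f x.1 x.2)} ->
  forall z t, K z -> forall e : R, 0 < e -> exists2 r : R, 0 < r &
    forall z' t', K z' -> N2 (z' - z) < r -> `|t' - t| < r -> `|f z' t' - f z t| < e.
Proof.
move=> /subspace_continuousP H z t Kz e e0.
have /cvgrPdist_lt/(_ e e0) := H (z, t) (conj Kz I).
rewrite near_withinE => -[[Q1 Q2] /= [/nbhsN2P[r1 r10 h1] /nbhs_ballP[r2 /= r20 h2]] h].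
exists (Num.min r1 r2) => [|z' t' Kz']; first by rewrite lt_min r10.
rewrite !lt_min => /andP[zr _] /andP[_ tr]; rewrite distrC.
apply: (h (z', t')) => //=; split; first exact: h1.
by apply: h2; rewrite /ball /= distrC.
Qed.

Lemma subsolution_vsub_ma v : viscosity_subsolution Om f v -> vsub (ma_ge f) Om v.
Proof.
move=> sv; have [[/withinN2P cv pv] _] := sv; apply: subsolution_vsub sv => z A q.
exact: psh_touching_psd.
Qed.

Lemma supersolutionP v : continuous_psh Om v ->
  viscosity_supersolution Om f v <->
  (forall z A q, Om z -> quad A q -> psd A -> touches_below q v z -> MA A <= f z (v z)).
Proof.
move=> cpv; split=> [[_ sv] z A q Oz [hA [h hh ->]] pA tq|H].
  rewrite -(MC_hermitian_form z hA); apply: sv => //; last by exists h.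
  by exists A => //; apply/nonneg_hermitianP.
split=> // _ [A /nonneg_hermitianP[hA pA] <-] z Oz [h hh tq].
by rewrite MC_hermitian_form //; apply: H tq => //; split=> //; exists h.
Qed.

End Dirichlet.

Local Close Scope complex_scope.

Theorem theorem1p3 (R : realType) (n : nat) (hn : (0 < n)%N)
  (Om : set 'CV[R]_n) (hOm : bounded_domain Om)
  (g : 'CV[R]_n -> R) (hg : {within boundary Om, continuous g})
  (f : 'CV[R]_n -> R -> R)
  (hf_cont : {within closure Om `*` [set: R],
                continuous (fun x : 'CV[R]_n * R => f x.1 x.2)})
  (hf_ge0 : forall z, closure Om z -> forall t, 0 <= f z t)
  (hf_nd : forall z, Om z -> {homo f z : s t / s <= t})
  (h_harmonic : exists ubar : 'CV[R]_n -> R,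
     [/\ {within closure Om, continuous ubar}, harmonic_on Om ubar
       & forall z, boundary Om z -> ubar z = g z])
  (h_sub : exists usub : 'CV[R]_n -> R,
     [/\ {within closure Om, continuous usub},
         viscosity_subsolution Om f usub
       & forall z, boundary Om z -> usub z = g z]) :
  exists u : 'CV[R]_n -> R,
    dirichlet_solution Om f g u /\
    forall v : 'CV[R]_n -> R, dirichlet_solution Om f g v ->
      forall z, closure Om z -> v z = u z.
Proof.
have [oOm _ _ /bounded_closureN2 cOm] := hOm.
have f_cont := within_prod_continuous hf_cont.
have [ub [/withinN2P cub hub bub]] := h_harmonic.
have [us [/withinN2P cus sus bus]] := h_sub.
have vus := subsolution_vsub_ma oOm sus.
have us_ub z : closure Om z -> ~ Om z -> us z = ub z.
  by move=> cz nOz; have bz := (boundary_open oOm z).2 (conj cz nOz); rewrite bus // bub.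
have fz0 z t : closure Om z -> 0 <= f z t by move=> cz; exact: hf_ge0.
have [cu vu usu bu] := perron_in_family hn oOm cOm f_cont hf_nd cus cub vus hub us_ub.
have su := perron_supersolution hn oOm cOm f_cont fz0 hf_nd cus cub vus hub us_ub.
pose u := perron Om f us; rewrite -/u in cu vu usu bu su.
have pu : psh Om (EFin \o u).
  (* The half A >= 0 of [ma_ge] is the viscosity form of plurisubharmonicity. *)
  apply: (vsub_psh hn oOm cOm cu); apply: vsub_weaken vu => z s A _ _ [] //.
have cpu : continuous_psh Om u.
  split=> //; apply/withinN2P => z Oz.
  apply: (@cts_at_sub _ _ (closure Om)) (cu z (subset_closure Oz)); exact: subset_closure.
exists u; split.
  split=> //; last 2 first.
  - exact/withinN2P.
  - by move=> z bz; have [cz nOz] := (boundary_open oOm z).1 bz; rewrite bu // bus.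
  - by split; [exact: vsub_subsolution|exact/supersolutionP].
move=> v [[sv1 sv2] pv /withinN2P cv bv] z cz.
have cpv : continuous_psh Om v by case: sv1.
have buv y : closure Om y -> ~ Om y -> u y = v y.
  by move=> cy nOy; have by_ := (boundary_open oOm y).2 (conj cy nOy); rewrite bu // bus // bv.
apply/eqP; rewrite eq_le; apply/andP; split.
  apply: (comparison_principle hn oOm cOm f_cont fz0 hf_nd cv cu) cz => //.
    exact: subsolution_vsub_ma.
  by move=> y cy nOy; rewrite buv.
apply: (comparison_principle hn oOm cOm f_cont fz0 hf_nd cu cv) cz => //.
  exact/(supersolutionP f cpv).
by move=> y cy nOy; rewrite buv.
Qed.
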